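(* Consider an $L$-layer DCFNet with Fourier–Bessel (FB) bases (as defined in the context), with $L$-th layer filters supported at scale $j_L$. Let $\tau:\mathbb{R}^2\to\mathbb{R}^2$ be $C^2$ with $|\nabla\tau|_\infty:=\sup_u\|\nabla\tau(u)\|<\frac15$ (operator norm), let $|\tau|_\infty=\sup_u|\tau(u)|$, $\rho(u)=u-\tau(u)$, and $D_\tau x(u,\lambda)=x(\rho(u),\lambda)$. Suppose the nonlinearity $\sigma:\mathbb{R}\to\mathbb{R}$ is non-expansive, i.e. $|\sigma(s)-\sigma(t)|\le|s-t|$ for all $s,t$. Suppose moreover that for all $l=1,\dots,L$, $$A_l:=\pi\max\Big\{\sup_\lambda\sum_{\lambda'=1}^{M_{l-1}}\|a^{(l)}_{\lambda',\lambda}\|_{FB},\ \sup_{\lambda'}\frac{M_{l-1}}{M_l}\sum_{\lambda=1}^{M_l}\|a^{(l)}_{\lambda',\lambda}\|_{FB}\Big\}\le1.$$ Then $$\big\|x^{(L)}[x^{(0)}]-x^{(L)}[D_\tau x^{(0)}]\big\|\le\big(8L\,|\nabla\tau|_\infty+2\cdot2^{-j_L}|\tau|_\infty\big)\|x^{(0)}\|.$$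
   Context: Write $[M]=\{1,\dots,M\}$. A CNN with $L$ layers and channel numbers $M_0,\dots,M_L\ge1$ maps an input $x^{(0)}(u,\lambda)$, $u\in\mathbb{R}^2$, $\lambda\in[M_0]$, to $x^{(L)}(u,\lambda)$, $u\in\mathbb{R}^2,\lambda\in[M_L]$, recursively for $l=1,\dots,L$ by $$x^{(l)}(u,\lambda)=\sigma\Big(\sum_{\lambda'=1}^{M_{l-1}}\int_{\mathbb{R}^2}W^{(l)}_{\lambda',\lambda}(v')\,x^{(l-1)}(u+v',\lambda')\,dv'+b^{(l)}(\lambda)\Big),$$ with filters $W^{(l)}_{\lambda',\lambda}:\mathbb{R}^2\to\mathbb{R}$ and biases $b^{(l)}(\lambda)\in\mathbb{R}$. $x^{(L)}[x^{(0)}]$ denotes the output of the $L$-layer network with input $x^{(0)}$. The input is real-valued, square-integrable and supported on the square domain $\Omega$ of side $2\cdot2^J$. Suprema over $\lambda$ are over $[M_l]$ and over $\lambda'$ are over $[M_{l-1}]$. For a function $x(u,\lambda)$, $u\in\mathbb{R}^2$, $\lambda\in[M]$, the norm is $$\|x\|^2=\frac1M\sum_{\lambda\in[M]}\frac1{|\Omega|}\int_{\mathbb{R}^2}|x(u,\lambda)|^2du,\qquad |\Omega|=(2\cdot2^J)^2.$$ FB bases: in polar coordinates on the unit disk $D\subset\mathbb{R}^2$, $\psi_{m,q}(r,\theta)=c_{m,q}J_m(R_{m,q}r)e^{im\theta}$, where $J_m$ is the Bessel function of the first kind, $m$ an integer, $q=1,2,\dots$, and $R_{m,q}$ is the $q$-th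 positive root of $J_m$. The real-valued FB bases $\{\psi_k\}_{k\ge1}$ are obtained from the real and imaginary parts (one function for each $(0,q)$; two, with $\cos m\theta$ and $\sin m\theta$, for each $(m,q)$ with $m\ge1$), normalized so that $\int_D\psi_k\psi_{k'}\,du=\pi\delta_{k,k'}$. They form an orthogonal basis of $L^2(D)$ consisting of Dirichlet Laplacian eigenfunctions: $-\Delta\psi_k=\mu_k\psi_k$ on $D$, $\psi_k=0$ on $\partial D$, with $\mu_k=R_{m,q}^2$ for $k$ corresponding to $(m,q)$; they are ordered so that $\mu_k$ is nondecreasing. For real coefficients $a=(a_k)_k$, $\|a\|_{FB}=(\sum_k\mu_ka_k^2)^{1/2}$. DCFNet with FB bases: a CNN for which there are scales $j_0\le j_1\le\cdots\le j_L\le J$ such that each filter $W^{(l)}_{\lambda',\lambda}$ is supported on the disk $D(j_l)$ of radius $2^{j_l}$ centered at the origin, vanishes on its boundary (and is extended by zero outside), is smooth on the closed disk, and $$W^{(l)}_{\lambda',\lambda}(u)=\sum_k(a^{(l)}_{\lambda',\lambda})_k\,\psi_{j_l,k}(u),\quad u\in D(j_l),\qquad \psi_{j,k}(u)=2^{-2j}\psi_k(2^{-j}u),$$ with real coefficient sequences $a^{(l)}_{\lambda',\lambda}=((a^{(l)}_{\lambda',\lambda})_k)_k$ (in particular any truncated, i.e. finite, expansion qualifies). *)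

(* Defs.v *)
From HB Require Import structures.
From mathcomp Require Import all_boot all_order all_algebra.
From mathcomp Require Import all_classical all_reals all_analysis.

Set Implicit Arguments.
Unset Strict Implicit.
Unset Printing Implicit Defensive.

Import Order.TTheory GRing.Theory Num.Theory.
Import numFieldNormedType.Exports.

Local Open Scope classical_set_scope.
Local Open Scope ring_scope.

Section Plane.
Context {R : realType}.

Definition leb2 :
    {measure set (measurableTypeR R * measurableTypeR R) -> \bar R} :=
  ((@lebesgue_measure R) \x (@lebesgue_measure R))%E.

(* The library norm on R * R is the max norm, hence this separate notion. *)
Definition enorm (u : R * R) : R := Num.sqrt (u.1 ^+ 2 + u.2 ^+ 2).

Definition disk (r : R) : set (R * R) := [set u | enorm u <= r].

Fixpoint is_Ck (V : normedModType R) (n : nat) (f : R * R -> V) : Prop :=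
  if n is n'.+1 then
    [/\ forall u, derivable f u (1, 0) /\ derivable f u (0, 1),
        is_Ck n' ('D_(1, 0) f) & is_Ck n' ('D_(0, 1) f)]
  else continuous f.

(* Smoothness up to the boundary: restriction of a smooth function on R^2. *)
Definition smooth_on (A : set (R * R)) (f : R * R -> R) : Prop :=
  exists2 g : R * R -> R, (forall n, is_Ck n g) & forall u, A u -> f u = g u.

Local Open Scope ereal_scope.

Definition opnorm (f : R * R -> R * R) : \bar R :=
  ereal_sup [set (enorm (f v))%:E | v in disk 1].

Definition grad_sup (tau : R * R -> R * R) : \bar R :=
  ereal_sup (range (fun u => opnorm ('d tau u))).

(* May be +oo: tau need not be bounded.  In products, +oo * 0 = 0. *)
Definition sup_norm (tau : R * R -> R * R) : \bar R :=
  ereal_sup (range (fun u => (enorm (tau u))%:E)).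

End Plane.

Section FourierBessel.
Context {R : realType}.

Definition besselJ (m : nat) (x : R) : R :=
  limn (series (fun i : nat =>
    (-1) ^+ i / (i`! * (i + m)`!)%:R * (x / 2) ^+ (2 * i + m))).

Definition is_nth_pos_root (f : R -> R) (q : nat) (r : R) : Prop :=
  [/\ 0 < r, f r = 0 & ([set s | 0 < s < r /\ f s = 0] #= `I_q.-1)%card].

(* (m, q, true) stands for cos (m theta), (m, q, false) for sin (m theta). *)
Definition fb_index : set (nat * nat * bool) :=
  [set i | (0 < i.1.2)%N /\ (i.1.1 = 0%N -> i.2 = true)].

Definition fb_angular (m : nat) (s : bool) (theta : R) : R :=
  if s then cos (m%:R * theta) else sin (m%:R * theta).

(* A system of real Fourier-Bessel functions on the closed unit disk.  The
   enumeration starts at 0 instead of 1; it is arbitrary among those with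
   nondecreasing eigenvalues, because eigenvalues are not simple.  Stating
   fb_psi_polar for all theta avoids an argument function; it is consistent at
   r = 0, where besselJ m vanishes for m >= 1. *)
Record FB_basis := {
  fb_root : nat -> nat -> R;
  fb_rootP : forall m q, (0 < q)%N ->
    is_nth_pos_root (besselJ m) q (fb_root m q);
  fb_enum : nat -> nat * nat * bool;
  fb_enum_bij : set_bij [set: nat] fb_index fb_enum;
  fb_const : nat -> R;
  fb_psi : nat -> R * R -> R;
  fb_psi_polar : forall (k : nat) (r theta : R), 0 <= r <= 1 ->
    let: (m, q, s) := fb_enum k in
    fb_psi k (r * cos theta, r * sin theta) =
      fb_const k * besselJ m (fb_root m q * r) * fb_angular m s theta;
  fb_psi_normalized : forall k k',
    \int[leb2]_(u in disk 1) (fb_psi k u * fb_psi k' u) = pi * (k == k')%:R;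
  fb_mu : nat -> R;
  fb_muE : forall k, let: (m, q, _) := fb_enum k in fb_mu k = fb_root m q ^+ 2;
  fb_mu_nondecreasing : {homo fb_mu : k k' / (k <= k')%N >-> k <= k'}
}.

End FourierBessel.

Arguments FB_basis R : clear implicits.

Section Filters.
Context {R : realType}.

Definition psi_scaled (B : FB_basis R) (j : R) (k : nat) (u : R * R) : R :=
  2 `^ (- (2 * j)) * fb_psi B k (2 `^ (- j) * u.1, 2 `^ (- j) * u.2).

Definition FB_norm (B : FB_basis R) (a : nat -> R) : \bar R :=
  poweR (\sum_(k <oo) (fb_mu B k * a k ^+ 2)%:E)%E 2^-1.

(* The filter is the sum of its expansion in L^2 of the disk.  When a has finite
   FB_norm, this is implied by pointwise convergence on the disk. *)
Definition is_FB_filter (B : FB_basis R) (j : R) (a : nat -> R)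
    (w : R * R -> R) : Prop :=
  [/\ forall u, 2 `^ j <= enorm u -> w u = 0,
      smooth_on (disk (2 `^ j)) w
    & (fun n => \int[leb2]_(u in disk (2 `^ j))
         ((w u - \sum_(k < n) a k * psi_scaled B j k u) ^+ 2)%:E)%E
      @ \oo --> 0%E].

End Filters.

Section Network.
Context {R : realType}.

(* The layer l >= 1 uses W l and b l; the indices W 0 and b 0 are unused. *)
Fixpoint cnn (sigma : R -> R) (M : nat -> nat)
    (W : forall l, 'I_(M l.-1) -> 'I_(M l) -> R * R -> R)
    (b : forall l, 'I_(M l) -> R)
    (x0 : R * R -> 'I_(M 0%N) -> R) (l : nat) : R * R -> 'I_(M l) -> R :=
  match l return R * R -> 'I_(M l) -> R with
  | 0 => x0
  | l'.+1 => fun u lam =>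
      sigma (\sum_(lam' < M l')
               \int[leb2]_v (W l'.+1 lam' lam v * @cnn sigma M W b x0 l' (u + v) lam')
             + b l'.+1 lam)
  end.

Definition Omega (J : R) : set (R * R) :=
  [set u | `|u.1| <= 2 `^ J /\ `|u.2| <= 2 `^ J].

Definition Omega_area (J : R) : R := (2 * 2 `^ J) ^+ 2.

Definition signal_norm (J : R) (m : nat) (x : R * R -> 'I_m -> R) : \bar R :=
  poweR ((m%:R^-1)%:E * \sum_(lam < m)
           ((Omega_area J)^-1)%:E * \int[leb2]_u (`|x u lam| ^+ 2)%:E)%E 2^-1.

Definition is_input (J : R) (m : nat) (x : R * R -> 'I_m -> R) : Prop :=
  forall lam,
    [/\ measurable_fun [set: R * R] (fun u => x u lam),
        leb2.-integrable [set: R * R] (fun u => (x u lam ^+ 2)%:E)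
      & forall u, ~ Omega J u -> x u lam = 0].

Definition deform (tau : R * R -> R * R) (m : nat) (x : R * R -> 'I_m -> R) :
    R * R -> 'I_m -> R :=
  fun u lam => x (u - tau u) lam.

Definition is_DCFNet (B : FB_basis R) (L : nat) (J : R) (j : nat -> R)
    (M : nat -> nat) (W : forall l, 'I_(M l.-1) -> 'I_(M l) -> R * R -> R)
    (a : forall l, 'I_(M l.-1) -> 'I_(M l) -> nat -> R) : Prop :=
  [/\ forall l, (l <= L)%N -> (0 < M l)%N,
      forall l, (l < L)%N -> j l <= j l.+1,
      j L <= J
    & forall l, (1 <= l <= L)%N -> forall lam' lam,
        is_FB_filter B (j l) (a l lam' lam) (W l lam' lam)].

Definition A_const (B : FB_basis R) (M : nat -> nat)
    (a : forall l, 'I_(M l.-1) -> 'I_(M l) -> nat -> R) (l : nat) : \bar R :=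
  (pi%:E * maxe
     (ereal_sup (range (fun lam => \sum_(lam' < M l.-1) FB_norm B (a l lam' lam))))
     (ereal_sup (range (fun lam' => ((M l.-1)%:R / (M l)%:R)%:E *
        \sum_(lam < M l) FB_norm B (a l lam' lam)))))%E.

End Network.

Arguments cnn {R} sigma {M} W b x0 l u lam.

(* Main.v *)
(**
The FB norm of a filter is its Dirichlet energy.  Comparing the filter with the
partial sums of its expansion through Green's identity gives
int |grad w|^2 = pi F^2 2^(-4j) on D(j), where F = ||a||_FB.  By Cauchy-Schwarz
||grad w||_1 <= sqrt 2 (pi F) 2^(-j), and, since w vanishes outside the disk, integrating
along chords gives ||w||_1 <= pi F.  Each layer is thus controlled by kernels whose
L^1 norms, summed over channels, are those of the hypothesis A_l <= 1, and Schur's test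
turns L^1 bounds of kernels into L^2 bounds.

Write rho u = u - tau u, with Jacobian determinant J, and g = |grad tau|_oo.
- A layer is nonexpansive: kernel w (v - u).
- A layer commutes with D_tau up to 8 g: after the change of variables v -> rho v the
  kernel is w (rho v - rho u) J v - w (v - u), and the points rho v - rho u and v - u are
  joined by the segment of the differences v - u - s (tau v - tau u), on which w varies
  little; moreover |J - 1| <= 2 g + g^2.
- The last layer satisfies ||y - D_tau y|| <= 2 2^(-j_L) |tau|_oo ||x0||:
  kernel w (v - u) - w (v - rho u).
The commutators of the L layers add up to 8 L g.  All outputs differ from constants (the
outputs for the zero input) by L^2 functions of norm at most that of the input, and
constants cancel in all the differences above.
*)
Require Import Defs.
From HB Require Import structures.
From mathcomp Require Import all_boot all_order all_algebra.
From mathcomp Require Import all_classical all_reals all_analysis.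
From mathcomp Require Import measurable_realfun ring lra.

Set Implicit Arguments.
Unset Strict Implicit.
Unset Printing Implicit Defensive.

Import Order.TTheory GRing.Theory Num.Theory.
Import numFieldNormedType.Exports.

Local Open Scope classical_set_scope.
Local Open Scope ring_scope.

(** * Integration and differentiation in the plane *)

(** A filter is smooth inside its disk and zero outside, but in general not differentiable across
    the circle, so no pointwise gradient bound holds on the plane. Regularity is therefore expressed
    by integrals of the gradient along segments, and Tonelli's theorem turns these into L^1 bounds
    of kernels. When the variable of integration is one on which tau acts, the points of the segment
    are reached through the maps u - s tau(u), 0 <= s <= 1, whose Jacobians are at least (1 - g)^2.

    This fixes the constants. In the commutator, 1 / (1 - g) comes from comparing a displacement
    with the radius of the filter, (1 - g)^-2 from the Jacobian, and 1 / (1 - g) from the norm of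
    D_tau on the input. Together they give g (sqrt 2 + (2 + g) (1 - g)) / (1 - g)^4. With sqrt 2 <=
    3/2 the factor of g is about 7.96 at g = 1/5: this is how 8 and 1/5 are matched. In the last
    layer only one of the two marginals of the kernel meets a Jacobian, and Schur's test gives sqrt
    2 / (1 - g) <= 2. *)

Lemma open_measurable_prod (R : realType) (U : set (R * R)) : open U ->
  measurable (U : set (measurableTypeR R * measurableTypeR R)).
Proof.
move=> oU.
(* Boxes with rational centres and radii 1 / (n + 1): there are countably many, and those contained
   in [U] cover it. *)
pose box (i : rat * rat * nat) : set (R * R) :=
  ball (ratr i.1.1 : R) i.2.+1%:R^-1 `*` ball (ratr i.1.2 : R) i.2.+1%:R^-1.
pose F i : set (measurableTypeR R * measurableTypeR R) :=
  if pselect (box i `<=` U) then box i else set0.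
have -> : U = \bigcup_i F i.
  apply/seteqP; split => [[x y] Uxy|z [i _]]; last first.
    by rewrite /F; case: pselect => // h; exact: h.
  have [e /= e0 he] : nbhs_ball (x, y) U by apply/nbhs_ballP; exact: oU.
  have [n hn] : exists n : nat, (n.+1%:R^-1 : R) < e / 2.
    exists (Num.truncn (e / 2)^-1).
    rewrite -[ltRHS]invrK ltf_pV2 ?posrE ?invr_gt0 ?divr_gt0//.
    exact: Num.Theory.truncnS_gt.
  have n0 : 0 < (n.+1%:R^-1 : R) by rewrite invr_gt0.
  have P (z : R) : exists q : rat, `|z - ratr q| < n.+1%:R^-1.
    have [q] := rat_in_itvoo (ltr_pwDr n0 (lexx z)).
    rewrite in_itv/= => /andP[zq qz]; exists q.
    by rewrite ltr0_norm ?subr_lt0// opprB ltrBlDl.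
  have [p hp] := P x; have [q hq] := P y.
  exists (p, q, n) => //; rewrite /F; case: pselect => [?|].
    by split; rewrite /ball /= distrC.
  case; move=> [a b] [/= ha hb]; apply: he; split; rewrite /ball /= in ha hb *.
    rewrite -(subrKA (ratr p)) (le_lt_trans (ler_normD _ _))//.
    by rewrite [ltRHS]splitr ltrD// (lt_trans _ hn).
  rewrite -(subrKA (ratr q)) (le_lt_trans (ler_normD _ _))//.
  by rewrite [ltRHS]splitr ltrD// (lt_trans _ hn).
apply: countable_bigcupT_measurable; first exact: countableP.
move=> i; rewrite /F; case: pselect => [?|?]; last exact: measurable0.
by apply: measurableX; exact: measurable_ball.
Qed.

Lemma continuous_measurable_prod (R : realType) (f : R * R -> R) :
  continuous f ->
  measurable_fun [set: measurableTypeR R * measurableTypeR R] f.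
Proof.
move=> /continuousP cf; apply: (measurability _ (RGenOpens.measurableE R)).
move=> _ [_ [a [b ->] <-]]; rewrite setTI.
by apply: open_measurable_prod; exact/cf/interval_open.
Qed.

(** * Image of a measure with a density *)

Section density.
Local Open Scope ereal_scope.
Context d1 d2 (X : measurableType d1) (Y : measurableType d2) (R : realType).
Variables (phi : X -> Y) (mphi : measurable_fun [set: X] phi).
Variables (mu : {measure set X -> \bar R}) (w : X -> R).
Hypotheses (mw : measurable_fun [set: X] w) (w0 : forall x, (0 <= w x)%R).

Definition weighted_pushforward (A : set Y) : \bar R :=
  \int[mu]_(x in phi @^-1` A) (w x)%:E.

Let nu0 : weighted_pushforward set0 = 0.
Proof. by rewrite /weighted_pushforward preimage_set0 integral_set0. Qed.

Let nu_ge0 A : 0 <= weighted_pushforward A.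
Proof. by apply: integral_ge0 => x _; rewrite lee_fin. Qed.

Let nu_sigma_additive : semi_sigma_additive weighted_pushforward.
Proof.
move=> /= F mF tF mUF; rewrite /weighted_pushforward; apply: cvg_toP.
  apply: ereal_nondecreasing_is_cvgn => m n mn.
  apply: lee_sum_nneg_natr => // k _ _; exact: nu_ge0.
rewrite preimage_bigcup ge0_integral_bigcup//=.
- by move=> k; rewrite -[_ @^-1` _]setTI; exact: mphi.
- by apply/measurable_EFinP; exact: measurable_funTS.
- by move=> x _; rewrite lee_fin.
- move=> i j _ _ [x [Fi Fj]]; apply: tF => //; by exists (phi x).
Qed.

HB.instance Definition _ := isMeasure.Build _ _ _
  weighted_pushforward nu0 nu_ge0 nu_sigma_additive.

Import HBNNSimple.

(** By linearity the formula passes from indicators to simple functions, and by monotone convergence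
    along [nnsfun_approx] to every nonnegative measurable function. *)
Lemma ge0_integral_weighted_pushforward (f : Y -> \bar R) :
  measurable_fun [set: Y] f -> (forall y, 0 <= f y) ->
  \int[weighted_pushforward]_y f y = \int[mu]_x (f (phi x) * (w x)%:E).
Proof.
move=> mf f0.
have mphiT B : measurable B -> measurable (phi @^-1` B).
  by move=> mB; rewrite -[_ @^-1` _]setTI; exact: mphi.
pose f_ := nnsfun_approx measurableT mf.
transitivity (limn (fun n => \int[weighted_pushforward]_x (f_ n x)%:E)).
  rewrite -monotone_convergence//.
  - apply: eq_integral => y _; apply/esym/cvg_lim => //.
    by apply: cvg_nnsfun_approx.
  - by move=> n; exact/measurable_EFinP/measurable_funP.
  - by move=> n y _; rewrite lee_fin.
  - by move=> y _ m n mn; rewrite lee_fin; exact/lefP/nd_nnsfun_approx.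
rewrite [X in limn X](_ : _ =
    (fun n => \int[mu]_x ((f_ n (phi x))%:E * (w x)%:E))).
  rewrite -monotone_convergence//; last 3 first.
    - move=> n /=; apply: emeasurable_funM; last exact/measurable_EFinP.
      apply/measurable_EFinP; apply: measurableT_comp => //.
    - by move=> n x _ /=; rewrite mule_ge0// lee_fin.
    - move=> x _ m n mn; apply: lee_wpmul2r; rewrite lee_fin//.
      exact/lefP/nd_nnsfun_approx.
  apply: eq_integral => x _; apply/cvg_lim => //.
  apply: cvgeZr => //.
  by apply: cvg_nnsfun_approx.
apply/funext => n.
transitivity (\sum_(k \in range (f_ n))
    (k%:E * weighted_pushforward (f_ n @^-1` [set k]))).
  under eq_integral do rewrite fimfunE -fsumEFin//.
  rewrite ge0_integral_fsum//; last 2 first.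
  - by move=> y; exact/measurable_EFinP/measurable_funM.
  - by move=> y x _; rewrite nnfun_muleindic_ge0.
  apply: eq_fsbigr => r _; rewrite integralZl_indic_nnsfun// integral_indic//=.
  by rewrite setIT.
have E x : (f_ n (phi x))%:E * (w x)%:E = \sum_(k \in range (f_ n))
    ((k * \1_(f_ n @^-1` [set k]) (phi x))%:E * (w x)%:E).
  rewrite fimfunE -fsumEFin// ge0_mule_fsuml// => k.
  exact: nnfun_muleindic_ge0.
under [RHS]eq_integral do rewrite E.
rewrite ge0_integral_fsum//; last 2 first.
- move=> y; apply: emeasurable_funM; last exact/measurable_EFinP.
  apply/measurable_EFinP/measurable_funM => //.
  apply: measurableT_comp => //.
- move=> y x _; rewrite mule_ge0 ?lee_fin//.
  by have := nnfun_muleindic_ge0 (f_ n) y (phi x); rewrite lee_fin.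
apply: eq_fsbigr => k kr.
have k0 : (0 <= k)%R by move: kr; rewrite inE => -[y _ <-].
under eq_integral do rewrite EFinM -muleA.
rewrite ge0_integralZl_EFin//; last 2 first.
- by move=> x _; rewrite mule_ge0// lee_fin.
- apply: emeasurable_funM; last exact/measurable_EFinP.
  by apply/measurable_EFinP; apply: measurableT_comp.
congr (_ * _).
rewrite /weighted_pushforward integral_mkcond; apply: eq_integral => x _.
rewrite patchE indicE.
have -> : (x \in phi @^-1` (f_ n @^-1` [set k])) = (phi x \in f_ n @^-1` [set k]).
  by apply/idP/idP; rewrite !inE.
by case: ifP; rewrite ?mul1e ?mul0e.
Qed.
End density.

Lemma is_derive_continuous (R : realType) (F F' : R -> R) :
  (forall x : R, is_derive x 1 F (F' x)) -> continuous F.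
Proof.
move=> dF x; apply: differentiable_continuous; apply/derivable1_diffP.
exact: ex_derive.
Qed.

(** * Expanding maps of the line and substitution *)

Section expanding.
Context (R : realType) (F F' : R -> R) (c : R).
Hypotheses (c0 : 0 < c) (dF : forall x : R, is_derive x 1 F (F' x))
  (cle : forall x, c <= F' x).

Let cF : continuous F. Proof. exact: is_derive_continuous dF. Qed.

Lemma expanding_le (x y : R) : x < y -> c * (y - x) <= F y - F x.
Proof.
move=> xy.
have [z _ ->] := MVT xy (fun x _ => dF x) (continuous_subspaceT cF).
by rewrite ler_wpM2r// subr_ge0 ltW.
Qed.

Lemma expanding_mono : {mono F : x y / x <= y}.
Proof.
apply: le_mono => x y xy; rewrite -subr_gt0.
by apply: lt_le_trans (expanding_le xy); rewrite mulr_gt0// subr_gt0.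
Qed.

(** With slope at least [c], [F] has passed the level [y] at distance |y - F 0| / c from the origin
    on either side; the intermediate value theorem applies between these two points. *)
Lemma expanding_surj (y : R) : exists x, F x = y.
Proof.
have n0 : 0 <= `|y - F 0| / c by rewrite divr_ge0// ltW.
have Fle : F (- (`|y - F 0| / c)) <= y <= F (`|y - F 0| / c).
  move: n0; rewrite le_eqVlt => /orP[/eqP n0|n0].
    rewrite -n0 oppr0; move/eqP: n0; rewrite eq_sym mulf_eq0 normr_eq0 subr_eq0 invr_eq0.
    by rewrite (gt_eqF c0) orbF => /eqP ->; rewrite !lexx.
  have := expanding_le n0; rewrite subr0 mulrC divfK ?gt_eqF// => h1.
  have n1 : - (`|y - F 0| / c) < 0 by rewrite oppr_lt0.
  have := expanding_le n1; rewrite sub0r opprK mulrC divfK ?gt_eqF// => h2.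
  have := ler_norm (y - F 0); have := ler_norm (F 0 - y); rewrite distrC.
  by move: h1 h2; set t := `| _ |; move=> ? ? ? ?; apply/andP; split; lra.
have [||x _ <-] := @IVT _ F (- (`|y - F 0| / c)) (`|y - F 0| / c) y _ (continuous_subspaceT cF); last by exists x.
  by rewrite -subr_ge0 opprK addr_ge0.
case/andP: Fle => h1 h2; rewrite minEle maxEle (le_trans h1 h2).
by rewrite h1 h2.
Qed.

Lemma expanding_norm (x y : R) : c * `|x - y| <= `|F x - F y|.
Proof.
have [xy|xy|->] := ltgtP x y; last by rewrite !subrr normr0 mulr0.
- rewrite distrC [leRHS]distrC gtr0_norm ?subr_gt0//.
  by rewrite (le_trans (expanding_le xy))// ler_norm.
- rewrite gtr0_norm ?subr_gt0//.
  by rewrite (le_trans (expanding_le xy))// ler_norm.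
Qed.

End expanding.

(** The image under [F] of the measure with density [F'] gives []a, b]] the mass b - a, by the
    fundamental theorem of calculus, so it is Lebesgue measure by uniqueness. Going through measures
    allows [f] to be merely measurable. *)
Lemma ge0_integration_substitution (R : realType) (F F' : R -> R) (c : R)
    (f : R -> \bar R) :
  (0 < c)%R -> (forall x : R, is_derive x 1 F (F' x)) -> continuous F' ->
  (forall x, c <= F' x) -> measurable_fun [set: measurableTypeR R] f -> (forall y, 0 <= f y)%E ->
  (\int[lebesgue_measure]_x (f (F x) * (F' x)%:E) =
   \int[lebesgue_measure]_y f y)%E.
Proof.
move=> c0 dF cF' cle mf f0.
have cF := is_derive_continuous dF.
have Fmono := expanding_mono c0 dF cle.
have Fsurj := expanding_surj c0 dF cle.
have mF : measurable_fun [set: measurableTypeR R] (F : _ -> measurableTypeR R).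
  exact: continuous_measurable_fun.
have mF' : measurable_fun [set: measurableTypeR R] F'.
  exact: continuous_measurable_fun.
have F'0 x : 0 <= F' x by rewrite (le_trans (ltW c0)).
rewrite -(ge0_integral_weighted_pushforward mF lebesgue_measure mF' F'0)//.
apply: eq_measure_integral => //= A mA _; apply/esym.
apply: lebesgue_measure_unique => //= _ [[a b] _ <-].
rewrite /weighted_pushforward/= lebesgue_measure_itv/= lte_fin.
have [ha Fha] := Fsurj a; have [hb Fhb] := Fsurj b.
have -> : F @^-1` `]a, b] = `]ha, hb]%classic.
  by apply/seteqP; split => x /=; rewrite !in_itv/= -Fha -Fhb Fmono !ltNge Fmono.
case: ifPn => [ab|]; last first.
  rewrite -leNgt => ba; rewrite set_itv_ge ?integral_set0//.
  by rewrite bnd_simp -leNgt -Fmono Fha Fhb.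
have hab : ha < hb by rewrite ltNge -Fmono Fha Fhb -ltNge.
rewrite integral_itv_obnd_cbnd; last first.
  by apply/measurable_EFinP; exact: measurable_funTS.
rewrite (@continuous_FTC2 _ _ F)//.
- by rewrite Fha Fhb.
- exact: continuous_subspaceT.
- split; first by move=> x _; exact: ex_derive.
  + by apply: cvg_at_right_filter; exact: cF.
  + by apply: cvg_at_left_filter; exact: cF.
- by move=> x _; rewrite derive1E derive_val.
Qed.

Section tonelli.
Local Open Scope ereal_scope.
Context (R : realType) (f : R * R -> \bar R).
Hypotheses (mf : measurable_fun [set: measurableTypeR R * measurableTypeR R] f)
  (f0 : forall u, 0 <= f u).

Lemma leb2_tonelli12 :
  \int[leb2]_u f u = \int[lebesgue_measure]_x \int[lebesgue_measure]_y f (x, y).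
Proof.
exact: (@fubini_tonelli1 _ _ _ _ _ lebesgue_measure lebesgue_measure _ mf f0).
Qed.

Lemma leb2_tonelli21 :
  \int[leb2]_u f u = \int[lebesgue_measure]_y \int[lebesgue_measure]_x f (x, y).
Proof.
rewrite leb2_tonelli12.
exact: (@fubini_tonelli _ _ _ _ _ lebesgue_measure lebesgue_measure _ mf f0).
Qed.
End tonelli.

(** The partial derivatives are explicit functions, so that closed formulas can be supplied for them
    and differentiated again. *)
Definition C1 (R : realType) (f f1 f2 : R * R -> R) : Prop :=
  [/\ forall u : R * R, is_derive u (1, 0) f (f1 u),
    forall u : R * R, is_derive u (0, 1) f (f2 u),
    continuous f1 & continuous f2].

Lemma fst_continuous (R : realType) : continuous (fun u : R * R => u.1).
Proof. by move=> u; exact: cvg_fst. Qed.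
Arguments fst_continuous {R} u : rename.

Lemma snd_continuous (R : realType) : continuous (fun u : R * R => u.2).
Proof. by move=> u; exact: cvg_snd. Qed.
Arguments snd_continuous {R} u : rename.

Lemma cvg_pair2 (R : realType) T (F : set_system T) {FF : Filter F}
    (f g : T -> R) (a b : R) : f @ F --> a -> g @ F --> b ->
  ((f t, g t) : R * R) @[t --> F] --> ((a, b) : R * R).
Proof. by move=> fa gb; exact: (cvg_pair fa gb). Qed.

Lemma cvg_comp2 (R : realType) T (F : set_system T) {FF : Filter F}
    (H : R * R -> R) (f g : T -> R) (a b : R) :
  continuous H -> f @ F --> a -> g @ F --> b -> H (f t, g t) @[t --> F] --> H (a, b).
Proof. by move=> cH fa gb; exact: (continuous_cvg _ (cH (a, b)) (cvg_pair2 fa gb)). Qed.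

Lemma continuous_pair2 (R : realType) (T : topologicalType) (f g : T -> R) :
  continuous f -> continuous g -> continuous (fun t => ((f t, g t) : R * R)).
Proof. by move=> cf cg t; apply: cvg_pair2; [exact: cf|exact: cg]. Qed.
Arguments continuous_pair2 {R T f g} cf cg t : rename.

Lemma continuous_comp2 (R : realType) (T : topologicalType) (F : R * R -> R)
    (f g : T -> R) :
  continuous F -> continuous f -> continuous g ->
  continuous (fun t => F (f t, g t)).
Proof.
move=> cF cf cg t.
have H := continuous_pair2 cf cg t.
by apply: (@continuous_comp T (R * R)%type R (fun t => (f t, g t)) F t H); exact: cF.
Qed.
Arguments continuous_comp2 {R T F f g} cF cf cg t : rename.

Lemma is_derive_slice1 (R : realType) (f : R * R -> R) (x y l : R) :
  is_derive (x, y) (1, 0) f l -> is_derive x 1 (fun s => f (s, y)) l.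
Proof.
have E : (fun h : R => h^-1 *: (((fun s : R => f (s, y)) \o shift x) (h *: 1) - f (x, y)))
  = (fun h : R => h^-1 *: ((f \o shift (x, y)) (h *: (1, 0)) - f (x, y))).
  apply/funext => h /=; congr (_ *: (f _ - _)).
  by rewrite /shift /=; congr pair; rewrite /= ?scaler0 ?add0r.
move=> [d v]; split; first by rewrite /derivable E.
by rewrite -v /derive E.
Qed.

Lemma is_derive_slice2 (R : realType) (f : R * R -> R) (x y l : R) :
  is_derive (x, y) (0, 1) f l -> is_derive y 1 (fun s => f (x, s)) l.
Proof.
have E : (fun h : R => h^-1 *: (((fun s : R => f (x, s)) \o shift y) (h *: 1) - f (x, y)))
  = (fun h : R => h^-1 *: ((f \o shift (x, y)) (h *: (0, 1)) - f (x, y))).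
  apply/funext => h /=; congr (_ *: (f _ - _)).
  by rewrite /shift /=; congr pair; rewrite /= ?scaler0 ?add0r.
move=> [d v]; split; first by rewrite /derivable E.
by rewrite -v /derive E.
Qed.

(** The end points are not ordered. Of the position of the intermediate point only its distance to
    [a] is kept, which is enough to make it converge when [b] tends to [a]. *)
Lemma MVT_between (R : realType) (f f' : R -> R) (a b : R) :
  (forall x : R, is_derive x 1 f (f' x)) ->
  exists2 c, `|c - a| <= `|b - a| & f b - f a = f' c * (b - a).
Proof.
move=> df.
have cf : continuous f.
  by move=> x; apply: differentiable_continuous; apply/derivable1_diffP; exact: ex_derive.
have [ab|ba|<-] := ltgtP a b.
- have [c] := MVT ab (fun x _ => df x) (continuous_subspaceT cf).
  rewrite in_itv/= => /andP[ac cb] E; exists c => //.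
  by rewrite !gtr0_norm ?subr_gt0// lerD2r ltW.
- have [c] := MVT ba (fun x _ => df x) (continuous_subspaceT cf).
  rewrite in_itv/= => /andP[ac cb] E; exists c.
    by rewrite !ltr0_norm ?subr_lt0// lerN2 lerD2r ltW.
  by rewrite -opprB E -mulrN opprB.
- by exists a; rewrite ?subrr ?mulr0.
Qed.

(** The increment is taken along one axis and then the other. The mean value theorem on each piece
    replaces it by a partial derivative at a nearby point, and continuity of the partial derivatives
    makes the error o(|h|). *)
Lemma C1_is_diff (R : realType) (f f1 f2 : R * R -> R) (u : R * R) :
  C1 f f1 f2 -> is_diff u f (fun v => v.1 * f1 u + v.2 * f2 u).
Proof.
case: u => x y [d1 d2 c1 c2].
pose L : R * R -> R := fun v => v.1 * f1 (x, y) + v.2 * f2 (x, y).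
have Llin : linear L.
  move=> k a b; rewrite /L /=. rewrite /GRing.scale /=. ring.
pose LL : {linear (R * R)%type -> R} := HB.pack L (GRing.isLinear.Build _ _ _ _ L Llin).
have cL : continuous LL.
  move=> v; apply: (@continuousD _ _ _ (fun v : R * R => v.1 * f1 (x, y)) (fun v : R * R => v.2 * f2 (x, y)));
    apply: continuousM; try exact: cst_continuous.
    exact: cvg_fst. exact: cvg_snd.
have H := @diff_unique R (R * R)%type R f LL (x, y) cL.
lazymatch type of H with ?P -> _ => have E : P end.
  apply/eqaddoP => e e0.
  have := c1 (x, y); have := c2 (x, y).
  move=> /cvgrPdist_lt/(_ (e / 2)) h2 /cvgrPdist_lt/(_ (e/2)) h1.
  have {}h2 := h2 (divr_gt0 e0 (ltr0Sn _ 1)).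
  have {}h1 := h1 (divr_gt0 e0 (ltr0Sn _ 1)).
  have [d /= d0 hd] : nbhs_ball (x, y) [set t | `|f1 (x, y) - f1 t| < e / 2 /\ `|f2 (x, y) - f2 t| < e / 2].
    by apply/nbhs_ballP; near=> t; split; near: t.
  apply/nbhs_ballP; exists d => // -[h k] [hd1 kd1].
  rewrite /ball /= sub0r normrN in hd1; rewrite /ball /= sub0r normrN in kd1.
  rewrite /= /LL /L /=.
  have [c hc Ec] := MVT_between (x) (h + x) (fun s => is_derive_slice1 (d1 (s, k + y))).
  have [c' hc' Ec'] := MVT_between (y) (k + y) (fun s => is_derive_slice2 (d2 (x, s))).
  rewrite addrK in hc Ec; rewrite addrK in hc' Ec'.
  rewrite -[X in `|X|]/(f (h + x, k + y) - (f (x, y) + (h * f1 (x, y) + k * f2 (x, y)))).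
  have -> : f (h + x, k + y) - (f (x, y) + (h * f1 (x, y) + k * f2 (x, y)))
     = (f1 (c, k + y) - f1 (x, y)) * h + (f2 (x, c') - f2 (x, y)) * k.
    by rewrite !mulrBl -Ec -Ec'; ring.
  apply: le_trans (ler_normD _ _) _; rewrite !normrM.
  have := hd (c, k + y); have := hd (x, c').
  have Hb : forall a b : R, `|x - a| < d -> `|y - b| < d -> ball (x, y) d (a, b) by [].
  have hk' : `|y - (k + y)| < d by rewrite distrC addrK.
  have hc1 : `|x - c| < d by rewrite distrC; apply: le_lt_trans hc hd1.
  have hc1' : `|y - c'| < d by rewrite distrC; apply: le_lt_trans hc' kd1.
  have hx : `|x - x| < d by rewrite subrr normr0.
  move=> /(_ (Hb _ _ hx hc1'))/= [_ g2] /(_ (Hb _ _ hc1 hk'))/= [g1 _].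
  rewrite distrC in g1; rewrite distrC in g2.
  rewrite prod_normE /= [X in _ <= X * _]splitr mulrDl.
  apply: lerD; apply: ler_pM => //; try exact: ltW; rewrite le_max lexx ?orbT//.
have {}H := H E.
split; last by rewrite H.
by apply/diff_locallyP; rewrite H; split.
Unshelve. all: by end_near. Qed.

Lemma C1_continuous (R : realType) (f f1 f2 : R * R -> R) : C1 f f1 f2 -> continuous f.
Proof. by move=> h u; apply: differentiable_continuous; have := C1_is_diff u h; case. Qed.
Arguments C1_continuous {R f f1 f2} h u : rename.

Lemma C1_path (R : realType) (f f1 f2 : R * R -> R) (p q : R -> R) (s p' q' : R) :
  C1 f f1 f2 -> is_derive s 1 p p' -> is_derive s 1 q q' ->
  is_derive s 1 (fun s => f (p s, q s)) (p' * f1 (p s, q s) + q' * f2 (p s, q s)).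
Proof.
move=> hf [dp vp] [dq vq].
have hp : is_diff s p (fun h => h * p').
  move/derivable1_diffP : (dp) => dp'; split => //. rewrite deriv1E// derive1E vp. by [].
have hq : is_diff s q (fun h => h * q').
  move/derivable1_diffP : (dq) => dq'; split => //. rewrite deriv1E// derive1E vq. by [].
have hc := @is_diff_comp _ _ _ _ (fun s => (p s, q s)) _ f _ s (is_diff_pair hp hq) (C1_is_diff _ hf).
have -> : (fun s => f (p s, q s)) = f \o (fun s => (p s, q s)) by [].
split; first by apply/derivable1_diffP; case: hc.
rewrite deriveE; last by case: hc.
by case: hc => _ -> /=; rewrite !mul1r.
Qed.

Lemma is_Ck1_C1 (R : realType) (f : R * R -> R) : is_Ck 1 f -> C1 f ('D_(1, 0) f) ('D_(0, 1) f).
Proof. by rewrite /is_Ck => -[d c1 c2]; split; [move=> u; exact: (derivableP (d u).1)|move=> u; exact: (derivableP (d u).2)| |]. Qed.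

Lemma is_Ck_fst (R : realType) n (f : R * R -> R * R) :
  is_Ck n f -> is_Ck n (fun u => (f u).1).
Proof.
elim: n f => [|n IH] f; rewrite [is_Ck _]/= => h; rewrite [is_Ck _]/=.
  move=> u; exact: (continuous_comp (h u) (fst_continuous (f u))).
case: h => d c1 c2.
have D v u : derivable f u v -> is_derive u v (fun u => (f u).1) ('D_v f u).1.
  move=> dfv.
  have E : (fun h : R => h^-1 *: (((fun u => (f u).1) \o shift u) (h *: v) - (f u).1)) @ 0^'
    --> ('D_v f u).1.
    exact: (continuous_cvg _ (fst_continuous ('D_v f u)) dfv).
  split; first by apply/cvg_ex; exists ('D_v f u).1.
  exact/cvg_lim.
split.
- by move=> u; have [a b] := d u; split; [have [] := D _ _ a|have [] := D _ _ b].
- have -> : 'D_(1, 0) (fun u => (f u).1) = fun u => ('D_(1, 0) f u).1.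
    by apply/funext => u; have [_ ->] := D _ _ (d u).1.
  exact: (IH _ c1).
- have -> : 'D_(0, 1) (fun u => (f u).1) = fun u => ('D_(0, 1) f u).1.
    by apply/funext => u; have [_ ->] := D _ _ (d u).2.
  exact: (IH _ c2).
Qed.

Lemma is_Ck_snd (R : realType) n (f : R * R -> R * R) :
  is_Ck n f -> is_Ck n (fun u => (f u).2).
Proof.
elim: n f => [|n IH] f; rewrite [is_Ck _]/= => h; rewrite [is_Ck _]/=.
  move=> u; exact: (continuous_comp (h u) (snd_continuous (f u))).
case: h => d c1 c2.
have D v u : derivable f u v -> is_derive u v (fun u => (f u).2) ('D_v f u).2.
  move=> dfv.
  have E : (fun h : R => h^-1 *: (((fun u => (f u).2) \o shift u) (h *: v) - (f u).2)) @ 0^'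
    --> ('D_v f u).2.
    exact: (continuous_cvg _ (snd_continuous ('D_v f u)) dfv).
  split; first by apply/cvg_ex; exists ('D_v f u).2.
  exact/cvg_lim.
split.
- by move=> u; have [a b] := d u; split; [have [] := D _ _ a|have [] := D _ _ b].
- have -> : 'D_(1, 0) (fun u => (f u).2) = fun u => ('D_(1, 0) f u).2.
    by apply/funext => u; have [_ ->] := D _ _ (d u).1.
  exact: (IH _ c1).
- have -> : 'D_(0, 1) (fun u => (f u).2) = fun u => ('D_(0, 1) f u).2.
    by apply/funext => u; have [_ ->] := D _ _ (d u).2.
  exact: (IH _ c2).
Qed.

(** * Change of variables in the plane *)

Section change_of_variables.
Context (R : realType) (p p1 p2 q q1 q2 : R * R -> R) (c : R).
Hypotheses (c0 : 0 < c) (Cp : C1 p p1 p2) (Cq : C1 q q1 q2)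
  (cp : forall u, c <= p1 u)
  (cJ : forall u, c * p1 u <= p1 u * q2 u - p2 u * q1 u).

Let dp1 (y x : R) : is_derive x 1 (fun s => p (s, y)) (p1 (x, y)).
Proof. by case: Cp => d _ _ _; exact: (is_derive_slice1 (d (x, y))). Qed.

Let dp2 (x y : R) : is_derive y 1 (fun s => p (x, s)) (p2 (x, y)).
Proof. by case: Cp => _ d _ _; exact: (is_derive_slice2 (d (x, y))). Qed.

Let exh (w : R * R) : {x | p (x, w.2) = w.1}.
Proof.
by apply: cid; exact: (expanding_surj c0 (dp1 w.2) (fun x => cp (x, w.2))).
Qed.

Let h (w : R * R) : R := projT1 (exh w).

Let ph w : p (h w, w.2) = w.1.
Proof. exact: (projT2 (exh w)). Qed.

Let pexp (y a b : R) : c * `|a - b| <= `|p (a, y) - p (b, y)|.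
Proof. exact: (@expanding_norm R (fun s => p (s, y)) (fun s => p1 (s, y)) c (dp1 y) (fun x => cp (x, y)) a b). Qed.

Let hp x y : h (p (x, y), y) = x.
Proof.
have := pexp y (h (p (x, y), y)) x; have := ph (p (x, y), y) => /= ->.
rewrite subrr normr0 => H; apply/eqP; rewrite -subr_eq0 -normr_eq0.
by rewrite eq_le normr_ge0 andbT -(ler_pM2l c0) mulr0.
Qed.

(** Since p (., y) expands by [c], the distance from [h w] to [h w'] is at most |p (h w, w'.2) -
    w'.1| / c, which is continuous in [w'] and vanishes at [w]. *)
Let ch : continuous h.
Proof.
move=> w; apply/cvgrPdist_lt => e e0.
have cpw : continuous (fun w' : R * R => p (h w, w'.2) - w'.1).
  move=> w'; apply: cvgB; last exact: cvg_fst.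
  apply: cvg_comp2; [exact: (C1_continuous Cp)|exact: cvg_cst|exact: cvg_snd].
have := cpw w; rewrite /continuous_at ph subrr => /cvgrPdist_lt/(_ (c * e)).
move=> /(_ (mulr_gt0 c0 e0)); apply: filterS => w'.
rewrite sub0r normrN => H.
rewrite -(ltr_pM2l c0); apply: le_lt_trans H.
by rewrite -[X in _ <= `|_ - X|](ph w'); exact: pexp.
Qed.

(** Implicit differentiation of p (h (y, s), s) = y. By the mean value theorem the difference
    quotient of [h] is minus that of [p] in its second variable, divided by [p1] at an intermediate
    point [xi k]; this point tends to [h (y, s)] because [h] is continuous. *)
Let dh (y s : R) :
  is_derive s 1 (fun s => h (y, s)) (- p2 (h (y, s), s) / p1 (h (y, s), s)).
Proof.
have xiP k : {z | `|z - h (y, s)| <= `|h (y, k + s) - h (y, s)| &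
    y - p (h (y, s), k + s) = p1 (z, k + s) * (h (y, k + s) - h (y, s))}.
  apply: cid2; have [z hz E] := MVT_between (h (y, s)) (h (y, k + s)) (dp1 (k + s)).
  by exists z => //; rewrite -E (ph (y, k + s)).
pose xi k := s2val (xiP k).
have cvgs : k + s @[k --> nbhs (0 : R)] --> s.
  rewrite -[X in _ --> X]add0r.
  by apply: cvgD; [exact: cvg_id|exact: cvg_cst].
have hcv : h (y, k + s) @[k --> 0^'] --> h (y, s).
  by apply: cvg_comp2; [exact: ch|exact: cvg_cst|exact: cvg_within_filter].
have xicv : xi k @[k --> 0^'] --> h (y, s).
  apply/cvgrPdist_lt => e e0; move/cvgrPdist_lt/(_ e e0) : hcv.
  apply: filterS => k; rewrite distrC => H; rewrite distrC.
  exact: le_lt_trans (s2valP (xiP k)) H.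
have p1cv : p1 (xi k, k + s) @[k --> 0^'] --> p1 (h (y, s), s).
  have cs : ((xi k, k + s) : R * R) @[k --> 0^'] --> ((h (y, s), s) : R * R).
    apply: cvg_pair2 => //.
    apply: cvg_within_filter.
    exact: cvgs.
  by case: Cp => _ _ c1 _; exact: (continuous_cvg _ (c1 _) cs).
have p1n0 u : p1 u != 0 by rewrite gt_eqF// (lt_le_trans c0).
have H : k^-1 *: (((fun s => h (y, s)) \o shift s) (k *: 1) - h (y, s)) @[k --> (0 : R)^'] --> - p2 (h (y, s), s) / p1 (h (y, s), s).
  have [dd dv] := dp2 (h (y, s)) s.
  have E k : k^-1 *: (((fun s => h (y, s)) \o shift s) (k *: 1) - h (y, s)) =
      - (k^-1 *: (((fun s' => p (h (y, s), s')) \o shift s) (k *: 1) - p (h (y, s), s))) *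
      (p1 (xi k, k + s))^-1.
    have := s2valP' (xiP k); rewrite -/(xi k) /= (ph (y, s)) /GRing.scale /= mulr1 => E1.
    rewrite -mulrN opprB E1 -mulrA -mulrA; congr (_ * _).
    by rewrite [X in _ = X]mulrCA mulfV// mulr1.
  rewrite (_ : (fun k => _) = (fun k => - (k^-1 *: (((fun s' => p (h (y, s), s')) \o shift s) (k *: 1) - p (h (y, s), s))) *
      (p1 (xi k, k + s))^-1)); last by apply/funext => k; exact: E.
  apply: cvgM; last by apply: cvgV.
  by apply: cvgN; rewrite -dv.
split; first by apply/cvg_ex; exists (- p2 (h (y, s), s) / p1 (h (y, s), s)).
exact/cvg_lim.
Qed.

Let J u := p1 u * q2 u - p2 u * q1 u.

Let dg (y s : R) : is_derive s 1 (fun s => q (h (y, s), s)) (J (h (y, s), s) / p1 (h (y, s), s)).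
Proof.
apply: is_derive_eq; first exact: (C1_path Cq (dh y s) (is_derive_id s 1)).
rewrite /J; have : p1 (h (y, s), s) != 0 by rewrite gt_eqF// (lt_le_trans c0).
move=> ?; field. by [].
Qed.

(** The map (p, q) is the composition of (x, y) -> (p (x, y), y) and (z, y) -> (z, q (h (z, y), y)),
    where [h] inverts [p] in its first variable. Each factor changes one coordinate only, with
    derivatives [p1] and [J / p1]; the two lower bounds of the section say that both are at least
    [c], so the one-dimensional substitution applies twice. [Phi] is the integrand between the two
    substitutions. *)
Lemma ge0_change_of_variables (f : R * R -> \bar R) :
  measurable_fun [set: measurableTypeR R * measurableTypeR R] f ->
  (forall u, 0 <= f u)%E ->
  (\int[leb2]_u (f (p u, q u) * (p1 u * q2 u - p2 u * q1 u)%:E) =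
   \int[leb2]_u f u)%E.
Proof.
move=> mf f0.
pose T := (measurableTypeR R * measurableTypeR R)%type.
have cJc : continuous J.
  case: Cp => _ _ cp1 cp2; case: Cq => _ _ cq1 cq2 u.
  by apply: cvgB; apply: cvgM; [exact: cp1|exact: cq2|exact: cp2|exact: cq1].
have p1g u : 0 < p1 u by rewrite (lt_le_trans c0).
have J0 u : 0 <= J u by apply: le_trans (cJ u); rewrite mulr_ge0// ltW.
have chs : continuous (fun w : R * R => ((h w, w.2) : R * R)).
  by move=> w; apply: cvg_pair2; [exact: ch|exact: cvg_snd].
pose K (w : R * R) := J (h w, w.2) / p1 (h w, w.2).
have cK : continuous K.
  move=> w; apply: cvgM.
    exact: (continuous_cvg _ (cJc _) (chs w)).
  apply: cvgV; first by rewrite gt_eqF.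
  by case: Cp => _ _ c1 _; exact: (continuous_cvg _ (c1 _) (chs w)).
have K0 w : 0 <= K w by rewrite divr_ge0// ltW.
have cq' : continuous (fun w : R * R => q (h w, w.2)).
  exact: (continuous_comp2 (C1_continuous Cq) ch snd_continuous).
pose Phi (w : T) : \bar R := (f (w.1, q (h w, w.2)) * (K w)%:E)%E.
have mPhi : measurable_fun [set: T] Phi.
  apply: emeasurable_funM; last first.
    by apply/measurable_EFinP; exact: continuous_measurable_prod.
  apply: (measurableT_comp mf); apply: measurable_fun_pair => //.
  exact: continuous_measurable_prod.
have cpq : continuous (fun u : R * R => ((p u, q u) : R * R)).
  by move=> u; apply: cvg_pair2; [exact: (C1_continuous Cp)|exact: (C1_continuous Cq)].
rewrite leb2_tonelli21; last 2 first.
- apply: emeasurable_funM; last first.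
    by apply/measurable_EFinP; exact: continuous_measurable_prod.
  apply: (measurableT_comp mf); apply: measurable_fun_pair.
    by apply: continuous_measurable_prod; exact: (C1_continuous Cp).
  by apply: continuous_measurable_prod; exact: (C1_continuous Cq).
- by move=> u; rewrite mule_ge0// lee_fin; exact: J0.
transitivity (\int[lebesgue_measure]_u2 \int[lebesgue_measure]_y1 Phi (y1, u2))%E.
  apply: eq_integral => u2 _.
  rewrite -[RHS](ge0_integration_substitution c0 (dp1 u2) _ (fun x => cp (x, u2)) (f := fun y => Phi (y, u2)))//; last 3 first.
  - case: Cp => _ _ c1 _ x.
    have cs : ((x, u2) : R * R) @[x --> x] --> ((x, u2) : R * R).
      by apply: cvg_pair2; [exact: cvg_id|exact: cvg_cst].
    exact: (continuous_cvg _ (c1 _) cs).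
  - exact: (measurable_fun_pair1 u2 mPhi).
  - by move=> y; rewrite /Phi mule_ge0// lee_fin.
  apply: eq_integral => u1 _; rewrite /Phi/K/= hp -muleA -EFinM divfK// gt_eqF//.
rewrite -leb2_tonelli21//; last by move=> w; rewrite /Phi mule_ge0// lee_fin.
rewrite leb2_tonelli12; [|exact: mPhi|by move=> w; rewrite /Phi mule_ge0// lee_fin].
rewrite leb2_tonelli12//.
apply: eq_integral => y1 _.
apply: (ge0_integration_substitution c0 (dg y1) _ _ (f := fun y => f (y1, y))) => //.
- move=> s.
  have cs : ((y1, s) : R * R) @[s --> s] --> ((y1, s) : R * R).
    by apply: cvg_pair2; [exact: cvg_cst|exact: cvg_id].
  exact: (continuous_cvg _ (cK _) cs).
- by move=> s; rewrite ler_pdivlMr//; exact: cJ.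
- exact: (measurable_fun_pair2 y1 mf).
Qed.
End change_of_variables.

Lemma is_derive_dir (R : realType) (f : R * R -> R) (u v : R * R) (l : R) :
  (forall h : R, h != 0 -> h^-1 *: (f (h *: v + u) - f u) = l) ->
  is_derive u v f l.
Proof.
move=> H.
have C : h^-1 *: ((f \o shift u) (h *: v) - f u) @[h --> (0 : R)^'] --> l.
  apply: cvg_near_cst; near=> h; apply: H; near: h; exact: nbhs_dnbhs_neq.
by split; [apply/cvg_ex; exists l|exact/cvg_lim].
Unshelve. all: by end_near. Qed.

Section C1_closure.
Context (R : realType).
Implicit Types f g : R * R -> R.

Lemma C1_cst (c : R) : C1 (fun=> c) (fun=> 0) (fun=> 0).
Proof. by split=> u; [exact: is_derive_cst|exact: is_derive_cst|exact: cvg_cst|exact: cvg_cst]. Qed.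

Lemma C1_fst : C1 (fun u : R * R => u.1) (fun=> 1) (fun=> 0).
Proof.
split=> u; [| |exact: cvg_cst|exact: cvg_cst].
  by apply: is_derive_dir => h h0; rewrite /= addrK /GRing.scale/= mulr1 mulVf.
by apply: is_derive_dir => h h0; rewrite /= addrK /GRing.scale/= !mulr0.
Qed.

Lemma C1_snd : C1 (fun u : R * R => u.2) (fun=> 0) (fun=> 1).
Proof.
split=> u; [| |exact: cvg_cst|exact: cvg_cst].
  by apply: is_derive_dir => h h0; rewrite /= addrK /GRing.scale/= !mulr0.
by apply: is_derive_dir => h h0; rewrite /= addrK /GRing.scale/= mulr1 mulVf.
Qed.

Lemma C1D f f1 f2 g g1 g2 : C1 f f1 f2 -> C1 g g1 g2 ->
  C1 (fun u => f u + g u) (fun u => f1 u + g1 u) (fun u => f2 u + g2 u).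
Proof.
move=> [d1 d2 c1 c2] [e1 e2 k1 k2]; split=> u.
- exact: (is_deriveD (d1 u) (e1 u)).
- exact: (is_deriveD (d2 u) (e2 u)).
- by apply: cvgD; [exact: c1|exact: k1].
- by apply: cvgD; [exact: c2|exact: k2].
Qed.

Lemma C1M f f1 f2 g g1 g2 : C1 f f1 f2 -> C1 g g1 g2 ->
  C1 (fun u => f u * g u) (fun u => f1 u * g u + f u * g1 u)
     (fun u => f2 u * g u + f u * g2 u).
Proof.
move=> Cf Cg; have cf := C1_continuous Cf; have cg := C1_continuous Cg.
case: Cf Cg => d1 d2 c1 c2 [e1 e2 k1 k2]; split=> u.
- apply: (is_derive_eq (is_deriveM (d1 u) (e1 u))).
  by rewrite /GRing.scale/= addrC mulrC.
- apply: (is_derive_eq (is_deriveM (d2 u) (e2 u))).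
  by rewrite /GRing.scale/= addrC mulrC.
- by apply: cvgD; apply: cvgM; [exact: c1|exact: cg|exact: cf|exact: k1].
- by apply: cvgD; apply: cvgM; [exact: c2|exact: cg|exact: cf|exact: k2].
Qed.

Lemma C1_eq f f1 f2 g1 g2 : C1 f f1 f2 -> f1 =1 g1 -> f2 =1 g2 -> C1 f g1 g2.
Proof. by move=> Cf /funext <- /funext <-. Qed.

Lemma C1Z (k : R) f f1 f2 : C1 f f1 f2 ->
  C1 (fun u => k * f u) (fun u => k * f1 u) (fun u => k * f2 u).
Proof.
move=> Cf; apply: (C1_eq (C1M (C1_cst k) Cf)) => u; by rewrite mul0r add0r.
Qed.

Lemma C1B f f1 f2 g g1 g2 : C1 f f1 f2 -> C1 g g1 g2 ->
  C1 (fun u => f u - g u) (fun u => f1 u - g1 u) (fun u => f2 u - g2 u).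
Proof.
move=> [d1 d2 c1 c2] [e1 e2 k1 k2]; split=> u.
- exact: (is_deriveB (d1 u) (e1 u)).
- exact: (is_deriveB (d2 u) (e2 u)).
- by apply: cvgB; [exact: c1|exact: k1].
- by apply: cvgB; [exact: c2|exact: k2].
Qed.

End C1_closure.

Section enorm.
Context (R : realType).
Implicit Types u v : R * R.

Lemma enorm_ge0 u : 0 <= enorm u. Proof. exact: sqrtr_ge0. Qed.

Lemma enorm_sqr u : enorm u ^+ 2 = u.1 ^+ 2 + u.2 ^+ 2.
Proof. by rewrite sqr_sqrtr// addr_ge0// sqr_ge0. Qed.

Lemma enorm_le u (r : R) : 0 <= r -> (enorm u <= r) = (u.1 ^+ 2 + u.2 ^+ 2 <= r ^+ 2).
Proof. by move=> r0; rewrite -enorm_sqr ler_sqr ?nnegrE// enorm_ge0. Qed.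

Lemma enorm_dot u v : `|u.1 * v.1 + u.2 * v.2| <= enorm u * enorm v.
Proof.
rewrite -ler_sqr ?nnegrE ?mulr_ge0 ?enorm_ge0// exprMn !enorm_sqr real_normK ?num_real//.
rewrite -subr_ge0; have -> : (u.1 ^+ 2 + u.2 ^+ 2) * (v.1 ^+ 2 + v.2 ^+ 2) -
  (u.1 * v.1 + u.2 * v.2) ^+ 2 = (u.1 * v.2 - u.2 * v.1) ^+ 2 by ring.
exact: sqr_ge0.
Qed.

Lemma norm_fst_enorm u : `|u.1| <= enorm u.
Proof. by rewrite -sqrtr_sqr ler_wsqrtr// lerDl sqr_ge0. Qed.

Lemma norm_snd_enorm u : `|u.2| <= enorm u.
Proof. by rewrite -sqrtr_sqr ler_wsqrtr// lerDr sqr_ge0. Qed.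

Lemma enormZ (k : R) u : enorm (k * u.1, k * u.2) = `|k| * enorm u.
Proof.
by rewrite /enorm/= !exprMn -mulrDr sqrtrM ?sqr_ge0// sqrtr_sqr.
Qed.

Lemma enormN u : enorm (- u) = enorm u.
Proof. by rewrite /enorm/= !sqrrN. Qed.

Lemma enorm_continuous : continuous (@enorm R).
Proof.
have c : continuous (fun u : R * R => u.1 * u.1 + u.2 * u.2).
  by move=> u; apply: cvgD; apply: cvgM; first [exact: cvg_fst|exact: cvg_snd].
move=> u; rewrite /enorm.
have -> : (fun u : R * R => Num.sqrt (u.1 ^+ 2 + u.2 ^+ 2)) = (fun u : R * R => Num.sqrt (u.1 * u.1 + u.2 * u.2)).
  by apply/funext => v; rewrite !expr2.
exact: (continuous_cvg _ (@sqrt_continuous R _) (c u)).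
Qed.

End enorm.

(** * Integrals over disks *)

Section disk_integral.
Context (R : realType) (r : R).
Hypothesis r0 : 0 < r.

Lemma disk_measurable : measurable (disk r : set (measurableTypeR R * measurableTypeR R)).
Proof.
have -> : disk r = ~` (@enorm R @^-1` `]r, +oo[%classic).
  by apply/seteqP; split => u; rewrite /disk/= in_itv/= andbT ; rewrite leNgt => /negP.
apply: measurableC; apply: open_measurable_prod.
by apply: open_comp; [move=> u _; exact: enorm_continuous|exact: interval_open].
Qed.

Let box : set (measurableTypeR R * measurableTypeR R) := `[-r, r]%classic `*` `[-r, r]%classic.

Let disk_box : disk r `<=` box.
Proof.
move=> u ur; split => /=; rewrite in_itv/= -ler_norml; apply: le_trans ur.
  exact: norm_fst_enorm.
exact: norm_snd_enorm.
Qed.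

(** Area of the circumscribed square. Having 4 instead of pi costs a factor at most sqrt 2 in the
    L^1 bound of the gradient of a filter. *)
Lemma leb2_disk_le : (leb2 (disk r) <= (4 * r ^+ 2)%:E)%E.
Proof.
have mb : measurable box by apply: measurableX; exact: measurable_itv.
apply: (@le_trans _ _ (leb2 box)).
  by apply: le_measure; rewrite ?inE//; exact: disk_measurable.
pose I : set (measurableTypeR R) := `[-r, r]%classic.
have -> : leb2 box = (lebesgue_measure I * lebesgue_measure I)%E.
  by rewrite /leb2 /box [LHS]product_measure1E.
rewrite /I/= !lebesgue_measure_itv/= lte_fin gtrN//.
by rewrite opprK -EFinD -EFinM lee_fin; lra.
Qed.

Lemma continuous_bounded_disk (f : R * R -> R) : continuous f ->
  exists M, forall u, disk r u -> `|f u| <= M.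
Proof.
move=> cf.
have cb : compact (`[-r, r]%classic `*` `[-r, r]%classic : set (R * R)).
  by apply: compact_setX; exact: segment_compact.
have cn : continuous (fun u => `|f u|).
  by move=> u; apply: (continuous_cvg _ (@norm_continuous _ _ _)); exact: cf.
have [|c _ hc] := @compact_EVT_max (R * R)%type R (fun u => `|f u|) _ _ cb (continuous_subspaceT cn).
  by exists (0, 0); split; rewrite /= in_itv/= oppr_le0 ltW.
exists `|f c| => u /disk_box ub; apply: hc; exact/mem_set.
Qed.

Lemma continuous_integrable_disk (f : R * R -> R) : continuous f ->
  leb2.-integrable (disk r) (EFin \o f).
Proof.
move=> cf; apply: measurable_bounded_integrable.
- exact: disk_measurable.
- by apply: le_lt_trans leb2_disk_le _; exact: ltry.
- by apply: measurable_funTS; exact: continuous_measurable_prod.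
- have [M hM] := continuous_bounded_disk cf.
  exists M; split; first exact: num_real.
  by move=> N MN u /hM h; apply: le_trans h (ltW MN).
Qed.

End disk_integral.

(** The domain is the interval whose end points are the roots of x^2 = c, where [h] vanishes, so the
    fundamental theorem of calculus gives 0. For c = 0 it is a point and for c < 0 it is empty. *)
Lemma integral_chord (R : realType) (h h' : R -> R) (c : R) :
  (forall x : R, is_derive x 1 h (h' x)) -> continuous h' ->
  (forall x : R, x ^+ 2 = c -> h x = 0) ->
  (\int[lebesgue_measure]_(x in [set x : R | (x ^+ 2 <= c)%R]) (h' x)%:E = 0)%E.
Proof.
move=> dh ch' hc; have ch := is_derive_continuous dh.
have [c0|c0|c0] := ltgtP c 0.
- have -> : [set x | x ^+ 2 <= c] = set0.
    by apply/seteqP; split => x //=; rewrite leNgt (lt_le_trans c0)// sqr_ge0.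
  exact: integral_set0.
- have s0 : 0 < Num.sqrt c by rewrite sqrtr_gt0.
  have -> : [set x | x ^+ 2 <= c] = `[- Num.sqrt c, Num.sqrt c]%classic.
    apply/seteqP; split => x /=; rewrite in_itv/= -ler_norml => H.
      by rewrite -sqrtr_sqr ler_wsqrtr.
    by rewrite -(sqr_sqrtr (ltW c0)) -[leLHS]real_normK ?num_real// ler_sqr ?nnegrE ?sqrtr_ge0.
  rewrite (@continuous_FTC2 _ _ h).
  + by rewrite !hc ?sqrrN ?sqr_sqrtr ?ltW// subee.
  + by rewrite gtrN.
  + exact: continuous_subspaceT.
  + split; first by move=> x _; exact: ex_derive.
    * by apply: cvg_at_right_filter; exact: ch.
    * by apply: cvg_at_left_filter; exact: ch.
  + by move=> x _; rewrite derive1E derive_val.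
- have -> : [set x | x ^+ 2 <= c] = [set 0].
    apply/seteqP; split => x /=; rewrite c0.
      by move=> H; apply/eqP; rewrite -sqrf_eq0 eq_le H sqr_ge0.
    by move=> ->; rewrite expr0n.
  exact: integral_set1.
Qed.

Section disk_divergence.
Context (R : realType) (r : R).
Hypothesis r0 : 0 < r.
Variables H H1 H2 : R * R -> R.
Hypotheses (CH : C1 H H1 H2) (H0 : forall u, enorm u = r -> H u = 0).

Let slice (x y : R) : x ^+ 2 = r ^+ 2 - y ^+ 2 -> enorm (x, y) = r.
Proof.
by move=> E; rewrite /enorm/= E subrK sqrtr_sqr ger0_norm// ltW.
Qed.

Let inD (x y : R) : ((x, y) \in disk r) = (x ^+ 2 <= r ^+ 2 - y ^+ 2).
Proof.
have -> : (x ^+ 2 <= r ^+ 2 - y ^+ 2) = (enorm (x, y) <= r).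
  by rewrite (enorm_le _ (ltW r0))/= lerBrDr.
by apply/idP/idP; rewrite inE.
Qed.

(** By Fubini the integral is taken along horizontal chords, whose end points lie on the circle. *)
Lemma disk_integral_d1 : (\int[leb2]_(u in disk r) (H1 u)%:E = 0)%E.
Proof.
have mD : measurable (disk r : set (measurableTypeR R * measurableTypeR R)) by exact: disk_measurable.
have cH1 : continuous H1 by case: CH.
have iH := continuous_integrable_disk r0 cH1.
rewrite integral_mkcond /leb2 -(integral21_prod_meas1); last first.
  exact/(integrable_mkcond _ mD).
apply: integral0_eq => y _; rewrite /fubini_G.
have dx (x : R) : is_derive x 1 (fun x => H (x, y)) (H1 (x, y)).
  by case: CH => d _ _ _; exact: (is_derive_slice1 (d (x, y))).
rewrite -[RHS](integral_chord dx (c := r ^+ 2 - y ^+ 2)).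
- rewrite [RHS]integral_mkcond; apply: eq_integral => x _.
  rewrite !patchE inD; congr (if _ then _ else _).
  by apply/idP/idP; rewrite inE.
- apply: (continuous_comp2 cH1); first by move=> x; exact: cvg_id.
  by move=> x; exact: cvg_cst.
- by move=> x E; apply: H0; exact: slice.
Qed.

Lemma disk_integral_d2 : (\int[leb2]_(u in disk r) (H2 u)%:E = 0)%E.
Proof.
have mD : measurable (disk r : set (measurableTypeR R * measurableTypeR R)) by exact: disk_measurable.
have cH2 : continuous H2 by case: CH.
have iH := continuous_integrable_disk r0 cH2.
rewrite integral_mkcond /leb2 -(integral12_prod_meas1); last first.
  exact/(integrable_mkcond _ mD).
apply: integral0_eq => x _; rewrite /fubini_F.
have dy (y : R) : is_derive y 1 (fun y => H (x, y)) (H2 (x, y)).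
  by case: CH => _ d _ _; exact: (is_derive_slice2 (d (x, y))).
rewrite -[RHS](integral_chord dy (c := r ^+ 2 - x ^+ 2)).
- rewrite [RHS]integral_mkcond; apply: eq_integral => y _.
  rewrite !patchE inD lerBrDr addrC -lerBrDr; congr (if _ then _ else _).
  by apply/idP/idP; rewrite inE.
- apply: (continuous_comp2 cH2); first by move=> y; exact: cvg_cst.
  by move=> y; exact: cvg_id.
- move=> y E; apply: H0; apply: slice; rewrite E; ring.
Qed.

End disk_divergence.

(** * Deformations with small gradient *)
Lemma is_derive_affine (R : realType) (a b s : R) :
  is_derive s 1 (fun s => a + s * b) b.
Proof.
apply: (is_derive_eq (is_deriveD (is_derive_cst a s 1)
  (is_deriveM (is_derive_id s 1) (is_derive_cst b s 1)))).
by rewrite /GRing.scale/= mulr0 !add0r mulr1.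
Qed.

(** Homotopy from the identity at t = 0 to rho at t = 1. *)
Definition deform_path (R : realType) (tau : R * R -> R * R) (t : R) (w : R * R) :
  R * R := (w.1 - t * (tau w).1, w.2 - t * (tau w).2).

(** With A the matrix of entries a, b, c, d, the determinant of I - t A is expanded around (1 - t g)
    I. The linear term contains the trace of g I - A and the quadratic one its determinant; both are
    nonnegative, the second because (g - a)(g - d) - b c >= (b - c)^2 / 4. *)
Lemma jacobian_lower_bound (R : realType) (g t a b c d : R) :
  0 <= g -> g < 5^-1 -> 0 <= t -> t <= 1 -> `|a| <= g -> `|d| <= g ->
  (b + c) ^+ 2 <= 4 * ((g - a) * (g - d)) ->
  (1 - g) ^+ 2 <= (1 - t * a) * (1 - t * d) - - (t * b) * - (t * c).
Proof.
move=> g0 g5 t0 t1; rewrite !ler_norml => /andP[h1 h1'] /andP[h2 h2'] h5.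
have tg : t * g <= g by rewrite ler_piMl.
have -> : (1 - t * a) * (1 - t * d) - - (t * b) * - (t * c) =
  (1 - t * g) ^+ 2 + (1 - t * g) * t * ((g - a) + (g - d)) +
  t ^+ 2 * ((g - a) * (g - d) - b * c) by ring.
have e0 : 0 <= 1 - t * g by lra.
have e1 : 0 <= (1 - t * g) * t * ((g - a) + (g - d)).
  by rewrite !mulr_ge0//; lra.
have e2 : 0 <= t ^+ 2 * ((g - a) * (g - d) - b * c).
  by rewrite mulr_ge0 ?sqr_ge0//; have := sqr_ge0 (b - c); nra.
have e3 : (1 - g) ^+ 2 <= (1 - t * g) ^+ 2 by nra.
lra.
Qed.

Lemma grad_sup_ge0 (R : realType) (tau : R * R -> R * R) : (0 <= grad_sup tau)%E.
Proof.
apply: (@le_trans _ _ (opnorm ('d tau 0))); last first.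
  by apply: ereal_sup_ubound; exists 0.
apply: (@le_trans _ _ (enorm ('d tau 0 0))%:E); first by rewrite lee_fin enorm_ge0.
by apply: ereal_sup_ubound; exists 0 => //; rewrite /disk/= /enorm/= expr0n/= addr0 sqrtr0.
Qed.

Lemma half_sub (R : realType) (g : R) : g < 5^-1 -> 2^-1 <= 1 - g.
Proof. by move=> ?; lra. Qed.

(** With x = p1 this is the bound c * p1 <= J for c = 1/2 required by the change of variables; at g
    = 1/5 it reads 0.6 <= 0.64. *)
Lemma half_mul_le (R : realType) (g x : R) : 0 <= g -> g < 5^-1 -> x <= 1 + g ->
  2^-1 * x <= (1 - g) ^+ 2.
Proof. by move=> *; nra. Qed.

Section deformation.
Context (R : realType) (tau : R * R -> R * R) (g : R).
Hypotheses (htau : is_Ck 1 tau) (gE : grad_sup tau = g%:E) (g5 : g < 5^-1).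

Let g0 : 0 <= g. Proof. by rewrite -lee_fin -gE grad_sup_ge0. Qed.

Let t1 := fun u => (tau u).1.
Let t2 := fun u => (tau u).2.
Let t11 : R * R -> R := 'D_(1, 0) t1.
Let t12 : R * R -> R := 'D_(0, 1) t1.
Let t21 : R * R -> R := 'D_(1, 0) t2.
Let t22 : R * R -> R := 'D_(0, 1) t2.

Let C1t1 : C1 t1 t11 t12. Proof. by apply: is_Ck1_C1; exact: is_Ck_fst. Qed.
Let C1t2 : C1 t2 t21 t22. Proof. by apply: is_Ck1_C1; exact: is_Ck_snd. Qed.

Let dtau (u v : R * R) : 'd tau u v =
  (v.1 * t11 u + v.2 * t12 u, v.1 * t21 u + v.2 * t22 u).
Proof.
have H := is_diff_pair (C1_is_diff u C1t1) (C1_is_diff u C1t2).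
have E : tau = (fun u => (t1 u, t2 u)).
  by apply/funext => w; rewrite /t1 /t2; case: (tau w).
by rewrite {1}E; case: H => _ ->.
Qed.

Let dtau_le (u v : R * R) :
  enorm (v.1 * t11 u + v.2 * t12 u, v.1 * t21 u + v.2 * t22 u) <= g * enorm v.
Proof.
have [v0|v0] := eqVneq (enorm v) 0.
  have : v.1 ^+ 2 + v.2 ^+ 2 = 0 by rewrite -enorm_sqr v0 expr0n.
  move/eqP; rewrite paddr_eq0 ?sqr_ge0// !sqrf_eq0 => /andP[/eqP -> /eqP ->].
  by rewrite !mul0r addr0 v0 mulr0 /enorm/= expr0n addr0 sqrtr0.
have vp : 0 < enorm v by rewrite lt_neqAle eq_sym v0 enorm_ge0.
rewrite -ler_pdivrMr//.
pose w := ((enorm v)^-1 * v.1, (enorm v)^-1 * v.2).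
have : ((enorm ('d tau u w))%:E <= grad_sup tau)%E.
  apply: le_trans (ereal_sup_ubound _); last by exists u.
  apply: ereal_sup_ubound; exists w => //.
  by rewrite /disk/= /w enormZ normfV ger0_norm ?enorm_ge0// mulVf.
rewrite gE lee_fin dtau /w/= -!mulrA -!mulrDr.
have := enormZ (enorm v)^-1 (v.1 * t11 u + v.2 * t12 u, v.1 * t21 u + v.2 * t22 u).
move=> /= ->; by rewrite normfV ger0_norm ?enorm_ge0// mulrC.
Qed.

(** The mean value theorem is applied to the scalar product of tau(u) - tau(v) with tau along the
    segment. Working with one scalar function keeps the constant [g] for the Euclidean norm, which
    separate estimates of the components would not. *)
Lemma deformation_lipschitz u v : enorm (tau u - tau v) <= g * enorm (u - v).
Proof.
pose e := tau u - tau v; pose d := u - v.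
pose c1 (s : R) := v.1 + s * d.1; pose c2 (s : R) := v.2 + s * d.2.
have dc1 (s : R) : is_derive s 1 c1 d.1.
  exact: is_derive_affine.
have dc2 (s : R) : is_derive s 1 c2 d.2.
  exact: is_derive_affine.
pose F (s : R) := e.1 * t1 (c1 s, c2 s) + e.2 * t2 (c1 s, c2 s).
pose F' (s : R) := e.1 * (d.1 * t11 (c1 s, c2 s) + d.2 * t12 (c1 s, c2 s)) +
  e.2 * (d.1 * t21 (c1 s, c2 s) + d.2 * t22 (c1 s, c2 s)).
have dF (s : R) : is_derive s 1 F (F' s).
  have h1 := C1_path C1t1 (dc1 s) (dc2 s).
  have h2 := C1_path C1t2 (dc1 s) (dc2 s).
  exact: (is_deriveD (is_deriveZ e.1 h1) (is_deriveZ e.2 h2)).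
have [s _] := MVT_between 0 1 dF.
have -> : F 1 - F 0 = enorm e ^+ 2.
  rewrite enorm_sqr /F /c1 /c2 !mul1r !mul0r !addr0 /d /= !subrKC.
  rewrite /t1 /t2 -!surjective_pairing /e /=. ring.
rewrite subr0 mulr1 => E.
have := enorm_dot e (d.1 * t11 (c1 s, c2 s) + d.2 * t12 (c1 s, c2 s), d.1 * t21 (c1 s, c2 s) + d.2 * t22 (c1 s, c2 s)).
rewrite /= -/(F' s) -E ger0_norm ?sqr_ge0// expr2 => H.
have := le_trans H (ler_wpM2l (enorm_ge0 e) (dtau_le _ d)).
have [e0|e0] := eqVneq (enorm e) 0; first by rewrite -/e e0 mulr_ge0// enorm_ge0.
by rewrite ler_pM2l// lt_neqAle eq_sym e0 enorm_ge0.
Qed.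

(** The images of the basis vectors give A^2 + C^2 <= g^2 and B^2 + D^2 <= g^2, hence the bounds of
    the entries and, by adding, those of the determinant. By Cauchy-Schwarz the symmetric part of g
    I minus the matrix is positive semidefinite ([Q]); the last bound says that its determinant is
    nonnegative. *)
Lemma jacobian_bounds (A B C D : R) : (forall v : R * R,
  enorm (v.1 * A + v.2 * B, v.1 * C + v.2 * D) <= g * enorm v) ->
  [/\ `|A| <= g, `|D| <= g, A * D - B * C <= g ^+ 2 , - g ^+ 2 <= A * D - B * C &
   (B + C) ^+ 2 <= 4 * ((g - A) * (g - D)) ].
Proof.
move=> H.
have H2 v : (v.1 * A + v.2 * B) ^+ 2 + (v.1 * C + v.2 * D) ^+ 2 <= g ^+ 2 * (v.1 ^+ 2 + v.2 ^+ 2).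
  have := H v; rewrite -ler_sqr ?nnegrE ?enorm_ge0 ?mulr_ge0 ?enorm_ge0//.
  by rewrite exprMn !enorm_sqr.
have := H2 (1, 0); have := H2 (0, 1); rewrite /= !mul1r !mul0r !addr0 !add0r expr1n expr0n/= addr0 add0r mulr1 => h1 h2.
have Q x y : (B + C) * x * y <= (g - A) * x ^+ 2 + (g - D) * y ^+ 2.
  have := enorm_dot (x, y) (x * A + y * B, x * C + y * D) => /=.
  move=> /(le_trans (ler_norm _)) h; have := le_trans h (ler_wpM2l (enorm_ge0 _) (H (x, y))).
  rewrite mulrCA -expr2 enorm_sqr/= => ?. nra.
have AD0 : 0 <= (g - A) /\ 0 <= g - D.
  have := Q 1 0; have := Q 0 1. move=> ? ?; split; nra.
split.
- rewrite -ler_sqr ?nnegrE// real_normK ?num_real//; nra.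
- rewrite -ler_sqr ?nnegrE// real_normK ?num_real//; nra.
- have := sqr_ge0 (A - D); have := sqr_ge0 (B + C); nra.
- have := sqr_ge0 (A + D); have := sqr_ge0 (B - C); nra.
- case: AD0; set x := g - A; set y := g - D; set S := B + C => a0 d0.
  (* One test vector for each case: (S, 2 x) if x > 0, (2 y, S) if x = 0 < y, and (1, S) if x = y =
     0. *)
  have := Q S (2 * x); have := Q (2 * y) S; have := Q 1 S.
  rewrite -/x -/y -/S => q1 q2 q3.
  have [x0|x0|x0] := ltgtP 0 x; last 2 first.
  + by move: a0; rewrite leNgt x0.
  + rewrite -x0 in q1 q2 q3 *.
    have [y0|y0|y0] := ltgtP 0 y; first nra; last by rewrite -y0 in q1 q2 q3 *; nra.
    by move: d0; rewrite leNgt y0.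
  + rewrite -(ler_pM2l x0); nra.
Qed.

(** At t = 1, J - 1 is minus the trace of the gradient of tau plus its determinant, whence 2 g +
    g^2. For the intermediate maps the lower bound of the Jacobian suffices. The substitution is
    licensed with expansion constant 1/2. *)
Lemma deformation_change_of_variables (t : R) : 0 <= t <= 1 ->
  exists J : R * R -> R, [/\ continuous J, forall w, (1 - g) ^+ 2 <= J w,
    t = 1 -> forall w, `|J w - 1| <= 2 * g + g ^+ 2 &
    forall f : R * R -> \bar R,
      measurable_fun [set: measurableTypeR R * measurableTypeR R] f ->
      (forall u, 0 <= f u)%E ->
      (\int[leb2]_w (f (deform_path tau t w) * (J w)%:E) = \int[leb2]_w f w)%E].
Proof.
move=> /andP[t0 tle1].
pose p (w : R * R) : R := w.1 - t * t1 w.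
pose p1 (w : R * R) : R := 1 - t * t11 w; pose p2 (w : R * R) : R := - (t * t12 w).
pose q (w : R * R) : R := w.2 - t * t2 w.
pose q1 (w : R * R) : R := - (t * t21 w); pose q2 (w : R * R) : R := 1 - t * t22 w.
have [d11 d12 c11 c12] := C1t1; have [d21 d22 c21 c22] := C1t2.
have Cp : C1 p p1 p2.
  apply: (C1_eq (C1B (C1_fst R) (C1Z t C1t1))) => // u.
  by rewrite sub0r.
have Cq : C1 q q1 q2.
  apply: (C1_eq (C1B (C1_snd R) (C1Z t C1t2))) => // u.
  by rewrite sub0r.
have A u := jacobian_bounds (dtau_le u).
have tg : t * g <= g by rewrite ler_piMl.
have p1ge u : 1 - g <= p1 u.
  rewrite lerD2l lerN2; apply: le_trans tg; rewrite ler_wpM2l//.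
  by have [h _ _ _ _] := A u; apply: le_trans h; exact: ler_norm.
have Jge u : (1 - g) ^+ 2 <= p1 u * q2 u - p2 u * q1 u.
  by have [h1 h2 _ _ h5] := A u; exact: jacobian_lower_bound.
exists (fun w => p1 w * q2 w - p2 w * q1 w); split => //.
- case: Cp => _ _ cp1 cp2; case: Cq => _ _ cq1 cq2 u.
  by apply: cvgB; apply: cvgM; [exact: cp1|exact: cq2|exact: cp2|exact: cq1].
- move=> te u; have [h1 h2 h3 h4 _] := A u; move: h1 h2 h3 h4.
  rewrite /p1 /p2 /q1 /q2 te !ler_norml => /andP[h1 h1'] /andP[h2 h2'] h3 h4.
  apply/andP; split; nra.
- move=> f mf f0.
  have c0 : 0 < 2^-1 :> R by [].
  have half : 2^-1 <= 1 - g :> R by exact: half_sub.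
  apply: (ge0_change_of_variables c0 Cp Cq _ _ mf f0) => u.
    exact: le_trans half (p1ge u).
  apply: le_trans (Jge u).
  have : p1 u <= 1 + g.
    rewrite /p1; have [h _ _ _ _] := A u.
    have : - (t * t11 u) <= g.
      apply: le_trans (ler_norm _) _; rewrite normrN normrM ger0_norm//.
      by apply: le_trans tg; rewrite ler_wpM2l.
    lra.
  exact: half_mul_le.
Qed.

Lemma deform_path_integral_le (t : R) (f : R * R -> \bar R) : 0 <= t <= 1 ->
  measurable_fun [set: measurableTypeR R * measurableTypeR R] f ->
  (forall u, 0 <= f u)%E ->
  (\int[leb2]_w f (deform_path tau t w) <= ((1 - g) ^- 2)%:E * \int[leb2]_w f w)%E.
Proof.
move=> t01 mf f0; have [J [cJ J0 _ HJ]] := deformation_change_of_variables t01.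
have g1 : 0 < (1 - g) ^+ 2.
  by rewrite exprn_gt0// (lt_le_trans _ (half_sub g5)).
have mp : measurable_fun [set: measurableTypeR R * measurableTypeR R]
    (fun w => f (deform_path tau t w)).
  apply: (measurableT_comp mf); apply: measurable_fun_pair;
    apply: continuous_measurable_prod => w.
    apply: cvgB; first exact: cvg_fst.
    by apply: cvgM; [exact: cvg_cst|exact: (C1_continuous C1t1)].
  apply: cvgB; first exact: cvg_snd.
  by apply: cvgM; [exact: cvg_cst|exact: (C1_continuous C1t2)].
rewrite -[X in (_ <= _ * X)%E]HJ//.
apply: (@le_trans _ _ (((1 - g) ^- 2)%:E * (((1 - g) ^+ 2)%:E *
   \int[leb2]_w f (deform_path tau t w)))%E).
  by rewrite muleA -EFinM mulVf ?mul1e ?gt_eqF.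
apply: lee_wpmul2l; first by rewrite lee_fin invr_ge0 ltW.
rewrite -ge0_integralZl_EFin//; last by rewrite ltW.
apply: ge0_le_integral => //.
- by move=> w _; rewrite mule_ge0// lee_fin ltW.
- by apply: emeasurable_funM => //; exact: measurable_cst.
- apply: emeasurable_funM => //.
  by apply/measurable_EFinP; exact: continuous_measurable_prod.
- by move=> w _; rewrite muleC lee_wpmul2l// lee_fin.
Qed.

End deformation.

(** * Dirichlet energy of a Fourier-Bessel expansion *)
(** The discriminant criterion, with no sign assumed on the coefficients. It yields Cauchy-Schwarz
    for integrals over the disk and the pointwise step of Schur's test. *)
Lemma sqr_le_of_quadratic_ge0 (R : realType) (a b c : R) :
  (forall s : R, 0 <= a + 2 * s * b + s ^+ 2 * c) -> b ^+ 2 <= a * c.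
Proof.
move=> H; have a0 : 0 <= a by have := H 0; rewrite mulr0 !mul0r expr0n/= mul0r !addr0.
have [c0|c0|c0] := ltgtP c 0.
(* For c < 0 the hypothesis is contradictory: the sum of its values at s and -s is 2 (a + s^2 c),
   which is negative since s >= 1 and -s c = a - c. *)
- have := H (a / - c + 1); have := H (- (a / - c + 1)).
  set s := _ + 1 => h1 h2.
  have cn : 0 < - c by rewrite oppr_gt0.
  have s1 : 1 <= s by rewrite lerDr divr_ge0// ltW.
  have sc : s * - c = a - c by rewrite mulrDl divfK ?gt_eqF// mul1r.
  nra.
- have := H (- b / c); rewrite -(ler_pM2l c0) mulr0.
  have -> : c * (a + 2 * (- b / c) * b + (- b / c) ^+ 2 * c) = a * c - b ^+ 2.
    by field; rewrite gt_eqF.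
  by rewrite subr_ge0.
- rewrite c0 in H *; rewrite mulr0; have [->|b0] := eqVneq b 0; first by rewrite expr0n.
  have := H (- (a + 1) / (2 * b)); rewrite mulr0 addr0.
  have -> : a + 2 * (- (a + 1) / (2 * b)) * b = -1 by field.
  by rewrite oppr_ge0 ler10.
Qed.

Section disk_calculus.
Context (R : realType) (r : R).
Hypothesis r0 : 0 < r.

Definition disk_int (F : R * R -> R) : R := \int[leb2]_(u in disk r) F u.

Let mD : measurable (disk r : set (measurableTypeR R * measurableTypeR R)).
Proof. exact: disk_measurable. Qed.

Lemma disk_intD (F G : R * R -> R) : continuous F -> continuous G ->
  disk_int (fun u => F u + G u) = disk_int F + disk_int G.
Proof. by move=> cF cG; apply: RintegralD => //; exact: continuous_integrable_disk. Qed.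

Lemma disk_intB (F G : R * R -> R) : continuous F -> continuous G ->
  disk_int (fun u => F u - G u) = disk_int F - disk_int G.
Proof. by move=> cF cG; apply: RintegralB => //; exact: continuous_integrable_disk. Qed.

Lemma disk_intZ (k : R) (F : R * R -> R) : continuous F ->
  disk_int (fun u => k * F u) = k * disk_int F.
Proof. by move=> cF; apply: RintegralZl => //; exact: continuous_integrable_disk. Qed.

Lemma disk_int_sum n (F : nat -> R * R -> R) : (forall k, continuous (F k)) ->
  disk_int (fun u => \sum_(k < n) F k u) = \sum_(k < n) disk_int (F k).
Proof.
move=> cF; elim: n => [|n IH].
  under eq_fun do rewrite big_ord0.
  by rewrite big_ord0 /disk_int Rintegral_cst// mul0r.
rewrite big_ord_recr/= -IH -disk_intD//; last first.
  move=> u; elim: n {IH} => [|n IH].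
    by under eq_fun do rewrite big_ord0; exact: cvg_cst.
  under eq_fun do rewrite big_ord_recr/=.
  by apply: cvgD; [exact: IH|exact: cF].
by congr disk_int; apply/funext => u; rewrite big_ord_recr.
Qed.

Lemma disk_int_ge0 F : (forall u, 0 <= F u) -> 0 <= disk_int F.
Proof. by move=> F0; apply: Rintegral_ge0 => u _. Qed.

Lemma eq_disk_int F G : (forall u, disk r u -> F u = G u) -> disk_int F = disk_int G.
Proof. by move=> FG; apply: eq_Rintegral => u /set_mem; exact: FG. Qed.

Let cM (F G : R * R -> R) : continuous F -> continuous G -> continuous (fun u => F u * G u).
Proof. by move=> cF cG u; apply: cvgM; [exact: cF|exact: cG]. Qed.

Let cZ (k : R) (F : R * R -> R) : continuous F -> continuous (fun u => k * F u).
Proof. by move=> cF u; apply: cvgM; [exact: cvg_cst|exact: cF]. Qed.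

Let cD (F G : R * R -> R) : continuous F -> continuous G -> continuous (fun u => F u + G u).
Proof. by move=> cF cG u; apply: cvgD; [exact: cF|exact: cG]. Qed.

Lemma disk_int_CS (F G : R * R -> R) : continuous F -> continuous G ->
  disk_int (fun u => F u * G u) ^+ 2 <=
  disk_int (fun u => F u ^+ 2) * disk_int (fun u => G u ^+ 2).
Proof.
move=> cF cG; apply: sqr_le_of_quadratic_ge0 => s.
have := @disk_int_ge0 (fun u => (F u + s * G u) ^+ 2) (fun u => sqr_ge0 _).
have -> : (fun u => (F u + s * G u) ^+ 2) =
    (fun u => (F u * F u + (2 * s) * (F u * G u)) + s ^+ 2 * (G u * G u)).
  by apply/funext => u; ring.
rewrite !disk_intD ?disk_intZ; do ? [exact: cM | apply: cD | apply: cZ | apply: cM] => //.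
Qed.

(** Both products f A and f B vanish on the circle, so the integrals of their first and second
    partial derivatives, respectively, over the disk are zero; the sum of the two is the
    identity. *)
Lemma disk_green f f1 f2 A A1 A2 B B1 B2 : C1 f f1 f2 -> C1 A A1 A2 -> C1 B B1 B2 ->
  (forall u, enorm u = r -> f u = 0) ->
  disk_int (fun u => f1 u * A u + f2 u * B u) =
  - disk_int (fun u => f u * (A1 u + B2 u)).
Proof.
move=> Cf CA CB f0.
have cf := C1_continuous Cf; have cA := C1_continuous CA; have cB := C1_continuous CB.
have HA := disk_integral_d1 r0 (C1M Cf CA) (fun u hu => etrans (congr1 ( *%R^~ (A u)) (f0 u hu)) (mul0r _)).
have HB := disk_integral_d2 r0 (C1M Cf CB) (fun u hu => etrans (congr1 ( *%R^~ (B u)) (f0 u hu)) (mul0r _)).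
case: Cf CA CB => _ _ cf1 cf2 [_ _ cA1 _] [_ _ _ cB2].
have {}HA : disk_int (fun u => f1 u * A u + f u * A1 u) = 0 by rewrite /disk_int /Rintegral HA.
have {}HB : disk_int (fun u => f2 u * B u + f u * B2 u) = 0 by rewrite /disk_int /Rintegral HB.
apply/eqP; rewrite -subr_eq0 opprK -disk_intD; last 2 first.
- by apply: cD; exact: cM.
- by apply: cM => //; exact: cD.
rewrite -[X in _ == X]addr0 -{1}HA -HB -disk_intD; [|by apply: cD; exact: cM..].
by apply/eqP; congr disk_int; apply/funext => u; ring.
Qed.

End disk_calculus.

Section disk_energy.
Context (R : realType) (r : R).
Hypothesis r0 : 0 < r.
Variables (g g1 g2 g11 g12 g21 g22 : R * R -> R).
Variables (P P1 P2 P11 P12 P21 P22 : nat -> R * R -> R).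
Variables (lam a : nat -> R) (N : R).
Hypotheses (Cg : C1 g g1 g2) (Cg1 : C1 g1 g11 g12) (Cg2 : C1 g2 g21 g22)
  (g0 : forall u, enorm u = r -> g u = 0).
Hypotheses (CP : forall k, C1 (P k) (P1 k) (P2 k))
  (CP1 : forall k, C1 (P1 k) (P11 k) (P12 k))
  (CP2 : forall k, C1 (P2 k) (P21 k) (P22 k))
  (P0 : forall k u, enorm u = r -> P k u = 0)
  (Peigen : forall k u, disk r u -> P11 k u + P22 k u = - lam k * P k u)
  (Pon : forall k k', disk_int r (fun u => P k u * P k' u) = N * (k == k')%:R).

Let S n u := \sum_(k < n) a k * P k u.
Let d n := disk_int r (fun u => (g u - S n u) ^+ 2).
Hypothesis d0 : d n @[n --> \oo] --> 0.

Let cM (F G : R * R -> R) : continuous F -> continuous G -> continuous (fun u => F u * G u).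
Proof. by move=> cF cG u; apply: cvgM; [exact: cF|exact: cG]. Qed.

Let cZ (k : R) (F : R * R -> R) : continuous F -> continuous (fun u => k * F u).
Proof. by move=> cF u; apply: cvgM; [exact: cvg_cst|exact: cF]. Qed.

Let cD (F G : R * R -> R) : continuous F -> continuous G -> continuous (fun u => F u + G u).
Proof. by move=> cF cG u; apply: cvgD; [exact: cF|exact: cG]. Qed.

Let cB (F G : R * R -> R) : continuous F -> continuous G -> continuous (fun u => F u - G u).
Proof. by move=> cF cG u; apply: cvgB; [exact: cF|exact: cG]. Qed.

Let cg : continuous g. Proof. exact: (C1_continuous Cg). Qed.
Let cP k : continuous (P k). Proof. exact: (C1_continuous (CP k)). Qed.

Let cS n : continuous (S n).
Proof.
elim: n => [|n IH] u.
  by rewrite /S; under eq_fun do rewrite big_ord0; exact: cvg_cst.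
have -> : S n.+1 = (fun u => S n u + a n * P n u).
  by apply/funext => v; rewrite /S big_ord_recr.
by apply: cD => //; apply: cZ; exact: cP.
Qed.

Let lap u := g11 u + g22 u.
Let clap : continuous lap.
Proof. by apply: cD; [case: Cg1|case: Cg2]. Qed.

Let intS n (F : R * R -> R) : continuous F ->
  disk_int r (fun u => S n u * F u) = \sum_(k < n) a k * disk_int r (fun u => P k u * F u).
Proof.
move=> cF; under [RHS]eq_bigr do rewrite -(disk_intZ r0 _ (cM (@cP _) cF)).
rewrite -(disk_int_sum r0 n (F := fun k u => a k * (P k u * F u))); last first.
  by move=> k; apply: cZ; exact: cM.
congr disk_int; apply/funext => u; rewrite /S mulr_suml; apply: eq_bigr => k _.
by rewrite mulrA.
Qed.

Let dF n (F : R * R -> R) : continuous F ->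
  (disk_int r (fun u => g u * F u) - disk_int r (fun u => S n u * F u)) ^+ 2 <=
  d n * disk_int r (fun u => F u ^+ 2).
Proof.
move=> cF; rewrite -disk_intB; [|exact: r0|exact: cM|by apply: cM => //; exact: cS].
have -> : (fun u => g u * F u - S n u * F u) = (fun u => (g u - S n u) * F u).
  by apply/funext => u; rewrite mulrBl.
by apply: disk_int_CS => //; apply: cB => //; exact: cS.
Qed.

(** For n > k the integral of S n * P k is already N a_k by orthogonality, and by Cauchy-Schwarz it
    differs from that of g * P k by a quantity tending to 0. *)
Let coef k : disk_int r (fun u => g u * P k u) = N * a k.
Proof.
apply/eqP; rewrite -subr_eq0 -sqrf_eq0 eq_le sqr_ge0 andbT.
pose C := disk_int r (fun u => P k u ^+ 2).
have H : d n * C @[n --> \oo] --> 0.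
  by rewrite -[X in _ --> X](mul0r C); apply: cvgM; [exact: d0|exact: cvg_cst].
apply: (ler_cvg_to (cvg_cst _) H).
exists k.+1 => // n /= kn.
have <- : disk_int r (fun u => S n u * P k u) = N * a k.
  rewrite (intS n (@cP k)) (bigD1 (Ordinal kn))//= Pon eqxx mulr1 mulrC big1 ?addr0//.
  move=> i ik; rewrite Pon (_ : (_ == _) = false) ?mulr0//.
  by apply: contra_neqF ik => /eqP ik; apply/val_inj.
exact: dF.
Qed.

(** Applied twice, Green's identity moves the Laplacian from [g] to each eigenfunction, so the
    partial sum of the energies equals minus the integral of S n * lap. Convergence of [S n] to [g]
    in L^2 is then enough to pass to the limit: no convergence of gradients is required. A last use
    of Green's identity turns - g * lap into the squared gradient. *)
Lemma disk_energy :
  \sum_(k < n) N * lam k * a k ^+ 2 @[n --> \oo] -->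
  disk_int r (fun u => g1 u * g1 u + g2 u * g2 u).
Proof.
have E n : \sum_(k < n) N * lam k * a k ^+ 2 = - disk_int r (fun u => S n u * lap u).
  rewrite (intS n clap) -sumrN; apply: eq_bigr => k _.
  have := disk_green r0 (CP k) Cg1 Cg2 (@P0 k).
  rewrite -/lap => /(congr1 -%R); rewrite opprK => <-.
  have -> : (fun u => P1 k u * g1 u + P2 k u * g2 u) = (fun u => g1 u * P1 k u + g2 u * P2 k u).
    by apply/funext => u; rewrite mulrC [X in _ + X]mulrC.
  rewrite (disk_green r0 Cg (CP1 k) (CP2 k) g0).
  have -> : disk_int r (fun u => g u * (P11 k u + P22 k u)) = disk_int r (fun u => - lam k * (g u * P k u)).
    by apply: eq_disk_int => u ur; rewrite Peigen//; ring.
  rewrite disk_intZ//; last exact: cM.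
  by rewrite coef; ring.
under eq_fun do rewrite E.
rewrite (disk_green r0 Cg Cg1 Cg2 g0) -/lap; apply: cvgN.
pose C := disk_int r (fun u => lap u ^+ 2).
have H : d n * C @[n --> \oo] --> 0.
  by rewrite -[X in _ --> X](mul0r C); apply: cvgM; [exact: d0|exact: cvg_cst].
apply/cvgrPdist_lt => e e0; move/cvgrPdist_lt : H => /(_ (e ^+ 2)).
move=> /(_ (exprn_gt0 2 e0)); apply: filterS => n; rewrite sub0r normrN => Hn.
rewrite -ltr_sqr ?nnegrE ?(ltW e0)// real_normK ?num_real//.
exact: le_lt_trans (dF n clap) (le_lt_trans (ler_norm _) Hn).
Qed.

End disk_energy.

(** * Bessel functions as power series *)

Section bessel_series.
Context (R : realType).

Definition bessel_coeff (m i : nat) : R := (-1) ^+ i / (i`! * (i + m)`!)%:R.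

Lemma bessel_coeff_cvg m (y : R) : cvgn (pseries (bessel_coeff m) y).
Proof.
apply: normed_cvg; apply: (series_le_cvg _ _ _ (is_cvg_series_exp_coeff `|y|)).
- by move=> i; exact: normr_ge0.
- by move=> i; exact: exp_coeff_ge0.
move=> i; rewrite -[leLHS]/(`|bessel_coeff m i * y ^+ i|) -[leRHS]/(`|y| ^+ i / i`!%:R).
rewrite /bessel_coeff mulrC normrM normrX ler_wpM2l ?exprn_ge0//.
rewrite normrM normrX normrN1 expr1n mul1r normfV ger0_norm// lef_pV2 ?posrE ?ltr0n ?muln_gt0 ?fact_gt0//.
by rewrite ler_nat leq_pmulr// fact_gt0.
Qed.

(** The entire function E_m such that J_m (x) = (x / 2)^m E_m ((x / 2)^2). As a function of the
    squared radius it causes no difficulty at the origin. *)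
Definition bessel_entire (m : nat) (y : R) : R := limn (pseries (bessel_coeff m) y).

Lemma pseries_diffs_bessel m : pseries_diffs (bessel_coeff m) = - bessel_coeff m.+1.
Proof.
apply/funext => i; rewrite /pseries_diffs /bessel_coeff.
rewrite -[RHS]/(- ((-1) ^+ i / (i`! * (i + m.+1)`!)%:R)).
have -> : ((i.+1)`! * (i.+1 + m)`! = i.+1 * (i`! * (i + m.+1)`!))%N.
  by rewrite factS addSnnS mulnA.
have n0 : (i`! * (i + m.+1)`!)%:R != 0 :> R by rewrite pnatr_eq0 -lt0n muln_gt0 !fact_gt0.
rewrite natrM exprS; have n1 : i.+1%:R != 0 :> R by rewrite pnatr_eq0.
by move: n0 n1; move: ((i`! * _)%:R) (i.+1%:R) => p q n0 n1; field; rewrite n0 n1.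
Qed.

Lemma bessel_entire_derive m (y : R) :
  is_derive y 1 (bessel_entire m) (- bessel_entire m.+1 y).
Proof.
have cN m' K : cvgn (pseries (- bessel_coeff m') K).
  have -> : pseries (- bessel_coeff m') K = - pseries (bessel_coeff m') K.
    apply/funext => n; rewrite /pseries/series/= -[RHS]/(- \sum_(0 <= i < n) _) -sumrN.
    by apply: eq_bigr => i _; exact: mulNr.
  by apply: is_cvgN; exact: bessel_coeff_cvg.
have E : limn (pseries (pseries_diffs (bessel_coeff m)) y) = - bessel_entire m.+1 y.
  rewrite pseries_diffs_bessel /bessel_entire -limN; last exact: bessel_coeff_cvg.
  congr (limn _); apply/funext => n; rewrite /pseries/series/= -[RHS]/(- \sum_(0 <= i < n) _) -sumrN.
  by apply: eq_bigr => i _; exact: mulNr.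
rewrite -E; apply: (@pseries_snd_diffs R _ (`|y| + 1)).
- exact: bessel_coeff_cvg.
- by rewrite pseries_diffs_bessel; exact: cN.
- rewrite pseries_diffs_bessel pseries_diffsN pseries_diffs_bessel opprK.
  exact: bessel_coeff_cvg.
- by rewrite [ltRHS]ger0_norm ?addr_ge0// ltrDl.
Qed.

Lemma bessel_entire_continuous m : continuous (bessel_entire m).
Proof. exact: (is_derive_continuous (bessel_entire_derive m)). Qed.

(** Bessel's equation in the variable (x / 2)^2: since E_m' = - E_(m+1), it reads y E_m'' + (m + 1)
    E_m' + E_m = 0. *)
Lemma bessel_entire_ode m (y : R) :
  y * bessel_entire m.+2 y - m.+1%:R * bessel_entire m.+1 y + bessel_entire m y = 0.
Proof.
have c m' : series (fun i => bessel_coeff m' i * y ^+ i) @ \oo --> bessel_entire m' y.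
  exact: bessel_coeff_cvg.
have cs m' : series (fun i => bessel_coeff m' i * y ^+ i) n.+1 @[n --> \oo] --> bessel_entire m' y.
  by rewrite (cvg_shiftS (series (fun i => bessel_coeff m' i * y ^+ i))).
pose S m' := series (fun i => bessel_coeff m' i * y ^+ i).
(* The factor y raises degrees by one, so the first partial sum has one term less than the other
   two; with this shift the combination is exactly 0 for every n. *)
have H : y * S m.+2 n - m.+1%:R * S m.+1 n.+1 + S m n.+1 @[n --> \oo] -->
    y * bessel_entire m.+2 y - m.+1%:R * bessel_entire m.+1 y + bessel_entire m y.
  apply: cvgD; last exact: cs.
  apply: cvgB; apply: cvgM; [exact: cvg_cst|exact: c|exact: cvg_cst|exact: cs].
apply: (cvg_unique _ H) => //.
rewrite (_ : (fun n => _) = fun=> 0); first exact: cvg_cst.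
apply/funext => n.
rewrite /S /series/=.
elim: n => [|n IH].
  rewrite big_nil !big_nat1 mulr0 sub0r /bessel_coeff !add0n !expr0 !mulr1 !fact0 !mul1n !div1r.
  by rewrite factS natrM invfM mulrA divff ?pnatr_eq0// mul1r addNr.
rewrite big_nat_recr// (big_nat_recr n.+1)//= (big_nat_recr n.+1)//= !mulrDr.
move: IH; set a := y * _; set b := m.+1%:R * \sum_(_ <= _ < _) _; set d := \sum_(_ <= _ < _) _.
move=> IH; rewrite [LHS](_ : _ = (a - b + d) + (y * (bessel_coeff m.+2 n * y ^+ n) -
   m.+1%:R * (bessel_coeff m.+1 n.+1 * y ^+ n.+1) + bessel_coeff m n.+1 * y ^+ n.+1)); last by ring.
rewrite IH add0r /bessel_coeff.
have f0 : (n`!)%:R != 0 :> R by rewrite pnatr_eq0 -lt0n fact_gt0.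
have -> : (n + m.+2 = (n.+1 + m).+1)%N by rewrite !addnS addSn.
have -> : (n.+1 + m.+1 = (n.+1 + m).+1)%N by rewrite !addnS.
have : (n.+1 + m).+1%:R = n.+1%:R + m.+1%:R :> R by rewrite -natrD addnS.
move: (n.+1 + m)%N => p Ep.
have f1 : (p`!)%:R != 0 :> R by rewrite pnatr_eq0 -lt0n fact_gt0.
rewrite (factS n) (factS p) !natrM !exprS Ep.
have n1 : n.+1%:R != 0 :> R by rewrite pnatr_eq0.
have n2 : n.+1%:R + m.+1%:R != 0 :> R by rewrite -natrD pnatr_eq0.
move: f0 f1 n1 n2; move: (n`!)%:R (p`!)%:R n.+1%:R m.+1%:R => f g p' q f0 f1 n1 n2.
by field; rewrite f0 f1 n1 n2.
Qed.

Lemma besselJE m (x : R) :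
  besselJ m x = (x / 2) ^+ m * bessel_entire m ((x / 2) ^+ 2).
Proof.
rewrite /besselJ /bessel_entire /pseries.
apply/cvg_lim => //.
have H : (x / 2) ^+ m * pseries (bessel_coeff m) ((x / 2) ^+ 2) n @[n --> \oo] -->
    (x / 2) ^+ m * bessel_entire m ((x / 2) ^+ 2).
  by apply: cvgM; [exact: cvg_cst|exact: bessel_coeff_cvg].
apply: cvg_trans H; apply: near_eq_cvg; near=> n.
rewrite /pseries /series/= big_distrr/=; apply: eq_bigr => i _.
by rewrite /bessel_coeff exprD exprM; ring.
Unshelve. all: by end_near. Qed.

End bessel_series.

(** * Harmonic polynomials and Laplacian eigenfunctions *)

Section harmonic.
Context (R : realType).

Fixpoint harm (m : nat) (u : R * R) : R * R :=
  if m is m'.+1 then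
    (u.1 * (harm m' u).1 - u.2 * (harm m' u).2,
     u.1 * (harm m' u).2 + u.2 * (harm m' u).1)
  else (1, 0).

Lemma harm_polar m (r t : R) : harm m (r * cos t, r * sin t) =
  (r ^+ m * cos (m%:R * t), r ^+ m * sin (m%:R * t)).
Proof.
elim: m => [|m IH]; first by rewrite /= mul0r cos0 sin0 expr0 mul1r mulr0.
rewrite /= IH /= -natr1 mulrDl mul1r cosD sinD exprSr; congr pair; ring.
Qed.

(** The derivative of z^m is m z^(m-1), and the Cauchy-Riemann equations give the partial
    derivatives of both components. *)
Lemma harm_C1 m :
  C1 (fun u => (harm m u).1) (fun u => m%:R * (harm m.-1 u).1)
     (fun u => - (m%:R * (harm m.-1 u).2)) /\
  C1 (fun u => (harm m u).2) (fun u => m%:R * (harm m.-1 u).2)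
     (fun u => m%:R * (harm m.-1 u).1).
Proof.
elim: m => [|m [IH1 IH2]].
  split; [apply: (C1_eq (C1_cst (1 : R)))|apply: (C1_eq (C1_cst (0 : R)))] => u;
    by rewrite mul0r ?oppr0.
split.
  apply: (C1_eq (C1B (C1M (C1_fst R) IH1) (C1M (C1_snd R) IH2))) => u /=.
    case: m {IH1 IH2} => [|m] /=; first by rewrite /=; ring.
    by rewrite -[m.+2%:R]natr1 /=; ring.
  case: m {IH1 IH2} => [|m] /=; first by rewrite /=; ring.
  by rewrite -[m.+2%:R]natr1 /=; ring.
apply: (C1_eq (C1D (C1M (C1_fst R) IH2) (C1M (C1_snd R) IH1))) => u /=.
  case: m {IH1 IH2} => [|m] /=; first by rewrite /=; ring.
  by rewrite -[m.+2%:R]natr1 /=; ring.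
case: m {IH1 IH2} => [|m] /=; first by rewrite /=; ring.
by rewrite -[m.+2%:R]natr1 /=; ring.
Qed.

Definition C2 (f f1 f2 f11 f12 f21 f22 : R * R -> R) :=
  [/\ C1 f f1 f2, C1 f1 f11 f12 & C1 f2 f21 f22].

(* harm m u is (x + i y)^m; the last identity is Euler's for homogeneous functions. *)
Lemma harm_C2 m (s : bool) : exists h1 h2 h11 h12 h21 h22,
  [/\ C2 (fun u => if s then (harm m u).1 else (harm m u).2) h1 h2 h11 h12 h21 h22,
    forall u, h11 u + h22 u = 0 &
    forall u, u.1 * h1 u + u.2 * h2 u = m%:R * (if s then (harm m u).1 else (harm m u).2)].
Proof.
have [A1 A2] := harm_C1 m; have [B1 B2] := harm_C1 m.-1.
case: s.
  exists (fun u => m%:R * (harm m.-1 u).1), (fun u => - (m%:R * (harm m.-1 u).2)).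
  exists (fun u => m%:R * (m.-1%:R * (harm m.-2 u).1)), (fun u => m%:R * - (m.-1%:R * (harm m.-2 u).2)).
  exists (fun u => - m%:R * (m.-1%:R * (harm m.-2 u).2)), (fun u => - m%:R * (m.-1%:R * (harm m.-2 u).1)).
  split.
  - split => //; first exact: (C1Z m%:R B1).
    have := C1Z (- m%:R) B2; congr C1; apply/funext => u; by rewrite mulNr.
  - by move=> u; ring.
  - by move=> u; case: m {A1 A2 B1 B2} => [|m] /=; ring.
exists (fun u => m%:R * (harm m.-1 u).2), (fun u => m%:R * (harm m.-1 u).1).
exists (fun u => m%:R * (m.-1%:R * (harm m.-2 u).2)), (fun u => m%:R * (m.-1%:R * (harm m.-2 u).1)).
exists (fun u => m%:R * (m.-1%:R * (harm m.-2 u).1)), (fun u => m%:R * - (m.-1%:R * (harm m.-2 u).2)).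
split.
- by split => //; [exact: (C1Z m%:R B2)|exact: (C1Z m%:R B1)].
- by move=> u; ring.
- by move=> u; case: m {A1 A2 B1 B2} => [|m] /=; ring.
Qed.

Lemma bessel_radial_C1 m (k : R) :
  C1 (fun u : R * R => bessel_entire m (k * (u.1 * u.1 + u.2 * u.2)))
     (fun u => - 2 * k * u.1 * bessel_entire m.+1 (k * (u.1 * u.1 + u.2 * u.2)))
     (fun u => - 2 * k * u.2 * bessel_entire m.+1 (k * (u.1 * u.1 + u.2 * u.2))).
Proof.
have Cq := C1Z k (C1D (C1M (C1_fst R) (C1_fst R)) (C1M (C1_snd R) (C1_snd R))).
have cq : continuous (fun u : R * R => k * (u.1 * u.1 + u.2 * u.2)) := C1_continuous Cq.
have ce m' : continuous (fun u : R * R => bessel_entire m' (k * (u.1 * u.1 + u.2 * u.2))).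
  by move=> u; exact: (continuous_cvg _ (@bessel_entire_continuous R m' _) (cq u)).
have D (v u : R * R) : is_derive u v
    (fun u : R * R => bessel_entire m (k * (u.1 * u.1 + u.2 * u.2)))
    ((v.1 * (k * (1 * u.1 + u.1 * 1 + (0 * u.2 + u.2 * 0))) +
      v.2 * (k * (0 * u.1 + u.1 * 0 + (1 * u.2 + u.2 * 1)))) *
     - bessel_entire m.+1 (k * (u.1 * u.1 + u.2 * u.2))).
  set z := k * (u.1 * u.1 + u.2 * u.2).
  have [db vb] := bessel_entire_derive m z.
  have hb : is_diff z (bessel_entire m) (fun h => h * - bessel_entire m.+1 z).
    move/derivable1_diffP : (db) => db'; split => //.
    by rewrite deriv1E// derive1E vb.
  have [d e] := @is_diff_comp _ _ _ _ (fun u : R * R => k * (u.1 * u.1 + u.2 * u.2)) _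
    (bessel_entire m) _ u (C1_is_diff u Cq) hb.
  split; first exact: diff_derivable.
  by rewrite deriveE// e.
split => u.
- by apply: (is_derive_eq (D (1, 0) u)) => /=; ring.
- by apply: (is_derive_eq (D (0, 1) u)) => /=; ring.
- by apply: cvgM; [apply: cvgM; [exact: cvg_cst|exact: cvg_fst]|exact: ce].
- by apply: cvgM; [apply: cvgM; [exact: cvg_cst|exact: cvg_snd]|exact: ce].
Qed.

(** In the Laplacian of the product, the term with the Laplacian of the polynomial vanishes, Euler's
    identity makes the cross term a multiple of the polynomial, and [bessel_entire_ode] combines
    what is left into -4 k times the function. *)
Lemma bessel_eigenfunction m (s : bool) (k c : R) : exists f1 f2 f11 f12 f21 f22,
  let f u := c * ((if s then (harm m u).1 else (harm m u).2) *
     bessel_entire m (k * (u.1 * u.1 + u.2 * u.2))) in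
  C2 f f1 f2 f11 f12 f21 f22 /\ forall u, f11 u + f22 u = - (4 * k) * f u.
Proof.
have [h1 [h2 [h11 [h12 [h21 [h22 [[Ch Ch1 Ch2] lap euler]]]]]]] := harm_C2 m s.
have E0 := bessel_radial_C1 m k; have E1 := bessel_radial_C1 m.+1 k.
have F1 := C1M (C1Z (- 2 * k) (C1_fst R)) E1.
have F2 := C1M (C1Z (- 2 * k) (C1_snd R)) E1.
have H := C1Z c (C1M Ch E0).
have H1 := C1Z c (C1D (C1M Ch1 E0) (C1M Ch F1)).
have H2 := C1Z c (C1D (C1M Ch2 E0) (C1M Ch F2)).
do 6 eexists; split; first by split; [exact: H|exact: H1|exact: H2].
move=> u /=; have := euler u; have := lap u.
have := bessel_entire_ode m (k * (u.1 * u.1 + u.2 * u.2)).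
move: (h1 u) (h2 u) (h11 u) (h22 u) (if s then _ else _) => a1 a2 a11 a22 hh.
move: (bessel_entire m _) (bessel_entire m.+1 _) (bessel_entire m.+2 _) => e0 e1 e2.
case: u => x y /=; rewrite -natr1 => ode /eqP; rewrite addr_eq0 => /eqP -> eu.
have -> : e0 = (m%:R + 1) * e1 - k * (x * x + y * y) * e2 by lra.
rewrite [LHS](_ : _ = c * (- (4 * k) * e1 * (x * a1 + y * a2) - 4 * k * hh * e1 +
  4 * k ^+ 2 * (x * x + y * y) * e2 * hh)); last by ring.
by rewrite eu; ring.
Qed.

End harmonic.

Lemma polar_coordinates (R : realType) (u : R * R) :
  exists theta, u = (enorm u * cos theta, enorm u * sin theta).
Proof.
have [u0|u0] := eqVneq (enorm u) 0.
  exists 0; have : u.1 ^+ 2 + u.2 ^+ 2 = 0 by rewrite -enorm_sqr u0 expr0n.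
  move/eqP; rewrite paddr_eq0 ?sqr_ge0// !sqrf_eq0 => /andP[/eqP h1 /eqP h2].
  by rewrite u0 !mul0r [LHS]surjective_pairing h1 h2.
have up : 0 < enorm u by rewrite lt_neqAle eq_sym u0 enorm_ge0.
have xb : -1 <= u.1 / enorm u <= 1.
  by rewrite -ler_norml normrM normfV (ger0_norm (ltW up)) ler_pdivrMr// mul1r norm_fst_enorm.
have cx : enorm u * cos (acos (u.1 / enorm u)) = u.1.
  by rewrite acosK ?in_itv//= mulrC divfK.
have sx : enorm u * sin (acos (u.1 / enorm u)) = `|u.2|.
  rewrite sin_acos// -[X in X * _](ger0_norm (ltW up)) -sqrtr_sqr -sqrtrM ?sqr_ge0//.
  rewrite -[RHS]sqrtr_sqr; congr Num.sqrt.
  by rewrite mulrBr mulr1 -exprMn mulrC divfK// enorm_sqr addrC addKr.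
have [y0|y0] := leP 0 u.2.
  exists (acos (u.1 / enorm u)); rewrite cx sx ger0_norm//; exact: surjective_pairing.
exists (- acos (u.1 / enorm u)); rewrite cosN sinN mulrN cx sx ltr0_norm// opprK.
exact: surjective_pairing.
Qed.

Section FB_functions.
Context (R : realType) (B : FB_basis R).

(** [fb_psi] is prescribed only on the closed disk and in polar coordinates. The function [f],
    written with polynomials and [bessel_entire], extends it to the whole plane, where its partial
    derivatives make sense. *)
Lemma FB_eigenfunction k : exists f f1 f2 f11 f12 f21 f22,
  [/\ C2 f f1 f2 f11 f12 f21 f22,
     forall u, f11 u + f22 u = - fb_mu B k * f u,
     forall u, disk 1 u -> fb_psi B k u = f u &
     forall u, enorm u = 1 -> f u = 0].
Proof.
have := fb_psi_polar B k; have := fb_muE B k.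
have [fe _ _] := fb_enum_bij B; have := fe k I.
case: (fb_enum B k) => [[m q] s] /= [/= q0 _] muE pol.
have [_ J0 _] := fb_rootP B m q0.
set rho := fb_root B m q in muE pol J0.
(* The power of rho / 2 is the part of the factor (x / 2)^m of J_m that [harm] does not provide. The
   parameter (rho / 2)^2 gives the eigenvalue 4 (rho / 2)^2 = rho^2. *)
pose c := fb_const B k * (rho / 2) ^+ m.
have [f1 [f2 [f11 [f12 [f21 [f22 [C lap]]]]]]] := bessel_eigenfunction m s ((rho / 2) ^+ 2) c.
set f := (fun u => c * _) in C lap.
have E u : disk 1 u -> fb_psi B k u = f u.
  move=> u1; have [th ue] := polar_coordinates u.
  have r01 : 0 <= enorm u <= 1 by rewrite enorm_ge0.
  rewrite {1}ue pol// besselJE /f /c.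
  have -> : (rho / 2) ^+ 2 * (u.1 * u.1 + u.2 * u.2) = (rho * enorm u / 2) ^+ 2.
    by rewrite -!expr2 -enorm_sqr; ring.
  have -> : harm m u = (enorm u ^+ m * cos (m%:R * th), enorm u ^+ m * sin (m%:R * th)).
    by rewrite {1}ue harm_polar.
  rewrite /fb_angular/=.
  have -> : (rho * enorm u / 2) ^+ m = (rho / 2) ^+ m * enorm u ^+ m by rewrite -exprMn; congr (_ ^+ _); ring.
  by case: (s); ring.
exists f, f1, f2, f11, f12, f21, f22; split => //.
- by move=> u; rewrite lap muE; congr (- _ * _); rewrite expr_div_n; field.
- move=> u u1; rewrite -E; last by rewrite /disk/= u1.
  have [th ue] := polar_coordinates u.
  by rewrite ue u1 pol ?ler01 ?lexx// mulr1 J0 mulr0 mul0r.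
Qed.

End FB_functions.

Section scaling.
Local Open Scope ereal_scope.
Context (R : realType) (r : R).
Hypothesis r0 : (0 < r)%R.

Lemma ge0_leb2_scale (f : R * R -> \bar R) :
  measurable_fun [set: measurableTypeR R * measurableTypeR R] f ->
  (forall u, 0 <= f u) ->
  \int[leb2]_u f u = (r ^+ 2)%:E * \int[leb2]_u f (r * u.1, r * u.2)%R.
Proof.
move=> mf f0.
have Cp := C1Z r (C1_fst R); have Cq := C1Z r (C1_snd R).
rewrite -[LHS](ge0_change_of_variables r0 Cp Cq _ _ mf f0).
- rewrite -ge0_integralZl_EFin ?sqr_ge0//.
  + by apply: eq_integral => u _; rewrite muleC; congr (_%:E * _); ring.
  + apply: (measurableT_comp mf); apply: measurable_fun_pair; apply: continuous_measurable_prod.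
      exact: (C1_continuous Cp).
    exact: (C1_continuous Cq).
- by move=> u; rewrite mulr1.
- by move=> u; rewrite mulr0 mul0r subr0 mulr1.
Qed.

Lemma ge0_leb2_scale_disk (f : R * R -> R) : continuous f -> (forall u, 0 <= f u)%R ->
  \int[leb2]_(u in disk r) (f u)%:E =
  (r ^+ 2)%:E * \int[leb2]_(u in disk 1) (f (r * u.1, r * u.2)%R)%:E.
Proof.
move=> cf f0; rewrite integral_mkcond ge0_leb2_scale.
- rewrite [in RHS]integral_mkcond; congr (_ * _); apply: eq_integral => u _.
  rewrite !patchE; congr (if _ then _ else _).
  have H : enorm (r * u.1, r * u.2)%R = (r * enorm u)%R.
    by rewrite enormZ ger0_norm// ltW.
  apply/idP/idP; rewrite !inE /disk/= H.
    by rewrite -[X in (_ <= X)%R -> _]mulr1 ler_pM2l.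
  by rewrite -[X in _ -> (_ <= X)%R]mulr1 ler_pM2l.
- have mD : measurable (disk r : set (measurableTypeR R * measurableTypeR R)) by exact: disk_measurable.
  apply/(measurable_restrictT _ mD).
  by apply: measurable_funTS; apply/measurable_EFinP; exact: continuous_measurable_prod.
- by move=> u; rewrite patchE; case: ifP => // _; rewrite lee_fin.
Qed.

End scaling.

Lemma EFin_disk_int (R : realType) (r : R) (F : R * R -> R) : 0 < r -> continuous F ->
  (disk_int r F)%:E = (\int[leb2]_(u in disk r) (F u)%:E)%E.
Proof.
move=> r0 cF; rewrite /disk_int /Rintegral fineK//.
apply: integrable_fin_num; first exact: disk_measurable.
exact: continuous_integrable_disk.
Qed.

(** A finite norm excludes an infinite sum, whose square root would be infinite; the series then
    converges in the reals. *)
Lemma FB_normE (R : realType) (B : FB_basis R) (a : nat -> R) (F : R) :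
  FB_norm B a = F%:E -> 0 <= F /\
  \sum_(k < n) fb_mu B k * a k ^+ 2 @[n --> \oo] --> F ^+ 2.
Proof.
rewrite /FB_norm; set S := (\sum_(k <oo) _)%E => FE.
have mu0 k : 0 <= fb_mu B k * a k ^+ 2.
  rewrite mulr_ge0 ?sqr_ge0//; have := fb_muE B k.
  by case: (fb_enum B k) => [[m q] s] ->; exact: sqr_ge0.
have S0 : (0 <= S)%E by apply: nneseries_ge0 => k _ _; rewrite lee_fin.
have Sfin : S = (fine S)%:E.
  rewrite fineK// ge0_fin_numE// ltey; apply/eqP => Soo.
  by move: FE; rewrite Soo poweRyr// invr_gt0.
have FS : F = Num.sqrt (fine S).
  move: FE; rewrite Sfin poweR_EFin => -[<-].
  by rewrite powR12_sqrt// fine_ge0.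
split; first by rewrite FS sqrtr_ge0.
rewrite FS sqr_sqrtr ?fine_ge0//.
have : (\sum_(0 <= k < n) (fb_mu B k * a k ^+ 2)%:E)%E @[n --> \oo] --> (fine S)%:E.
  by rewrite -Sfin; apply: is_cvg_nneseries => k _ _; rewrite lee_fin.
under eq_fun do rewrite sumEFin big_mkord.
by move/fine_cvgP => [].
Qed.

Lemma is_Ck2_C2 (R : realType) (f : R * R -> R) : is_Ck 1 f -> is_Ck 2 f ->
  exists f1 f2 f11 f12 f21 f22, C2 f f1 f2 f11 f12 f21 f22.
Proof.
move=> H1 H2; have {}H1 := is_Ck1_C1 H1.
have [_ D1 D2] : [/\ forall u : R * R, derivable f u (1, 0) /\ derivable f u (0, 1),
  is_Ck 1 ('D_(1, 0) f) & is_Ck 1 ('D_(0, 1) f)] := H2.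
by do 6 eexists; split; [exact: H1|exact: (is_Ck1_C1 D1)|exact: (is_Ck1_C1 D2)].
Qed.

Section FB_filter_energy.
Context (R : realType) (B : FB_basis R) (j : R) (a : nat -> R) (w : R * R -> R) (F : R).
Hypotheses (hw : is_FB_filter B j a w) (hF : FB_norm B a = F%:E).

Let r : R := 2 `^ j.
Let r0 : 0 < r. Proof. exact: powR_gt0. Qed.

Let psi_scaledE k u : psi_scaled B j k u = r ^- 2 * fb_psi B k (r^-1 * u.1, r^-1 * u.2).
Proof.
rewrite /psi_scaled /r -powRN; congr (_ * _).
by rewrite powRN mulrC powRrM powR_mulrn ?powR_ge0.
Qed.

(** By scaling to the unit disk: h(u) = r^2 g(r u) has the same coefficients in the unscaled basis.
    Its squared gradient is r^6 times that of [g] at r u, and the area contributes r^2, whence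
    r^-4. *)
Lemma FB_filter_energy : exists g g1 g2,
  [/\ C1 g g1 g2, forall u, disk r u -> w u = g u,
      forall u, r <= enorm u -> w u = 0 &
      (\int[leb2]_(u in disk r) (g1 u ^+ 2 + g2 u ^+ 2)%:E = (pi * F ^+ 2 * r ^- 4)%:E)%E].
Proof.
case: hw => w0 [g smg wg] L2.
have [g1 [g2 [g11 [g12 [g21 [g22 [Cg Cg1 Cg2]]]]]]] := is_Ck2_C2 (smg 1%N) (smg 2).
exists g, g1, g2; split => //.
pose h (u : R * R) := r ^+ 2 * g (r * u.1, r * u.2).
have [_ FS] := FB_normE hF.
have rn0 : r != 0 by rewrite gt_eqF.
have Cscale f f1 f2 : C1 f f1 f2 ->
  C1 (fun u : R * R => f (r * u.1, r * u.2)) (fun u => r * f1 (r * u.1, r * u.2))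
     (fun u => r * f2 (r * u.1, r * u.2)).
  move=> Cf.
  have cs : continuous (fun u : R * R => ((r * u.1, r * u.2) : R * R)).
    by apply: continuous_pair2; apply: (C1_continuous (C1Z r _)); [exact: C1_fst|exact: C1_snd].
  have D (v u : R * R) : is_derive u v (fun u : R * R => f (r * u.1, r * u.2))
     (r * v.1 * f1 (r * u.1, r * u.2) + r * v.2 * f2 (r * u.1, r * u.2)).
    have hs := is_diff_pair (C1_is_diff u (C1Z r (C1_fst R))) (C1_is_diff u (C1Z r (C1_snd R))).
    have [d e] := @is_diff_comp _ _ _ _ (fun u : R * R => (r * u.1, r * u.2)) _ f _ u hs
      (C1_is_diff (r * u.1, r * u.2) Cf).
    split; first exact: diff_derivable.
    by rewrite deriveE// e /=; ring.
  case: (Cf) => _ _ c1 c2; split=> u.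
  - by apply: (is_derive_eq (D (1, 0) u)); rewrite /=; ring.
  - by apply: (is_derive_eq (D (0, 1) u)); rewrite /=; ring.
  - apply: cvgM; first exact: cvg_cst.
    exact: (continuous_cvg _ (c1 _) (cs u)).
  - apply: cvgM; first exact: cvg_cst.
    exact: (continuous_cvg _ (c2 _) (cs u)).
have Ch := C1Z (r ^+ 2) (Cscale _ _ _ Cg).
have Ch1 := C1Z (r ^+ 2) (C1Z r (Cscale _ _ _ Cg1)).
have Ch2 := C1Z (r ^+ 2) (C1Z r (Cscale _ _ _ Cg2)).
have h0 u : enorm u = 1 -> h u = 0.
  move=> u1; rewrite /h -wg.
    by rewrite w0 ?mulr0// enormZ u1 mulr1 ger0_norm// ltW.
  by rewrite /disk/= enormZ u1 mulr1 ger0_norm// ltW.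
have /choice[P HP] := FB_eigenfunction B.
have /choice[P1 {}HP] := HP. have /choice[P2 {}HP] := HP.
have /choice[P11 {}HP] := HP. have /choice[P12 {}HP] := HP.
have /choice[P21 {}HP] := HP. have /choice[P22 {}HP] := HP.
have CP k := let: And4 (And3 C _ _) _ _ _ := HP k in C.
have CP1 k := let: And4 (And3 _ C _) _ _ _ := HP k in C.
have CP2 k := let: And4 (And3 _ _ C) _ _ _ := HP k in C.
have Peig k u (_ : disk 1 u) := let: And4 _ E _ _ := HP k in E u.
have PE k u (hu : disk 1 u) := let: And4 _ _ E _ := HP k in E u hu.
have P0 k u (hu : enorm u = 1) := let: And4 _ _ _ E := HP k in E u hu.
have Pon k k' : disk_int 1 (fun u => P k u * P k' u) = pi * (k == k')%:R.
  rewrite -(fb_psi_normalized B); apply: eq_disk_int => u hu.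
  by rewrite !PE.
have cP k : continuous (P k) := C1_continuous (CP k).
pose S n u := \sum_(k < n) a k * P k u.
have cS n : continuous (S n).
  elim: n => [|n IH].
    have -> : S 0%N = fun=> 0 by apply/funext => u; rewrite /S big_ord0.
    by move=> u; exact: cvg_cst.
  have -> : S n.+1 = fun u => S n u + a n * P n u by apply/funext => u; rewrite /S big_ord_recr.
  move=> u; apply: cvgD; first exact: IH.
  by apply: cvgM; [exact: cvg_cst|exact: cP].
have chS n : continuous (fun u => (h u - S n u) ^+ 2).
  have c : continuous (fun u => (h u - S n u) * (h u - S n u)).
    by move=> u; apply: cvgM; apply: cvgB; do ?[exact: (C1_continuous Ch)|exact: cS].
  by under eq_fun do rewrite expr2.
have d0 : disk_int 1 (fun u => (h u - S n u) ^+ 2) @[n --> \oo] --> 0.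
  (* The square of [h] carries r^4 and the change of area r^-2. *)
  have E n : ((disk_int 1 (fun u => (h u - S n u) ^+ 2))%:E =
      (r ^+ 2)%:E * \int[leb2]_(u in disk r)
         ((w u - \sum_(k < n) a k * psi_scaled B j k u) ^+ 2)%:E)%E.
    rewrite EFin_disk_int ?ltr01//.
    pose q u := (g u - r ^- 2 * S n (r^-1 * u.1, r^-1 * u.2)) ^+ 2.
    have cq : continuous q.
      have cs : continuous (fun u : R * R => ((r^-1 * u.1, r^-1 * u.2) : R * R)).
        by apply: continuous_pair2; apply: (C1_continuous (C1Z r^-1 _)); [exact: C1_fst|exact: C1_snd].
      have c : continuous (fun u => g u - r ^- 2 * S n (r^-1 * u.1, r^-1 * u.2)).
        move=> u; apply: cvgB; first exact: (C1_continuous Cg).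
        apply: cvgM; first exact: cvg_cst.
        exact: (continuous_cvg _ (cS n _) (cs u)).
      rewrite /q; under eq_fun do rewrite expr2.
      by move=> u; apply: cvgM; exact: c.
    rewrite (_ : (\int[leb2]_(u in disk r) _)%E = \int[leb2]_(u in disk r) (q u)%:E)%E; last first.
      apply: eq_integral => u /set_mem ur; rewrite /q (wg _ ur); congr ((_ - _) ^+ 2)%:E.
      rewrite /S mulr_sumr; apply: eq_bigr => k _; rewrite psi_scaledE PE; first by ring.
      by rewrite /disk/= enormZ normfV (ger0_norm (ltW r0)) mulrC ler_pdivrMr// mul1r.
    rewrite (ge0_leb2_scale_disk r0 cq); last by move=> u; exact: sqr_ge0.
    have cq1 : continuous (fun u : R * R => q (r * u.1, r * u.2)).
      have cs : continuous (fun u : R * R => ((r * u.1, r * u.2) : R * R)).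
        by apply: continuous_pair2; apply: (C1_continuous (C1Z r _)); [exact: C1_fst|exact: C1_snd].
      by move=> u; exact: (continuous_cvg _ (cq _) (cs u)).
    rewrite muleA -EFinM -!EFin_disk_int ?ltr01// -EFinM -disk_intZ ?ltr01//.
    congr (_%:E); congr disk_int; apply/funext => u; rewrite /q /h.
    rewrite !mulrA !mulVf// !mul1r -!surjective_pairing.
    move: (S n u) (g _) => s x; field. exact: rn0.
  have H : ((r ^+ 2)%:E * \int[leb2]_(u in disk r)
         ((w u - \sum_(k < n) a k * psi_scaled B j k u) ^+ 2)%:E)%E @[n --> \oo] --> 0%E.
    by rewrite -[X in _ --> X](mule0 (r ^+ 2)%:E); apply: cvgeZl.
  have {}H : (disk_int 1 (fun u => (h u - S n u) ^+ 2))%:E @[n --> \oo] --> 0%:E.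
    by under eq_fun do rewrite E; exact: H.
  by move/fine_cvgP : H => [_].
have En := disk_energy ltr01 Ch Ch1 Ch2 h0 CP CP1 CP2 P0 Peig Pon d0.
have En2 : \sum_(k < n) pi * fb_mu B k * a k ^+ 2 @[n --> \oo] --> pi * F ^+ 2.
  under eq_fun do (under eq_bigr do rewrite -mulrA; rewrite -mulr_sumr).
  by apply: cvgM; [exact: cvg_cst|exact: FS].
have {En En2} EE := cvg_unique (@Rhausdorff R) En2 En.
have cg1 : continuous g1 by case: Cg.
have cg2 : continuous g2 by case: Cg.
have cgr : continuous (fun u => g1 u ^+ 2 + g2 u ^+ 2).
  under eq_fun do rewrite !expr2.
  by move=> u; apply: cvgD; apply: cvgM; do ?[exact: cg1|exact: cg2].
have cgrs : continuous (fun u : R * R => g1 (r * u.1, r * u.2) ^+ 2 + g2 (r * u.1, r * u.2) ^+ 2).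
  have cs : continuous (fun u : R * R => ((r * u.1, r * u.2) : R * R)).
    by apply: continuous_pair2; apply: (C1_continuous (C1Z r _)); [exact: C1_fst|exact: C1_snd].
  by move=> u; exact: (continuous_cvg _ (cgr _) (cs u)).
rewrite (ge0_leb2_scale_disk r0 cgr); last by move=> u; rewrite addr_ge0// sqr_ge0.
rewrite -EFin_disk_int ?ltr01// -EFinM; congr (_%:E).
have -> : pi * F ^+ 2 = r ^+ 6 * disk_int 1 (fun u : R * R => g1 (r * u.1, r * u.2) ^+ 2 + g2 (r * u.1, r * u.2) ^+ 2).
  by rewrite EE -disk_intZ ?ltr01//; congr disk_int; apply/funext => u; ring.
by field.
Qed.

End FB_filter_energy.

(** * L^1 bounds of a filter and of its gradient *)
Section tonelli_measurable.
Local Open Scope ereal_scope.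
Context (R : realType) (f : R * R -> \bar R).
Hypotheses (mf : measurable_fun [set: measurableTypeR R * measurableTypeR R] f)
  (f0 : forall u, 0 <= f u).

Lemma leb2_measurable_fst :
  measurable_fun [set: measurableTypeR R] (fun x => \int[lebesgue_measure]_y f (x, y)).
Proof.
exact: (@measurable_fun_fubini_tonelli_F _ _ (measurableTypeR R) (measurableTypeR R) R
  lebesgue_measure f mf f0).
Qed.

Lemma leb2_measurable_snd :
  measurable_fun [set: measurableTypeR R] (fun y => \int[lebesgue_measure]_x f (x, y)).
Proof.
exact: (@measurable_fun_fubini_tonelli_G _ _ (measurableTypeR R) (measurableTypeR R) R
  lebesgue_measure f mf f0).
Qed.
End tonelli_measurable.

Lemma FTC_norm_le (R : realType) (f f' : R -> R) (a b : R) : a <= b ->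
  (forall x : R, is_derive x 1 f (f' x)) -> continuous f' ->
  (`|f b - f a|%:E <= \int[lebesgue_measure]_(s in `[a, b]) `|f' s|%:E)%E.
Proof.
move=> ab df cf'; have cf := is_derive_continuous df.
move: ab; rewrite le_eqVlt => /predU1P[->|ab].
  by rewrite subrr normr0 integral_ge0// => s _; rewrite lee_fin.
have E : (\int[lebesgue_measure]_(s in `[a, b]) (f' s)%:E = (f b)%:E - (f a)%:E)%E.
  apply: (continuous_FTC2 ab (continuous_subspaceT cf')).
  - split; first by move=> x _; exact: ex_derive.
    + by apply: cvg_at_right_filter; exact: cf.
    + by apply: cvg_at_left_filter; exact: cf.
  - by move=> x _; rewrite derive1E derive_val.
rewrite -[leLHS]/(`|(f b - f a)%:E|)%E EFinB -E; apply: (le_trans (le_abse_integral _ _ _)) => //.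
  by apply/measurable_EFinP; apply: measurable_funTS; exact: continuous_measurable_fun.
Qed.

Definition line (R : realType) (p q : R * R) (s : R) : R * R :=
  (p.1 + s * q.1, p.2 + s * q.2).

Section disk_supported.
Context (R : realType) (r : R) (w g g1 g2 : R * R -> R).
Hypotheses (r0 : 0 < r) (Cg : C1 g g1 g2) (wg : forall u, disk r u -> w u = g u)
  (w0 : forall u, r <= enorm u -> w u = 0).

Let dirD (q u : R * R) : R := \1_(disk r) u * `|q.1 * g1 u + q.2 * g2 u|.

Let mD : measurable (disk r : set (measurableTypeR R * measurableTypeR R)).
Proof. exact: disk_measurable. Qed.

Let line_continuous p q : continuous (@line R p q).
Proof.
apply: continuous_pair2 => s; apply: cvgD; do ?exact: cvg_cst;
  by apply: cvgM; [exact: cvg_id|exact: cvg_cst].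
Qed.

Let line_convex p q (s0 s1 s : R) : s0 <= s <= s1 ->
  disk r (line p q s0) -> disk r (line p q s1) -> disk r (line p q s).
Proof.
move=> /andP[h0 h1]; rewrite /disk/= !(enorm_le _ (ltW r0))/=.
set Q := fun s => (p.1 + s * q.1) ^+ 2 + (p.2 + s * q.2) ^+ 2.
rewrite -/(Q s0) -/(Q s1) -/(Q s) => H0 H1.
have [E|E] := eqVneq s0 s1.
  by have -> : s = s0; [apply/eqP; rewrite eq_le h0 andbT E|].
have d : 0 < s1 - s0 by rewrite subr_gt0 lt_neqAle E (le_trans h0 h1).
rewrite -(ler_pM2l d).
(* Linear interpolation of the quadratic polynomial [Q] at [s0] and [s1], with its exact
   remainder. *)
have -> : (s1 - s0) * Q s = (s1 - s) * Q s0 + (s - s0) * Q s1 -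
   (q.1 ^+ 2 + q.2 ^+ 2) * ((s - s0) * (s1 - s) * (s1 - s0)) by rewrite /Q; ring.
have e1 : (s1 - s) * Q s0 <= (s1 - s) * r ^+ 2 by rewrite ler_wpM2l// subr_ge0.
have e2 : (s - s0) * Q s1 <= (s - s0) * r ^+ 2 by rewrite ler_wpM2l// subr_ge0.
have e3 : 0 <= (q.1 ^+ 2 + q.2 ^+ 2) * ((s - s0) * (s1 - s) * (s1 - s0)).
  by rewrite mulr_ge0 ?addr_ge0 ?sqr_ge0// !mulr_ge0 ?subr_ge0// ltW// -subr_gt0.
have -> : (s1 - s0) * r ^+ 2 = (s1 - s) * r ^+ 2 + (s - s0) * r ^+ 2 by ring.
lra.
Qed.

(* Where a segment leaves the disk, w vanishes; since the disk is convex, the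
   part of the segment inside the disk is an interval on which w = g. *)
Let boundary p q (s0 s : R) : disk r (line p q s0) -> exists s1,
  [/\ Num.min s0 s <= s1 <= Num.max s0 s, disk r (line p q s1) & w (line p q s1) = w (line p q s)].
Proof.
move=> H0; have [ur|ur] := leP (enorm (line p q s)) r.
  by exists s; split => //; rewrite ge_min lexx orbT le_max lexx orbT.
have cn : continuous (fun s => enorm (line p q s)).
  by move=> t; exact: (continuous_cvg _ (@enorm_continuous R _) (@line_continuous p q t)).
have mm : Num.min s0 s <= Num.max s0 s by rewrite ge_min le_max lexx.
have [|s1 Hs1 E] := @IVT _ (fun s => enorm (line p q s)) _ _ r mm (continuous_subspaceT cn).
  have H0' : enorm (line p q s0) <= r := H0.
  have [h|h] := leP s0 s.
    by rewrite ge_min le_max H0' (ltW ur) orbT.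
  by rewrite ge_min le_max H0' (ltW ur) orbT.
exists s1; split; [by move: Hs1; rewrite in_itv|by rewrite /disk/= E|].
by rewrite !w0 ?E// ltW.
Qed.

(** If the segment misses the disk, both values are 0. Otherwise each end is moved to a parameter
    inside the disk without changing the value of [w], and the fundamental theorem of calculus
    applies to [g] between the two. *)
Lemma disk_supported_segment p q (a b : R) : a <= b ->
  (`|w (line p q b) - w (line p q a)|%:E <=
   \int[lebesgue_measure]_(s in `[a, b]) (dirD q (line p q s))%:E)%E.
Proof.
move=> ab.
have d0 s : (0 <= (dirD q (line p q s))%:E)%E by rewrite lee_fin mulr_ge0.
have [[s [sab Hs]]|none] := pselect (exists s, a <= s <= b /\ disk r (line p q s)); last first.
  have z s : a <= s <= b -> w (line p q s) = 0.
    move=> sab; apply: w0; rewrite leNgt; apply/negP => /ltW h.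
    by apply: none; exists s.
  rewrite !z ?lexx ?ab// subrr normr0.
  by apply: integral_ge0.
case/andP: sab => sa sb.
have [a' [a'1 a'D <-]] := boundary a Hs; have [b' [b'1 b'D <-]] := boundary b Hs.
rewrite (min_r sa) (max_l sa) in a'1; rewrite (min_l sb) (max_r sb) in b'1.
case/andP: a'1 => aa' a's; case/andP: b'1 => sb' b'b.
have a'b' : a' <= b' := le_trans a's sb'.
have dl (s' : R) : is_derive s' 1 (fun s => g (line p q s)) (q.1 * g1 (line p q s') + q.2 * g2 (line p q s')).
  by apply: (C1_path Cg); exact: is_derive_affine.
have cdl : continuous (fun s => q.1 * g1 (line p q s) + q.2 * g2 (line p q s)).
  case: Cg => _ _ c1 c2 t; apply: cvgD; apply: cvgM; do ?exact: cvg_cst.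
    exact: (continuous_cvg _ (c1 _) (@line_continuous p q t)).
  exact: (continuous_cvg _ (c2 _) (@line_continuous p q t)).
rewrite !wg//; apply: (le_trans (FTC_norm_le a'b' dl cdl)).
have md : measurable_fun [set: measurableTypeR R] (fun s => (dirD q (line p q s))%:E).
  apply/measurable_EFinP; apply: measurable_funM; last first.
    apply: continuous_measurable_fun => t.
    by apply: (continuous_cvg _ (@norm_continuous _ _ _)); exact: cdl.
  have mi : measurable_fun [set: measurableTypeR R * measurableTypeR R] (\1_(disk r) : R * R -> R).
    exact: measurable_indic.
  apply: (measurableT_comp mi).
  by apply: measurable_fun_pair; apply: continuous_measurable_fun => t; apply: cvgD;
    do ?exact: cvg_cst; apply: cvgM; do ?[exact: cvg_id|exact: cvg_cst].
apply: (@le_trans _ _ (\int[lebesgue_measure]_(s in `[a', b']) (dirD q (line p q s))%:E)%E).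
  apply: ge0_le_integral => //.
  - by apply/measurable_EFinP; apply: measurable_funTS; apply: continuous_measurable_fun => t;
      apply: (continuous_cvg _ (@norm_continuous _ _ _)); exact: cdl.
  - exact: measurable_funTS.
  - move=> t /=; rewrite in_itv/= => tab; rewrite /dirD indicE mem_set ?mul1r//.
    exact: (line_convex tab).
apply: ge0_subset_integral => //.
  exact: measurable_funTS.
by move=> t /=; rewrite !in_itv/= => /andP[h1 h2]; rewrite (le_trans aa' h1) (le_trans h2 b'b).
Qed.

Let mdir q : measurable_fun [set: measurableTypeR R * measurableTypeR R] (dirD q).
Proof.
apply: measurable_funM; first exact: measurable_indic.
apply: continuous_measurable_prod => u; apply: (continuous_cvg _ (@norm_continuous _ _ _)).
case: Cg => _ _ c1 c2; apply: cvgD; apply: cvgM; do ?exact: cvg_cst; [exact: c1|exact: c2].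
Qed.

Lemma disk_supported_measurable :
  measurable_fun [set: measurableTypeR R * measurableTypeR R] w.
Proof.
have -> : w = fun u => \1_(disk r) u * g u.
  apply/funext => u; rewrite indicE; have [ur|ur] := leP (enorm u) r.
    by rewrite mem_set// mul1r wg.
  by rewrite memNset ?mul0r ?w0 ?(ltW ur)//; rewrite /disk/= leNgt ur.
apply: measurable_funM; first exact: measurable_indic.
by apply: continuous_measurable_prod; exact: (C1_continuous Cg).
Qed.

Let dir0 q u : 0 <= dirD q u. Proof. by rewrite mulr_ge0. Qed.

(* Each chord value of w is reached from both ends of the chord, where w = 0. *)
Let chord_bound (c : R -> R * R) (q : R * R) (x : R) :
  (forall s, c s = line (c 0) q s) -> (forall s, r <= `|s| -> r <= enorm (c s)) ->
  measurable_fun [set: measurableTypeR R] (fun s => dirD q (c s)) ->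
  (`|w (c x)|%:E <= (\1_(`[- r, r]%classic) x * 2^-1)%:E *
     \int[lebesgue_measure]_s (dirD q (c s))%:E)%E.
Proof.
move=> cE cr mc.
have md : measurable_fun [set: measurableTypeR R] (fun s => (dirD q (c s))%:E).
  exact/measurable_EFinP.
have I0 : (0 <= \int[lebesgue_measure]_s (dirD q (c s))%:E)%E.
  by apply: integral_ge0 => s _; rewrite lee_fin dir0.
rewrite indicE; have [xr|xr] := boolP (x \in `[- r, r]%classic); last first.
  rewrite w0 ?normr0 ?mul0r ?mul0e//; apply: cr.
  by move: xr; rewrite notin_setE/= in_itv/= -ler_norml => /negP; rewrite -ltNge => /ltW.
move: xr; rewrite inE/= in_itv/= => /andP[rx xr]; rewrite mul1r.
have wr : w (c r) = 0 by apply/w0/cr; rewrite ger0_norm ?lexx// ltW.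
have wNr : w (c (- r)) = 0 by apply/w0/cr; rewrite normrN ger0_norm ?lexx// ltW.
have S1 := disk_supported_segment (c 0) q rx; have S2 := disk_supported_segment (c 0) q xr.
rewrite -!cE wNr subr0 in S1; rewrite -!cE wr sub0r normrN in S2.
have ES a b : (\int[lebesgue_measure]_(s in `[a, b]) (dirD q (line (c 0%R) q s))%:E =
   \int[lebesgue_measure]_(s in `[a, b]) (dirD q (c s))%:E)%E.
  by apply: eq_integral => s _; rewrite -cE.
rewrite !ES in S1 S2.
rewrite -[X in (X <= _)%E]mul1e -(_ : (2^-1 * 2)%:E = 1%E :> \bar R); last by rewrite mulVf.
rewrite EFinM -muleA lee_pmul2l//.
have -> : (2%:E * `|w (c x)|%:E = `|w (c x)|%:E + `|w (c x)|%:E)%E.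
  by rewrite -EFinM -EFinD mulr_natl mulr2n.
apply: (le_trans (leeD S1 S2)).
rewrite -integral_itv_bndo_bndc; last exact: measurable_funTS.
rewrite -ge0_integral_setU//=; last 3 first.
- exact: measurable_funTS.
- by move=> s _; rewrite lee_fin dir0.
- rewrite disj_set2E; apply/eqP; rewrite -subset0 => s [] /=; rewrite !in_itv/= => /andP[_ h1] /andP[h2 _].
  by move: (lt_le_trans h1 h2); rewrite ltxx.
apply: ge0_subset_integral => //.
- by apply: measurableU; exact: measurable_itv.
- by move=> s _; rewrite lee_fin dir0.
Qed.

Let chord_integral (T : \bar R) : (0 <= T)%E ->
  (\int[lebesgue_measure]_x ((\1_(`[- r, r]%classic) x * 2^-1)%:E * T) = r%:E * T)%E.
Proof.
move=> T0.
have m1 : measurable_fun [set: measurableTypeR R] (fun x => (\1_(`[- r, r]%classic) x)%:E : \bar R).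
  by apply/measurable_EFinP; exact: measurable_indic.
have m2 : measurable_fun [set: measurableTypeR R] (fun x => (\1_(`[- r, r]%classic) x * 2^-1)%:E : \bar R).
  apply/measurable_EFinP; apply: measurable_funM; first exact: measurable_indic.
  exact: measurable_cst.
rewrite ge0_integralZr//.
congr (_ * _)%E; under eq_integral do rewrite EFinM.
rewrite ge0_integralZr//.
rewrite integral_indic// setIT.
by rewrite /= lebesgue_measure_itv/= lte_fin gtrN// -EFinD -EFinM; congr (_%:E); field.
Qed.

Let mdir_slice1 (y : R) : measurable_fun [set: measurableTypeR R] (fun s => dirD (1, 0) (s, y)).
Proof. exact: (measurable_fun_pair1 y (mdir (1, 0))). Qed.

Let mdir_slice2 (x : R) : measurable_fun [set: measurableTypeR R] (fun s => dirD (0, 1) (x, s)).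
Proof. exact: (measurable_fun_pair2 x (mdir (0, 1))). Qed.

Let mw : measurable_fun [set: measurableTypeR R * measurableTypeR R] (fun u => `|w u|%:E).
Proof. by apply/measurable_EFinP; apply: measurableT_comp => //; exact: disk_supported_measurable. Qed.

(** On each horizontal line the bound of [chord_bound] is the same at every point of an interval of
    length 2 r; its factor 1/2 leaves r. *)
Lemma disk_supported_L1_fst :
  (\int[leb2]_u `|w u|%:E <= r%:E * \int[leb2]_u (dirD (1, 0) u)%:E)%E.
Proof.
have mE : measurable_fun [set: measurableTypeR R * measurableTypeR R] (fun u => (dirD (1, 0) u)%:E).
  by apply/measurable_EFinP; exact: mdir.
rewrite leb2_tonelli21// leb2_tonelli21//; last by move=> u; rewrite lee_fin dir0.
have mI : measurable_fun [set: measurableTypeR R]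
    (fun y => \int[lebesgue_measure]_x (dirD (1, 0) (x, y))%:E)%E.
  by apply: (@leb2_measurable_snd R (fun u => (dirD (1, 0) u)%:E)) => // u; rewrite lee_fin dir0.
rewrite -ge0_integralZl//; last 2 first.
- by move=> y _; apply: integral_ge0 => x _; rewrite lee_fin dir0.
- by rewrite lee_fin ltW.
apply: ge0_le_integral => //.
- by move=> y _; apply: integral_ge0 => x _; rewrite lee_fin.
- by apply: (@leb2_measurable_snd R (fun u => `|w u|%:E)) => // u; rewrite lee_fin.
- by apply: emeasurable_funM => //; exact: measurable_cst.
move=> y _; rewrite -chord_integral; last by apply: integral_ge0 => x _; rewrite lee_fin dir0.
apply: ge0_le_integral => //.
- exact: (measurable_fun_pair1 y mw).
- apply: emeasurable_funM; last exact: measurable_cst.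
  apply/measurable_EFinP; apply: measurable_funM; first exact: measurable_indic.
  exact: measurable_cst.
move=> x _; apply: (@chord_bound (fun s => (s, y)) (1, 0) x) => //.
- by move=> s; rewrite /line/= add0r mulr1 mulr0 addr0.
- by move=> s rs; apply: le_trans rs _; exact: (norm_fst_enorm (s, y)).
Qed.

Lemma disk_supported_L1_snd :
  (\int[leb2]_u `|w u|%:E <= r%:E * \int[leb2]_u (dirD (0, 1) u)%:E)%E.
Proof.
have mE : measurable_fun [set: measurableTypeR R * measurableTypeR R] (fun u => (dirD (0, 1) u)%:E).
  by apply/measurable_EFinP; exact: mdir.
rewrite leb2_tonelli12// leb2_tonelli12//; last by move=> u; rewrite lee_fin dir0.
have mI : measurable_fun [set: measurableTypeR R]
    (fun x => \int[lebesgue_measure]_y (dirD (0, 1) (x, y))%:E)%E.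
  by apply: (@leb2_measurable_fst R (fun u => (dirD (0, 1) u)%:E)) => // u; rewrite lee_fin dir0.
rewrite -ge0_integralZl//; last 2 first.
- by move=> y _; apply: integral_ge0 => x _; rewrite lee_fin dir0.
- by rewrite lee_fin ltW.
apply: ge0_le_integral => //.
- by move=> y _; apply: integral_ge0 => x _; rewrite lee_fin.
- by apply: (@leb2_measurable_fst R (fun u => `|w u|%:E)) => // u; rewrite lee_fin.
- by apply: emeasurable_funM => //; exact: measurable_cst.
move=> x _; rewrite -chord_integral; last by apply: integral_ge0 => y _; rewrite lee_fin dir0.
apply: ge0_le_integral => //.
- exact: (measurable_fun_pair2 x mw).
- apply: emeasurable_funM; last exact: measurable_cst.
  apply/measurable_EFinP; apply: measurable_funM; first exact: measurable_indic.
  exact: measurable_cst.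
move=> y _; apply: (@chord_bound (fun s => (x, s)) (0, 1) y) => //.
- by move=> s; rewrite /line/= add0r mulr1 mulr0 addr0.
- by move=> s rs; apply: le_trans rs _; exact: (norm_snd_enorm (x, s)).
Qed.

End disk_supported.

Section indic_disk.
Context (R : realType) (r : R).
Hypothesis r0 : 0 < r.

Lemma integral_indic_disk (F : R * R -> R) : continuous F ->
  (\int[leb2]_u (\1_(disk r) u * F u)%:E = (disk_int r F)%:E)%E.
Proof.
move=> cF; rewrite EFin_disk_int// [RHS]integral_mkcond; apply: eq_integral => u _.
by rewrite patchE indicE; case: ifP => _; rewrite ?mul1r ?mul0r.
Qed.

Lemma disk_int_le (F G : R * R -> R) : continuous F -> continuous G ->
  (forall u, F u <= G u) -> disk_int r F <= disk_int r G.
Proof.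
move=> cF cG FG; apply: le_Rintegral => //.
- exact: disk_measurable.
- exact: continuous_integrable_disk.
- exact: continuous_integrable_disk.
Qed.

Lemma disk_int_cst1 : disk_int r (fun=> 1 ^+ 2) <= 4 * r ^+ 2.
Proof.
rewrite -lee_fin EFin_disk_int//; last by move=> u; exact: cvg_cst.
rewrite expr1n integral_cst/=; last exact: disk_measurable.
by rewrite mul1e; exact: leb2_disk_le.
Qed.

End indic_disk.

(* G is the norm of the gradient of w inside the disk and 0 outside.  Since w need
   not be differentiable across the circle, only the integrated form cf_segment of
   the gradient bound is available there. *)
Record controlled_filter (R : realType) (r A : R) (w G : R * R -> R) : Prop := {
  cf_measurable : measurable_fun [set: measurableTypeR R * measurableTypeR R] w;
  cf_grad_measurable : measurable_fun [set: measurableTypeR R * measurableTypeR R] G;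
  cf_grad_ge0 : forall u, 0 <= G u;
  cf_grad_support : forall u, r < enorm u -> G u = 0;
  cf_bounded : exists M, forall u, `|w u| <= M;
  cf_segment : forall p q, (`|w (line p q 1) - w (line p q 0)|%:E <=
    \int[lebesgue_measure]_(s in `[0%R, 1%R]) (enorm q * G (line p q s))%:E)%E;
  cf_L1 : (\int[leb2]_u `|w u|%:E <= A%:E)%E;
  cf_grad_L1 : (\int[leb2]_u (G u)%:E <= (Num.sqrt 2 * A / r)%:E)%E
}.

Lemma FB_filter_controlled (R : realType) (B : FB_basis R) (j : R) (a : nat -> R)
    (w : R * R -> R) (F : R) : is_FB_filter B j a w -> FB_norm B a = F%:E ->
  exists G, controlled_filter (2 `^ j) (pi * F) w G.
Proof.
move=> hw hF; have [F0 _] := FB_normE hF.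
have [g [g1 [g2 [Cg wg w0 E]]]] := FB_filter_energy hw hF.
set r := 2 `^ j in w0 wg E *.
have r0 : 0 < r by exact: powR_gt0.
have cg := C1_continuous Cg; have [_ _ cg1 cg2] := Cg.
pose Gc u := enorm (g1 u, g2 u).
have cGc : continuous Gc.
  by move=> u; apply: (continuous_cvg _ (@enorm_continuous R _)); exact: continuous_pair2.
have cn (f : R * R -> R) : continuous f -> continuous (fun u => `|f u|).
  by move=> cf u; apply: (continuous_cvg _ (@norm_continuous _ _ _)); exact: cf.
pose X := disk_int r Gc.
have X0 : 0 <= X by apply: disk_int_ge0 => u; exact: enorm_ge0.
have X2 : X ^+ 2 <= 2 * (pi * F / r) ^+ 2.
  have cc : continuous (fun _ : R * R => 1 : R) by move=> u; exact: cvg_cst.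
  have := disk_int_CS r0 cGc cc.
  rewrite (_ : (fun u => Gc u * 1) = Gc); last by apply/funext => u; rewrite mulr1.
  rewrite -/X => H; apply: (le_trans H).
  have EE : disk_int r (fun u => Gc u ^+ 2) = pi * F ^+ 2 * r ^- 4.
    have [] : (disk_int r (fun u => Gc u ^+ 2))%:E = (pi * F ^+ 2 * r ^- 4)%:E; last by [].
    rewrite EFin_disk_int//.
      by rewrite -E; apply: eq_integral => u _; rewrite /Gc enorm_sqr.
    by under eq_fun do rewrite expr2; move=> u; apply: cvgM; exact: cGc.
  rewrite EE.
  have e0 : 0 <= pi * F ^+ 2 * r ^- 4.
    by rewrite !mulr_ge0 ?sqr_ge0 ?pi_ge0// invr_ge0 exprn_ge0// ltW.
  apply: (le_trans (ler_wpM2l e0 (disk_int_cst1 r0))).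
  (* With the area bound 4 r^2 the constant is 4 pi, and 4 pi <= 2 pi^2 because 2 <= pi. *)
  have -> : pi * F ^+ 2 * r ^- 4 * (4 * r ^+ 2) = 2 * (2 * pi) * (F / r) ^+ 2.
    by field; rewrite gt_eqF.
  have -> : 2 * (pi * F / r) ^+ 2 = 2 * (pi * pi) * (F / r) ^+ 2 by ring.
  by rewrite ler_wpM2r ?sqr_ge0// ler_wpM2l// ler_wpM2r ?pi_ge0// pi_ge2.
have XA : X <= Num.sqrt 2 * (pi * F / r).
  rewrite -ler_sqr ?nnegrE//; first by rewrite exprMn sqr_sqrtr.
  by rewrite !mulr_ge0 ?sqrtr_ge0 ?pi_ge0// invr_ge0 ltW.
exists (fun u => \1_(disk r) u * Gc u); split.
- exact: (disk_supported_measurable Cg wg w0).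
- by apply: measurable_funM; [apply: measurable_indic; exact: disk_measurable|exact: continuous_measurable_prod].
- by move=> u; rewrite mulr_ge0// enorm_ge0.
- move=> u ru; rewrite indicE memNset ?mul0r//.
  by rewrite /disk/= leNgt ru.
- have [M hM] := continuous_bounded_disk r0 cg.
  exists `|M| => u; have [ur|ur] := leP (enorm u) r.
    by rewrite wg//; apply: le_trans (hM _ ur) (ler_norm _).
  by rewrite w0 ?normr0// ltW.
- move=> p q; apply: (le_trans (disk_supported_segment r0 Cg wg w0 p q ler01)).
  have cl : continuous (line p q).
    apply: continuous_pair2 => s; apply: cvgD; do ?exact: cvg_cst;
      by apply: cvgM; [exact: cvg_id|exact: cvg_cst].
  have ml : measurable_fun [set: measurableTypeR R] (line p q : _ -> measurableTypeR R * measurableTypeR R).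
    by apply: measurable_fun_pair; apply: continuous_measurable_fun => t; apply: cvgD;
      do ?exact: cvg_cst; apply: cvgM; do ?[exact: cvg_id|exact: cvg_cst].
  have mi : measurable_fun [set: measurableTypeR R * measurableTypeR R] (\1_(disk r) : R * R -> R).
    by apply: measurable_indic; exact: disk_measurable.
  apply: ge0_le_integral => //.
  + apply/measurable_EFinP; apply: measurable_funTS.
    apply: measurable_funM; first exact: (measurableT_comp mi ml).
    apply: continuous_measurable_fun => t; apply: (continuous_cvg _ (@norm_continuous _ _ _)).
    by apply: cvgD; apply: cvgM; do ?exact: cvg_cst;
      [exact: (continuous_cvg _ (cg1 _) (cl t))|exact: (continuous_cvg _ (cg2 _) (cl t))].
  + apply/measurable_EFinP; apply: measurable_funTS.
    apply: measurable_funM; first exact: measurable_cst.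
    apply: measurable_funM; first exact: (measurableT_comp mi ml).
    by apply: continuous_measurable_fun => t; exact: (continuous_cvg _ (cGc _) (cl t)).
  + move=> s _; rewrite lee_fin [leRHS]mulrCA ler_wpM2l//.
    exact: (enorm_dot q (g1 (line p q s), g2 (line p q s))).
- have H1 := disk_supported_L1_fst r0 Cg wg w0.
  have H2 := disk_supported_L1_snd r0 Cg wg w0.
  have E1 : (\int[leb2]_u (\1_(disk r) u * `|((1, 0) : R * R).1 * g1 u + ((1, 0) : R * R).2 * g2 u|)%:E = (disk_int r (fun u => `|g1 u|))%:E)%E.
    rewrite -integral_indic_disk//; last exact: cn.
    by apply: eq_integral => u _; rewrite /= mul1r mul0r addr0.
  have E2 : (\int[leb2]_u (\1_(disk r) u * `|((0, 1) : R * R).1 * g1 u + ((0, 1) : R * R).2 * g2 u|)%:E = (disk_int r (fun u => `|g2 u|))%:E)%E.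
    rewrite -integral_indic_disk//; last exact: cn.
    by apply: eq_integral => u _; rewrite /= mul1r mul0r add0r.
  rewrite E1 -EFinM in H1; rewrite E2 -EFinM in H2.
  (* Adding the bounds along the two axes gives 2 ||w||_1 <= r (||g1||_1 + ||g2||_1). One factor
     sqrt 2 arises here and one in [XA]; their product 2 cancels, leaving exactly pi F. *)
  have S : disk_int r (fun u => `|g1 u|) + disk_int r (fun u => `|g2 u|) <= Num.sqrt 2 * X.
    rewrite -disk_intD; [|exact: r0|exact: cn|exact: cn].
    rewrite /X -disk_intZ//; apply: disk_int_le => //.
    - by move=> u; apply: cvgD; exact: cn.
    - by move=> u; apply: cvgM; [exact: cvg_cst|exact: cGc].
    - move=> u; rewrite -ler_sqr ?nnegrE ?addr_ge0 ?mulr_ge0 ?sqrtr_ge0 ?enorm_ge0//.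
      rewrite exprMn sqr_sqrtr// /Gc enorm_sqr/= -(real_normK (num_real (g1 u))) -(real_normK (num_real (g2 u))).
      have := sqr_ge0 (`|g1 u| - `|g2 u|); move: `|g1 u| `|g2 u| => x y; nra.
  move: H1 H2; set I := (\int[leb2]_u _)%E => H1 H2.
  have Ifin : I \is a fin_num.
    rewrite ge0_fin_numE; last by apply: integral_ge0 => u _; rewrite lee_fin.
    by apply: le_lt_trans H1 _; exact: ltry.
  rewrite -(fineK Ifin) in H1 H2 *; rewrite !lee_fin in H1 H2 *.
  have s2 : Num.sqrt 2 * Num.sqrt 2 = 2 :> R by rewrite -expr2 sqr_sqrtr.
  have K : r * (Num.sqrt 2 * X) <= 2 * (pi * F).
    have -> : 2 * (pi * F) = r * (Num.sqrt 2 * (Num.sqrt 2 * (pi * F / r))).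
      move: (Num.sqrt 2) s2 => y yy; have -> : r * (y * (y * (pi * F / r))) = (y * y) * (pi * F).
        by field; rewrite gt_eqF.
      by rewrite yy.
    by apply: ler_wpM2l; [exact: ltW|apply: ler_wpM2l => //; exact: sqrtr_ge0].
  have : r * (disk_int r (fun u => `|g1 u|) + disk_int r (fun u => `|g2 u|)) <= r * (Num.sqrt 2 * X).
    by apply: ler_wpM2l => //; exact: ltW.
  rewrite mulrDr; move: H1 H2 K.
  move: (fine I) (r * disk_int _ _) (r * disk_int _ _) (r * (_ * X)) (pi * F) => *; lra.
- by rewrite integral_indic_disk// lee_fin -mulrA.
Qed.

(** * Schur test for kernels with several channels *)
Notation plane R := (measurableTypeR R * measurableTypeR R)%type.

Section plane_integrals.
Context (R : realType).
Local Open Scope ereal_scope.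

Lemma ge0_integral_oppr (f : R -> \bar R) :
  measurable_fun [set: measurableTypeR R] f -> (forall x, 0 <= f x) ->
  \int[lebesgue_measure]_x f (- x)%R = \int[lebesgue_measure]_x f x.
Proof.
move=> mf f0.
have mN : measurable_fun [set: measurableTypeR R] (fun x : measurableTypeR R => (- x)%R : measurableTypeR R).
  exact: oppr_measurable.
rewrite -[LHS](@ge0_integral_pushforward _ _ _ _ R _ mN lebesgue_measure setT f)//.
by apply: eq_measure_integral => A mA _; exact: lebesgue_measureN.
Qed.

Lemma ge0_leb2_shift (f : R * R -> \bar R) (a : R * R) :
  measurable_fun [set: plane R] f -> (forall u, 0 <= f u) ->
  \int[leb2]_v f (a + v)%R = \int[leb2]_v f v.
Proof.
move=> mf f0.
have C1a : C1 (fun u : R * R => a.1 + u.1)%R (fun=> 1%R) (fun=> 0%R).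
  by apply: (C1_eq (C1D (C1_cst a.1) (C1_fst R))) => u; rewrite add0r.
have C1b : C1 (fun u : R * R => a.2 + u.2)%R (fun=> 0%R) (fun=> 1%R).
  by apply: (C1_eq (C1D (C1_cst a.2) (C1_snd R))) => u; rewrite add0r.
rewrite -[RHS](ge0_change_of_variables (c := 1%R) _ C1a C1b)//; last first.
  by move=> u; rewrite !mulr1 mulr0 subr0.
by apply: eq_integral => u _; rewrite !mulr1 mulr0 subr0 mule1.
Qed.

Lemma ge0_leb2_opp (f : R * R -> \bar R) :
  measurable_fun [set: plane R] f -> (forall u, 0 <= f u) ->
  \int[leb2]_v f (- v)%R = \int[leb2]_v f v.
Proof.
move=> mf f0.
have mN : measurable_fun [set: measurableTypeR R] (fun x : measurableTypeR R => (- x)%R : measurableTypeR R).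
  exact: oppr_measurable.
have mf1 : measurable_fun [set: plane R] (fun u : plane R => f (u.1, - u.2)%R).
  apply: (measurableT_comp mf); apply: measurable_fun_pair => //.
  exact: (measurableT_comp mN).
have mfN : measurable_fun [set: plane R] (fun u : plane R => f (- u)%R).
  apply: (measurableT_comp mf); apply: measurable_fun_pair; exact: (measurableT_comp mN).
rewrite leb2_tonelli21//; transitivity (\int[lebesgue_measure]_y \int[lebesgue_measure]_x f (x, - y)%R).
  apply: eq_integral => y _.
  rewrite -(ge0_integral_oppr (f := fun x => f (x, - y)%R))//.
  exact: (measurable_fun_pair1 y mf1).
rewrite -(leb2_tonelli21 mf1)// leb2_tonelli12// leb2_tonelli12//.
apply: eq_integral => x _.
by rewrite -(ge0_integral_oppr (f := fun y => f (x, y)))//; exact: (measurable_fun_pair2 x mf).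
Qed.

Lemma ge0_leb2_reflect (f : R * R -> \bar R) (a : R * R) :
  measurable_fun [set: plane R] f -> (forall u, 0 <= f u) ->
  \int[leb2]_v f (a - v)%R = \int[leb2]_v f v.
Proof.
move=> mf f0; rewrite -(ge0_leb2_shift a mf f0).
rewrite -(ge0_leb2_opp (f := fun v => f (a + v)%R))//.
apply: (measurableT_comp mf); apply: measurable_fun_pair.
  by apply: continuous_measurable_prod => u; apply: cvgD; [exact: cvg_cst|exact: cvg_fst].
by apply: continuous_measurable_prod => u; apply: cvgD; [exact: cvg_cst|exact: cvg_snd].
Qed.

Section signed.
Context (T : R * R -> R * R) (J : R * R -> R).
Hypotheses (mT : measurable_fun [set: plane R] (T : plane R -> plane R))
  (mJ : measurable_fun [set: plane R] J) (J0 : forall u, (0 <= J u)%R)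
  (HJ : forall f : R * R -> \bar R, measurable_fun [set: plane R] f ->
    (forall u, 0 <= f u) -> \int[leb2]_u (f (T u) * (J u)%:E) = \int[leb2]_u f u).

(** Multiplication by the nonnegative [J] commutes with taking positive and negative parts, so the
    formula for nonnegative functions extends without integrability. *)
Lemma change_of_variables_integral (f : R * R -> R) :
  measurable_fun [set: plane R] f ->
  \int[leb2]_u (f (T u) * J u)%:E = \int[leb2]_u (f u)%:E.
Proof.
move=> mf; have mf' : measurable_fun [set: plane R] (fun u => (f u)%:E) by exact/measurable_EFinP.
rewrite integralE [RHS]integralE; congr (_ - _).
  rewrite -[RHS]HJ//; last exact: measurable_funepos.
  by apply: eq_integral => u _; rewrite !funeposE -!EFin_max -EFinM maxr_pMl// mul0r.
rewrite -[RHS]HJ//; last exact: measurable_funeneg.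
by apply: eq_integral => u _; rewrite !funenegE -!EFinN -!EFin_max -EFinM maxr_pMl// mul0r mulNr.
Qed.

Lemma change_of_variables_integrable (f : R * R -> R) :
  leb2.-integrable [set: plane R] (fun u => (f u)%:E) ->
  leb2.-integrable [set: plane R] (fun u => (f (T u) * J u)%:E).
Proof.
move=> /integrableP[mf fi]; have mf' : measurable_fun [set: plane R] f by exact/measurable_EFinP.
apply/integrableP; split.
  by apply/measurable_EFinP; apply: measurable_funM => //; exact: (measurableT_comp mf').
rewrite (_ : \int[leb2]_u _ = \int[leb2]_u `|(f u)%:E|)//.
rewrite -[RHS]HJ//; last exact: measurableT_comp.
by apply: eq_integral => u _; rewrite EFinM abseM [`|(J u)%:E|]gee0_abs// lee_fin.
Qed.

End signed.
End plane_integrals.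

Definition leb2_sf (R : realType) : set (plane R) -> \bar R := @leb2 R.

(* The library only registers products of finite measures as sigma-finite. *)
Section leb2_sigma_finite.
Context (R : realType).

Let leb2_sf0 : leb2_sf set0 = 0%E :> \bar R. Proof. exact: measure0. Qed.
Let leb2_sf_ge0 (A : set (plane R)) : (0 <= leb2_sf A)%E. Proof. exact: measure_ge0. Qed.
Let leb2_sf_sigma_additive : semi_sigma_additive (@leb2_sf R).
Proof. exact: (@measure_semi_sigma_additive _ _ _ (@leb2 R)). Qed.

HB.instance Definition _ := isMeasure.Build _ (plane R) R (@leb2_sf R)
  leb2_sf0 leb2_sf_ge0 leb2_sf_sigma_additive.

Let leb2_sf_sigma_finite : sigma_finite setT (@leb2_sf R).
Proof.
have /sigma_finiteP[F [TF ndF Foo]] := sigma_finiteT (@lebesgue_measure R).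
exists (fun n => F n `*` F n).
  rewrite -setXTT TF predeqE => -[x y]; split.
    move=> [/= [n _ Fnx] [k _ Gky]]; exists (maxn n k) => //; split.
    - by move: x Fnx; exact/subsetPset/ndF/leq_maxl.
    - by move: y Gky; exact/subsetPset/ndF/leq_maxr.
  by move=> [n _ []/= ? ?]; split; exists n.
move=> k; have [mF Fk] := Foo k.
split; first exact: measurableX.
rewrite /leb2_sf/= product_measure1E//.
by apply: lte_mul_pinfty => //; rewrite ge0_fin_numE.
Qed.

HB.instance Definition _ := Measure_isSigmaFinite.Build _ _ _ (@leb2_sf R)
  leb2_sf_sigma_finite.

End leb2_sigma_finite.

Section plane_tonelli.
Context (R : realType) d (T : measurableType d) (mu : {sigma_finite_measure set T -> \bar R}).
Local Open Scope ereal_scope.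
Variable f : T * plane R -> \bar R.
Hypotheses (mf : measurable_fun [set: T * plane R] f) (f0 : forall z, 0 <= f z).

Lemma measurable_integral_leb2 :
  measurable_fun [set: T] (fun t => \int[leb2]_u f (t, u)).
Proof. exact: (measurable_fun_fubini_tonelli_F (m2 := @leb2_sf R) f mf f0). Qed.

Lemma measurable_leb2_integral :
  measurable_fun [set: plane R] (fun u => \int[mu]_t f (t, u)).
Proof. exact: (measurable_fun_fubini_tonelli_G (m1 := mu) f mf f0). Qed.

Lemma leb2_tonelli_swap :
  \int[leb2]_u \int[mu]_t f (t, u) = \int[mu]_t \int[leb2]_u f (t, u).
Proof. exact/esym/(fubini_tonelli (m1 := mu) (m2 := @leb2_sf R) f mf f0). Qed.

End plane_tonelli.

Section plane_plane_tonelli.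
Context (R : realType).
Local Open Scope ereal_scope.
Variable f : plane R * plane R -> \bar R.
Hypotheses (mf : measurable_fun [set: plane R * plane R] f) (f0 : forall z, 0 <= f z).

Lemma leb2_leb2_swap :
  \int[leb2]_u \int[leb2]_v f (u, v) = \int[leb2]_v \int[leb2]_u f (u, v).
Proof. exact/esym/(@leb2_tonelli_swap _ _ _ (@leb2_sf R) _ mf f0). Qed.

Lemma measurable_leb2_fst :
  measurable_fun [set: plane R] (fun v => \int[leb2]_u f (u, v)).
Proof. exact: (@measurable_leb2_integral _ _ _ (@leb2_sf R) _ mf f0). Qed.

End plane_plane_tonelli.

(* The squared norm of the paper, before normalization by the area of Omega. *)
Definition energy (R : realType) (m : nat) (x : R * R -> 'I_m -> R) : \bar R :=
  ((m%:R^-1)%:E * \sum_(lam < m) \int[leb2]_u (x u lam ^+ 2)%:E)%E.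

Lemma energy_ge0 (R : realType) (m : nat) (x : R * R -> 'I_m -> R) : (0 <= energy x)%E.
Proof.
rewrite mule_ge0 ?lee_fin ?invr_ge0//; apply: sume_ge0 => l _.
by apply: integral_ge0 => u _; rewrite lee_fin sqr_ge0.
Qed.

Section schur.
Context (R : realType) (n m : nat).
Variables (k : 'I_n -> 'I_m -> R * R -> R * R -> R) (w : 'I_n -> 'I_m -> R).
Hypotheses
  (mk : forall i l, measurable_fun [set: plane R * plane R] (fun z => k i l z.1 z.2))
  (k0 : forall i l u v, 0 <= k i l u v)
  (w0 : forall i l, 0 <= w i l)
  (w1 : forall l, \sum_(i < n) w i l <= 1)
  (w2 : forall i, \sum_(l < m) w i l <= m%:R / n%:R).
Variables (x : R * R -> 'I_n -> R) (y : R * R -> 'I_m -> R).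
Hypotheses
  (mx : forall i, measurable_fun [set: plane R] (x ^~ i))
  (my : forall l, measurable_fun [set: plane R] (y ^~ l))
  (Hy : forall u l, (`|y u l|%:E <= \sum_(i < n) \int[leb2]_v (k i l u v * `|x v i|)%:E)%E).

Let mku i l u : measurable_fun [set: plane R] (k i l u).
Proof. exact: (measurable_fun_pair2 u (mk i l)). Qed.

Let mkv i l v : measurable_fun [set: plane R] (fun u => k i l u v).
Proof. exact: (measurable_fun_pair1 v (mk i l)). Qed.

(** Cauchy-Schwarz for the measure with density [k], in a form that tolerates infinite integrals: 2
    c |x| <= c^2 + x^2 is integrated for every c > 0, the row sums [w1] bound the first term, and
    the discriminant criterion chooses the best c. *)
Let schur_pointwise (p : R) : 0 < p ->
  (forall i l u, (\int[leb2]_v (k i l u v)%:E <= (p * w i l)%:E)%E) ->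
  forall u l, ((y u l ^+ 2)%:E <=
    p%:E * \sum_(i < n) \int[leb2]_v (k i l u v * x v i ^+ 2)%:E)%E.
Proof.
move=> p0 Hp u l; set X := (\sum_(i < n) _)%E.
have X0 : (0 <= X)%E.
  apply: sume_ge0 => i _; apply: integral_ge0 => v _.
  by rewrite lee_fin mulr_ge0// sqr_ge0.
have H c : 0 < c -> ((2 * c * `|y u l|)%:E <= (c ^+ 2 * p)%:E + X)%E.
  move=> c0; rewrite EFinM; apply: (le_trans (lee_wpmul2l _ (Hy u l))).
    by rewrite lee_fin mulr_ge0// ltW.
  rewrite ge0_sume_distrr; last first.
    by move=> i _; apply: integral_ge0 => v _; rewrite lee_fin mulr_ge0.
  apply: (@le_trans _ _ (\sum_(i < n) ((c ^+ 2 * p * w i l)%:E +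
     \int[leb2]_v (k i l u v * x v i ^+ 2)%:E))%E); last first.
    rewrite big_split/= leeD2r// sumEFin lee_fin -mulr_sumr ler_piMr//.
    by rewrite mulr_ge0 ?sqr_ge0// ltW.
  apply: lee_sum => i _.
  have mkx : measurable_fun [set: plane R] (fun v => k i l u v * `|x v i|).
    by apply: measurable_funM => //; exact: measurableT_comp.
  have mkxx : measurable_fun [set: plane R] (fun v => k i l u v * x v i ^+ 2).
    by apply: measurable_funM => //; exact: measurable_funX.
  rewrite -ge0_integralZl_EFin//; last 3 first.
  - by move=> v _; rewrite lee_fin mulr_ge0.
  - exact/measurable_EFinP.
  - by rewrite mulr_ge0// ltW.
  apply: (@le_trans _ _ (\int[leb2]_v ((c ^+ 2)%:E * (k i l u v)%:E + (k i l u v * x v i ^+ 2)%:E))%E).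
    apply: ge0_le_integral => //.
    - by move=> v _; rewrite -EFinM lee_fin !mulr_ge0// ltW.
    - by apply/measurable_EFinP; apply: measurable_funM => //; exact: measurable_cst.
    - apply: emeasurable_funD; last exact/measurable_EFinP.
      by apply/measurable_EFinP; apply: measurable_funM => //; exact: measurable_cst.
    - move=> v _; rewrite -!EFinM -EFinD lee_fin mulrCA [_ ^+ 2 * _]mulrC -mulrDr ler_wpM2l//.
      rewrite -(real_normK (num_real (x v i))).
      by have := sqr_ge0 (c - `|x v i|); move: `|x v i| => t; nra.
  rewrite ge0_integralD//; last 4 first.
  - by move=> v _; rewrite -EFinM lee_fin mulr_ge0// sqr_ge0.
  - by apply/measurable_EFinP; apply: measurable_funM => //; exact: measurable_cst.
  - by move=> v _; rewrite lee_fin mulr_ge0// sqr_ge0.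
  - exact/measurable_EFinP.
  rewrite leeD2r// ge0_integralZl_EFin//; last 3 first.
  - by move=> v _; rewrite lee_fin.
  - exact/measurable_EFinP.
  - exact: sqr_ge0.
  rewrite -mulrA (EFinM (c ^+ 2) (p * w i l)).
  by apply: lee_wpmul2l => //; rewrite lee_fin sqr_ge0.
have [Xoo|Xoo] := eqVneq X +oo%E; first by rewrite Xoo gt0_muley ?lte_fin ?leey.
have Xf : X \is a fin_num by rewrite ge0_fin_numE// ltey.
move: X0 H; rewrite -(fineK Xf) -EFinM !lee_fin => X0 H.
rewrite -[y u l ^+ 2]real_normK ?num_real//.
(* With this sign the quadratic is trivially nonnegative for s <= 0, and for s > 0 it is [H s]. *)
rewrite mulrC; suff : (- `|y u l|) ^+ 2 <= fine X * p by rewrite sqrrN.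
apply: sqr_le_of_quadratic_ge0 => s.
have [s0|s0] := leP s 0.
  have := sqr_ge0 s; have := normr_ge0 (y u l); move: `|y u l| => t; nra.
have := H s s0; rewrite -EFinD lee_fin; move: `|y u l| => t; lra.
Qed.

(** The pointwise bound is integrated in [u] and the integrals are exchanged, which brings in the
    bound [q] and the column sums [w2]. The ratio m / n in [w2] exactly converts the normalization 1
    / m of the output energy into the 1 / n of the input. *)
Lemma schur_pos (p q : R) : (0 < n)%N -> (0 < m)%N -> 0 < p -> 0 <= q ->
  (forall i l u, (\int[leb2]_v (k i l u v)%:E <= (p * w i l)%:E)%E) ->
  (forall i l v, (\int[leb2]_u (k i l u v)%:E <= (q * w i l)%:E)%E) ->
  (energy y <= (p * q)%:E * energy x)%E.
Proof.
move=> n0 m0 p0 q0 Hp Hq; have Hpt := schur_pointwise p0 Hp.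
pose E i := (\int[leb2]_v (x v i ^+ 2)%:E)%E.
have E0 i : (0 <= E i)%E by apply: integral_ge0 => v _; rewrite lee_fin sqr_ge0.
have mkxx i l : measurable_fun [set: plane R * plane R] (fun z => (k i l z.1 z.2 * x z.2 i ^+ 2)%:E).
  apply/measurable_EFinP; apply: measurable_funM => //; apply: measurable_funX.
  exact: (measurableT_comp (mx i) measurable_snd).
have kx0 i l (z : plane R * plane R) : (0 <= (k i l z.1 z.2 * x z.2 i ^+ 2)%:E)%E.
  by rewrite lee_fin mulr_ge0// sqr_ge0.
have mI i l : measurable_fun [set: plane R] (fun u => \int[leb2]_v (k i l u v * x v i ^+ 2)%:E)%E.
  exact: (measurable_integral_leb2 (mkxx i l)).
have I0 i l u : (0 <= \int[leb2]_v (k i l u v * x v i ^+ 2)%:E)%E.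
  by apply: integral_ge0 => v _; exact: (kx0 i l (u, v)).
have S1 l : (\int[leb2]_u (y u l ^+ 2)%:E <= p%:E * (q%:E * \sum_(i < n) (w i l)%:E * E i))%E.
  apply: (@le_trans _ _ (\int[leb2]_u (p%:E * \sum_(i < n) \int[leb2]_v (k i l u v * x v i ^+ 2)%:E))%E).
    apply: ge0_le_integral => //.
    - by move=> u _; rewrite lee_fin sqr_ge0.
    - by apply/measurable_EFinP; exact: measurable_funX.
    - by apply: emeasurable_funM; [exact: measurable_cst|exact: emeasurable_sum].
  rewrite ge0_integralZl_EFin//; last 3 first.
  - by move=> u _; exact: sume_ge0.
  - exact: emeasurable_sum.
  - exact: ltW.
  apply: lee_wpmul2l; first by rewrite lee_fin ltW.
  rewrite ge0_integral_sum// ge0_sume_distrr; last first.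
    by move=> i _; rewrite mule_ge0// lee_fin.
  apply: lee_sum => i _.
  rewrite (leb2_leb2_swap (mkxx i l))//.
  rewrite muleA -EFinM -ge0_integralZl_EFin//; last 3 first.
  - by move=> v _; rewrite lee_fin sqr_ge0.
  - by apply/measurable_EFinP; exact: measurable_funX.
  - exact: mulr_ge0.
  apply: ge0_le_integral => //.
  - by move=> v _; apply: integral_ge0 => u _; exact: (kx0 i l (u, v)).
  - exact: (measurable_leb2_fst (mkxx i l)).
  - by apply/measurable_EFinP; apply: measurable_funM; [exact: measurable_cst|exact: measurable_funX].
  - move=> v _; under eq_integral do rewrite mulrC EFinM.
    rewrite /= ge0_integralZl_EFin ?sqr_ge0//; last 2 first.
    + by move=> u _; rewrite lee_fin.
    + exact/measurable_EFinP.
    by rewrite muleC lee_wpmul2r// lee_fin sqr_ge0.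
rewrite /energy.
apply: (@le_trans _ _ ((m%:R^-1)%:E * (p%:E * (q%:E * ((m%:R / n%:R)%:E * \sum_(i < n) E i))))%E).
  apply: lee_wpmul2l; first by rewrite lee_fin invr_ge0.
  apply: (le_trans (lee_sum _ (fun l _ => S1 l))).
  rewrite -ge0_sume_distrr; last first.
    move=> l _; rewrite mule_ge0 ?lee_fin//; apply: sume_ge0 => i _.
    by rewrite mule_ge0// lee_fin.
  apply: lee_wpmul2l; first by rewrite lee_fin ltW.
  rewrite -ge0_sume_distrr; last first.
    by move=> l _; apply: sume_ge0 => i _; rewrite mule_ge0// lee_fin.
  apply: lee_wpmul2l; first by rewrite lee_fin.
  rewrite exchange_big/= ge0_sume_distrr//; apply: lee_sum => i _.
  rewrite -ge0_sume_distrl; last by move=> l _; rewrite lee_fin.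
  by rewrite sumEFin lee_wpmul2r// lee_fin.
rewrite !muleA -!EFinM; apply: lee_wpmul2r; first exact: sume_ge0.
rewrite lee_fin le_eqVlt; apply/orP; left; apply/eqP; field.
by rewrite !pnatr_eq0 -!lt0n n0 m0.
Qed.

End schur.

(** Allows vanishing constants in estimates whose proof divides by them. *)
Lemma sqr_le_addgt0 (R : realType) (E : \bar R) (a b c : R) : 0 <= a -> 0 <= b -> 0 <= c ->
  (forall e, 0 < e -> (E <= ((a + e) * (b + e) * c)%:E)%E) -> (E <= (a * b * c)%:E)%E.
Proof.
move=> a0 b0 c0 H; apply/lee_addgt0Pr => e e0.
(* For d <= 1, replacing a and b by a + d and b + d increases a b c by at most d K. *)
pose K := (a + b + 1) * c + 1.
have K0 : 0 < K by rewrite ltr_wpDl// mulr_ge0// !addr_ge0.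
pose d := Num.min 1 (e / K).
have d0 : 0 < d by rewrite lt_min ltr01 divr_gt0.
have d1 : d <= 1 by rewrite ge_min lexx.
have dK : d * K <= e by rewrite -ler_pdivlMr// ge_min lexx orbT.
apply: (le_trans (H d d0)); rewrite -EFinD lee_fin.
apply: (@le_trans _ _ (a * b * c + d * K)); last by rewrite lerD2l.
have -> : (a + d) * (b + d) * c = a * b * c + d * ((a + b + d) * c) by ring.
rewrite lerD2l ler_pM2l// /K.
have : (a + b + d) * c <= (a + b + 1) * c by apply: ler_wpM2r => //; lra.
lra.
Qed.

Section schur_bound.
Context (R : realType) (n m : nat).
Variables (k : 'I_n -> 'I_m -> R * R -> R * R -> R) (w : 'I_n -> 'I_m -> R).
Hypotheses (n0 : (0 < n)%N) (m0 : (0 < m)%N)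
  (mk : forall i l, measurable_fun [set: plane R * plane R] (fun z => k i l z.1 z.2))
  (k0 : forall i l u v, 0 <= k i l u v)
  (w0 : forall i l, 0 <= w i l)
  (w1 : forall l, \sum_(i < n) w i l <= 1)
  (w2 : forall i, \sum_(l < m) w i l <= m%:R / n%:R).
Variables (x : R * R -> 'I_n -> R) (y : R * R -> 'I_m -> R).
Hypotheses
  (mx : forall i, measurable_fun [set: plane R] (x ^~ i))
  (my : forall l, measurable_fun [set: plane R] (y ^~ l))
  (Hy : forall u l, (`|y u l|%:E <= \sum_(i < n) \int[leb2]_v (k i l u v * `|x v i|)%:E)%E).

Lemma schur_bound (p q c e : R) : 0 <= p -> 0 <= q -> p * q <= c ^+ 2 ->
  (forall i l u, (\int[leb2]_v (k i l u v)%:E <= (p * w i l)%:E)%E) ->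
  (forall i l v, (\int[leb2]_u (k i l u v)%:E <= (q * w i l)%:E)%E) ->
  (energy x <= (e ^+ 2)%:E)%E -> (energy y <= ((c * e) ^+ 2)%:E)%E.
Proof.
move=> p0 q0 pq Hp Hq Ex.
apply: (@le_trans _ _ (p * q * e ^+ 2)%:E); last first.
  by rewrite lee_fin exprMn ler_wpM2r// sqr_ge0.
apply: sqr_le_addgt0 => //; first exact: sqr_ge0.
move=> d d0; rewrite EFinM; apply: le_trans (lee_wpmul2l _ Ex); last first.
  by rewrite lee_fin mulr_ge0// addr_ge0// ltW.
apply: (schur_pos mk k0 w0 w1 w2 mx my Hy) => //.
- by rewrite ltr_wpDl.
- by rewrite addr_ge0// ltW.
- move=> i l u; apply: (le_trans (Hp i l u)); rewrite lee_fin ler_wpM2r//.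
  by rewrite lerDl ltW.
- move=> i l v; apply: (le_trans (Hq i l v)); rewrite lee_fin ler_wpM2r//.
  by rewrite lerDl ltW.
Qed.

End schur_bound.

(** Minkowski's inequality from (s + t)^2 <= (1 + b / a) s^2 + (1 + a / b) t^2: with the bounds of
    the two norms as weights, the right-hand side integrates to at most (a + b)^2. Both weights are
    increased by e / 2 so that they are positive. *)
Lemma energyD (R : realType) (m : nat) (x y : R * R -> 'I_m -> R) (a b : R) :
  (forall l, measurable_fun [set: plane R] (x ^~ l)) ->
  (forall l, measurable_fun [set: plane R] (y ^~ l)) ->
  0 <= a -> 0 <= b ->
  (energy x <= (a ^+ 2)%:E)%E -> (energy y <= (b ^+ 2)%:E)%E ->
  (energy (fun u l => (x u l + y u l)%R) <= ((a + b) ^+ 2)%:E)%E.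
Proof.
move=> mx my a0 b0 Ex Ey; rewrite -[(a + b) ^+ 2]mulr1 expr2.
have ab0 : 0 <= a + b by exact: addr_ge0.
apply: sqr_le_addgt0 => // e e0.
pose a' := a + e / 2; pose b' := b + e / 2.
have a'0 : 0 < a' by rewrite ltr_wpDl// divr_gt0.
have b'0 : 0 < b' by rewrite ltr_wpDl// divr_gt0.
have c0 : 0 <= 1 + b' / a' by rewrite addr_ge0// divr_ge0// ltW.
have d0 : 0 <= 1 + a' / b' by rewrite addr_ge0// divr_ge0// ltW.
have sq (c l : R) : 0 <= l -> l <= c -> l ^+ 2 <= c ^+ 2.
  by move=> l0 lc; rewrite ler_sqr// nnegrE// (le_trans l0).
apply: (@le_trans _ _ ((1 + b' / a')%:E * energy x + (1 + a' / b')%:E * energy y)%E).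
  rewrite /energy !(muleCA _ (m%:R^-1)%:E) -ge0_muleDr; last 2 first.
  - rewrite mule_ge0 ?lee_fin//; apply: sume_ge0 => l _.
    by apply: integral_ge0 => u _; rewrite lee_fin sqr_ge0.
  - rewrite mule_ge0 ?lee_fin//; apply: sume_ge0 => l _.
    by apply: integral_ge0 => u _; rewrite lee_fin sqr_ge0.
  apply: lee_wpmul2l; first by rewrite lee_fin invr_ge0.
  rewrite !ge0_sume_distrr -?big_split/=; last 2 first.
  - by move=> l _; apply: integral_ge0 => u _; rewrite lee_fin sqr_ge0.
  - by move=> l _; apply: integral_ge0 => u _; rewrite lee_fin sqr_ge0.
  apply: lee_sum => l _.
  have m1 : measurable_fun [set: plane R] (fun u => (x u l ^+ 2)%:E).
    by apply/measurable_EFinP; exact: measurable_funX.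
  have m2 : measurable_fun [set: plane R] (fun u => (y u l ^+ 2)%:E).
    by apply/measurable_EFinP; exact: measurable_funX.
  have n1 u : (0 <= (x u l ^+ 2)%:E)%E by rewrite lee_fin sqr_ge0.
  have n2 u : (0 <= (y u l ^+ 2)%:E)%E by rewrite lee_fin sqr_ge0.
  have m3 : measurable_fun [set: plane R] (fun u => (1 + b' / a')%:E * (x u l ^+ 2)%:E)%E.
    by apply: emeasurable_funM => //; exact: measurable_cst.
  have m4 : measurable_fun [set: plane R] (fun u => (1 + a' / b')%:E * (y u l ^+ 2)%:E)%E.
    by apply: emeasurable_funM => //; exact: measurable_cst.
  have n3 u : (0 <= (1 + b' / a')%:E * (x u l ^+ 2)%:E)%E by rewrite mule_ge0.
  have n4 u : (0 <= (1 + a' / b')%:E * (y u l ^+ 2)%:E)%E by rewrite mule_ge0.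
  rewrite -!ge0_integralZl_EFin// -ge0_integralD//.
  apply: ge0_le_integral => //.
  - by move=> u _; rewrite lee_fin sqr_ge0.
  - by apply/measurable_EFinP; apply: measurable_funX; exact: measurable_funD.
  - exact: emeasurable_funD.
  - move=> u _; rewrite -!EFinM -EFinD lee_fin; move: (x u l) (y u l) => s t.
    rewrite -subr_ge0.
    have -> : (1 + b' / a') * s ^+ 2 + (1 + a' / b') * t ^+ 2 - (s + t) ^+ 2 =
      (b' * s - a' * t) ^+ 2 / (a' * b') by field; rewrite !gt_eqF.
    by rewrite divr_ge0 ?sqr_ge0// mulr_ge0// ltW.
have -> : (a + b + e) * (a + b + e) * 1 =
    (1 + b' / a') * a' ^+ 2 + (1 + a' / b') * b' ^+ 2.
  have -> : a + b + e = a' + b' by rewrite /a' /b'; field.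
  by field; rewrite !gt_eqF.
rewrite (EFinD (_ * _) (_ * _)) (EFinM _ (a' ^+ 2)) (EFinM _ (b' ^+ 2)); apply: leeD; apply: lee_wpmul2l; rewrite ?lee_fin//.
- by apply: (le_trans Ex); rewrite lee_fin; apply: sq => //; rewrite lerDl divr_ge0// ltW.
- by apply: (le_trans Ey); rewrite lee_fin; apply: sq => //; rewrite lerDl divr_ge0// ltW.
Qed.

Lemma energy_triangle (R : realType) (m : nat) (x y z : R * R -> 'I_m -> R) (a b : R) :
  (forall l, measurable_fun [set: plane R] (x ^~ l)) ->
  (forall l, measurable_fun [set: plane R] (y ^~ l)) ->
  (forall l, measurable_fun [set: plane R] (z ^~ l)) ->
  0 <= a -> 0 <= b ->
  (energy (fun u l => (x u l - y u l)%R) <= (a ^+ 2)%:E)%E ->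
  (energy (fun u l => (y u l - z u l)%R) <= (b ^+ 2)%:E)%E ->
  (energy (fun u l => (x u l - z u l)%R) <= ((a + b) ^+ 2)%:E)%E.
Proof.
move=> mx my mz a0 b0 Exy Eyz.
rewrite (_ : (fun u l => x u l - z u l) = fun u l => (x u l - y u l) + (y u l - z u l)).
  by apply: energyD => // l; exact: measurable_funB.
by apply/funext => u; apply/funext => l; rewrite addrA subrK.
Qed.

Section convolution.
Context (R : realType) (w x : R * R -> R) (A : R).
Hypotheses (mw : measurable_fun [set: plane R] w) (mx : measurable_fun [set: plane R] x)
  (wb : exists K, forall u, `|w u| <= K) (wA : (\int[leb2]_u `|w u|%:E <= A%:E)%E)
  (xx : (\int[leb2]_u (x u ^+ 2)%:E < +oo)%E).

Lemma measurable_shift (a : R * R) (f : R * R -> R) :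
  measurable_fun [set: plane R] f -> measurable_fun [set: plane R] (fun v : plane R => f (v + a)).
Proof.
move=> mf; apply: (measurableT_comp mf); apply: measurable_fun_pair.
  by apply: measurable_funD; [exact: measurable_fst|exact: measurable_cst].
by apply: measurable_funD; [exact: measurable_snd|exact: measurable_cst].
Qed.

(** If |w| <= K, then 2 |w x| <= w^2 + x^2 <= K |w| + x^2, and both terms are integrable. *)
Lemma convolution_integrable (a : R * R) :
  leb2.-integrable [set: plane R] (fun v => (w (v - a) * x v)%:E).
Proof.
have [K wK] := wb.
have mws : measurable_fun [set: plane R] (fun v : plane R => w (v - a)) by exact: measurable_shift.
have K0 : 0 <= K by apply: le_trans (wK (0, 0)).
apply/integrableP; split; first by apply/measurable_EFinP; exact: measurable_funM.
have m1 : measurable_fun [set: plane R] (fun v => `|w (v - a)|%:E : \bar R).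
  by apply/measurable_EFinP; exact: measurableT_comp.
have m2 : measurable_fun [set: plane R] (fun u => (x u ^+ 2)%:E).
  by apply/measurable_EFinP; exact: measurable_funX.
have m3 : measurable_fun [set: plane R] (fun v => K%:E * `|w (v - a)|%:E : \bar R)%E.
  by apply: emeasurable_funM => //; exact: measurable_cst.
apply: (@le_lt_trans _ _ (\int[leb2]_v (K%:E * `|w (v - a)|%:E + (x v ^+ 2)%:E))%E).
  apply: ge0_le_integral => //.
  - by apply: measurableT_comp => //; apply/measurable_EFinP; exact: measurable_funM.
  - exact: emeasurable_funD.
  - move=> v _; rewrite -EFinM -EFinD lee_fin normrM.
    have := wK (v - a); rewrite -(real_normK (num_real (x v))).
    move: (normr_ge0 (w (v - a))) (normr_ge0 (x v)) (sqr_ge0 (`|w (v - a)| - `|x v|)).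
    move: `|w _| `|x v| => s t s0 t0 st sK.
    have : s ^+ 2 <= K * s by rewrite expr2 ler_wpM2r.
    nra.
rewrite ge0_integralD//; last 2 first.
- by move=> v _; rewrite -EFinM lee_fin mulr_ge0.
- by move=> v _; rewrite lee_fin sqr_ge0.
rewrite ge0_integralZl_EFin// lte_add_pinfty//.
rewrite lte_mul_pinfty//.
have mwa : measurable_fun [set: plane R] (fun v => `|w v|%:E : \bar R).
  by apply/measurable_EFinP; exact: measurableT_comp.
under eq_integral do rewrite addrC.
rewrite (ge0_leb2_shift (- a) mwa)//.
by apply: le_lt_trans wA _; exact: ltry.
Qed.

Lemma convolution_shift (a : R * R) :
  \int[leb2]_v (w v * x (a + v)) = \int[leb2]_v (w (v - a) * x v).
Proof.
rewrite /Rintegral; congr fine.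
have H := @change_of_variables_integral R (fun v => a + v) (fun=> 1) _ _ (fun v : R * R => w (v - a) * x v).
rewrite -[RHS]H//.
- by apply: eq_integral => v _; rewrite mulr1 addrAC subrr add0r.
- move=> f mf f0; under eq_integral do rewrite mule1.
  exact: ge0_leb2_shift.
- by apply: measurable_funM => //; exact: measurable_shift.
Qed.

Lemma convolution_shift_integrable (a : R * R) :
  leb2.-integrable [set: plane R] (fun v => (w v * x (a + v))%:E).
Proof.
have mT : measurable_fun [set: plane R] ((fun v => a + v) : plane R -> plane R).
  apply: measurable_fun_pair.
    by apply: measurable_funD; [exact: measurable_cst|exact: measurable_fst].
  by apply: measurable_funD; [exact: measurable_cst|exact: measurable_snd].
have H := @change_of_variables_integrable R (fun v => a + v) (fun=> 1) mT _ _ _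
  (fun v => w (v - a) * x v) (convolution_integrable a).
have -> : (fun v => (w v * x (a + v))%:E) = fun v => (w (a + v - a) * x (a + v) * 1)%:E.
  by apply/funext => v; rewrite mulr1 addrAC subrr add0r.
apply: H => //.
by move=> f mf f0; under eq_integral do rewrite mule1; exact: ge0_leb2_shift.
Qed.

End convolution.

Lemma Rintegral_dist_le (R : realType) (f g : R * R -> R) :
  leb2.-integrable [set: plane R] (fun v => (f v)%:E) ->
  leb2.-integrable [set: plane R] (fun v => (g v)%:E) ->
  (`|\int[leb2]_v f v - \int[leb2]_v g v|%:E <= \int[leb2]_v `|f v - g v|%:E)%E.
Proof.
move=> fi gi; rewrite -RintegralB//.
have fgi : leb2.-integrable [set: plane R] (fun v => (f v - g v)%:E).
  have -> : (fun v => (f v - g v)%:E) = (fun v => (f v)%:E - (g v)%:E)%E by [].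
  exact: integrableB.
have [mfg _] := integrableP _ _ _ fgi.
apply: le_trans (le_abse_integral _ _ mfg) => //.
by rewrite -[X in `|X|%E]fineK ?integrable_fin_num.
Qed.

(** * The three kernels *)
Lemma enormD (R : realType) (u v : R * R) : enorm (u + v) <= enorm u + enorm v.
Proof.
rewrite -ler_sqr ?nnegrE ?addr_ge0 ?enorm_ge0// sqrrD !enorm_sqr/=.
have := le_trans (ler_norm _) (enorm_dot u v); rewrite -mulr_natr.
move: (enorm u * enorm v) => t; nra.
Qed.

Section plane_measurability.
Context (R : realType) d (T : measurableType d).

Lemma measurable_plane_sub (f h : T -> plane R) :
  measurable_fun [set: T] f -> measurable_fun [set: T] h ->
  measurable_fun [set: T] ((fun t => (f t : R * R) - h t) : T -> plane R).
Proof.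
move=> mf mh; apply: measurable_fun_pair; apply: measurable_funB.
- exact: (measurableT_comp measurable_fst mf).
- exact: (measurableT_comp measurable_fst mh).
- exact: (measurableT_comp measurable_snd mf).
- exact: (measurableT_comp measurable_snd mh).
Qed.

Lemma measurable_plane_scale (s : T -> measurableTypeR R) (f : T -> plane R) :
  measurable_fun [set: T] s -> measurable_fun [set: T] f ->
  measurable_fun [set: T] ((fun t => (s t * (f t).1, s t * (f t).2)) : T -> plane R).
Proof.
move=> ms mf; apply: measurable_fun_pair; apply: measurable_funM => //.
- exact: (measurableT_comp measurable_fst mf).
- exact: (measurableT_comp measurable_snd mf).
Qed.

End plane_measurability.

Lemma continuous_measurable_plane (R : realType) (f : R * R -> R * R) :
  continuous f -> measurable_fun [set: plane R] (f : plane R -> plane R).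
Proof.
move=> cf; have -> : f = fun u => ((f u).1, (f u).2) by apply/funext => u; case: (f u).
apply: measurable_fun_pair; apply: continuous_measurable_prod => u.
  exact: (continuous_cvg _ (@fst_continuous R _) (cf u)).
exact: (continuous_cvg _ (@snd_continuous R _) (cf u)).
Qed.

(** Tonelli on [0, 1] times the plane: the kernel is dominated by an average over [s] of functions
    with integral at most [b]. This is how gradient integrals along segments become L^1 bounds. *)
Lemma segment_average_le (R : realType) (h : R * (R * R) -> R) (k : R * R -> R) (b : R) :
  measurable_fun [set: measurableTypeR R * plane R] h -> (forall z, 0 <= h z) ->
  measurable_fun [set: plane R] k ->
  (forall v, (`|k v|%:E <= \int[lebesgue_measure]_(s in `[0%R, 1%R]) (h (s, v))%:E)%E) ->
  (forall s : R, 0 <= s <= 1 -> (\int[leb2]_v (h (s, v))%:E <= b%:E)%E) ->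
  (\int[leb2]_v `|k v|%:E <= b%:E)%E.
Proof.
move=> mh h0 mk kh hb.
pose I : set R := `[0%R, 1%R]%classic.
pose f (z : measurableTypeR R * plane R) := (\1_I z.1 * h z)%:E.
have f0 z : (0 <= f z)%E by rewrite lee_fin mulr_ge0.
have mI : measurable_fun [set: measurableTypeR R] (\1_I : measurableTypeR R -> R).
  by apply: measurable_indic; exact: measurable_itv.
have mf : measurable_fun [set: measurableTypeR R * plane R] f.
  apply/measurable_EFinP; apply: measurable_funM => //.
  exact: (measurableT_comp mI measurable_fst).
have b0 : 0 <= b.
  rewrite -lee_fin; apply: le_trans (hb 0 _); last by rewrite lexx ler01.
  by apply: integral_ge0 => v _; rewrite lee_fin.
have E v : (\int[lebesgue_measure]_(s in `[0%R, 1%R]) (h (s, v))%:E = \int[lebesgue_measure]_s f (s, v))%E.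
  rewrite integral_mkcond; apply: eq_integral => s _.
  by rewrite patchE /f indicE; case: ifP => _; rewrite ?mul1r ?mul0r.
apply: (@le_trans _ _ (\int[leb2]_v \int[lebesgue_measure]_s f (s, v))%E).
  apply: ge0_le_integral => //.
  - by apply/measurable_EFinP; exact: measurableT_comp.
  - exact: measurable_leb2_integral.
  - by move=> v _; rewrite -E.
rewrite leb2_tonelli_swap//.
apply: (@le_trans _ _ (\int[lebesgue_measure]_s (b%:E * (\1_I s)%:E))%E).
  apply: ge0_le_integral => //.
  - by move=> s _; apply: integral_ge0.
  - exact: measurable_integral_leb2.
  - apply: emeasurable_funM; first exact: measurable_cst.
    exact/measurable_EFinP.
  - move=> s _; rewrite /f/= indicE; have [sI|sI] := boolP (s \in I).
      rewrite mule1; under eq_integral do rewrite mul1r.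
      by apply: hb; have := set_mem sI; rewrite /I/= in_itv.
    by rewrite mule0; under eq_integral do rewrite mul0r; rewrite integral0.
rewrite ge0_integralZl_EFin//; last exact/measurable_EFinP.
rewrite integral_indic//; last exact: measurable_itv.
by rewrite setIT /I/= lebesgue_measure_itv/= lte_fin ltr01 -EFinD subr0 mule1.
Qed.

(** Here a = |v - u|, c = |tau v - tau u| and e is the length of the interpolated difference. From c
    <= g a <= g (r + c) follows the ratio g / (1 - g). *)
Lemma displacement_ratio (R : realType) (g r a c e s : R) : 0 <= g -> 0 <= c ->
  0 <= s -> s <= 1 -> c <= g * a -> e <= r -> a <= e + s * c -> c * (1 - g) <= g * r.
Proof.
move=> g0 c0 s0 s1 ca er ae; have sc : s * c <= c by rewrite ler_piMl.
have : g * a <= g * (r + c) by apply: ler_wpM2l => //; lra.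
lra.
Qed.

Section kernels.
Context (R : realType) (tau : R * R -> R * R) (g : R).
Hypotheses (htau : is_Ck 1 tau) (gE : grad_sup tau = g%:E) (g5 : g < 5^-1).
Variables (r A : R) (w G : R * R -> R).
Hypotheses (r0 : 0 < r) (hw : controlled_filter r A w G).

Let rho (u : R * R) : R * R := u - tau u.

Let g0 : 0 <= g. Proof. by rewrite -lee_fin -gE grad_sup_ge0. Qed.

Let g1 : 0 < 1 - g. Proof. by rewrite (lt_le_trans _ (half_sub g5)). Qed.

Lemma deform_path1 u : deform_path tau 1 u = u - tau u.
Proof. by rewrite /deform_path !mul1r. Qed.

Let mw : measurable_fun [set: plane R] w := cf_measurable hw.
Let mG : measurable_fun [set: plane R] G := cf_grad_measurable hw.

Let G0 u : 0 <= G u. Proof. exact: (cf_grad_ge0 hw). Qed.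

Let mGE : measurable_fun [set: plane R] (fun u => (G u)%:E).
Proof. exact/measurable_EFinP. Qed.

Lemma deformation_continuous : continuous tau.
Proof.
have c1 := C1_continuous (is_Ck1_C1 (is_Ck_fst htau)).
have c2 := C1_continuous (is_Ck1_C1 (is_Ck_snd htau)).
by move=> u; rewrite (_ : tau = fun u => ((tau u).1, (tau u).2));
  [apply: cvg_pair2; [exact: c1|exact: c2]|apply/funext => v; case: (tau v)].
Qed.

Let mtau : measurable_fun [set: plane R] (tau : plane R -> plane R).
Proof. by apply: continuous_measurable_plane; exact: deformation_continuous. Qed.

Lemma measurable_deformation :
  measurable_fun [set: plane R] ((fun u => u - tau u) : plane R -> plane R).
Proof. exact: measurable_plane_sub. Qed.

Let measurable_path d (T : measurableType d) (s : T -> measurableTypeR R) (f : T -> plane R) :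
  measurable_fun [set: T] s -> measurable_fun [set: T] f ->
  measurable_fun [set: T] ((fun t => deform_path tau (s t) (f t)) : T -> plane R).
Proof.
move=> ms mf; apply: (@measurable_plane_sub _ _ _ f (fun t => (s t * (tau (f t)).1, s t * (tau (f t)).2))) => //.
apply: (@measurable_plane_scale _ _ _ s (fun t => tau (f t))) => //.
exact: (measurableT_comp mtau).
Qed.

Let grad_bound := Num.sqrt 2 * A / r.

Let ge0_shift (f : R * R -> R) (b : R) (a : R * R) : measurable_fun [set: plane R] f ->
  (forall u, 0 <= f u) -> (\int[leb2]_u (f u)%:E <= b%:E)%E ->
  (\int[leb2]_u (f (u - a))%:E <= b%:E)%E.
Proof.
move=> mf f0 fb; under eq_integral do rewrite addrC.
rewrite (ge0_leb2_shift (f := fun u => (f u)%:E))//; exact/measurable_EFinP.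
Qed.

Let ge0_reflect (f : R * R -> R) (b : R) (a : R * R) : measurable_fun [set: plane R] f ->
  (forall u, 0 <= f u) -> (\int[leb2]_u (f u)%:E <= b%:E)%E ->
  (\int[leb2]_u (f (a - u))%:E <= b%:E)%E.
Proof.
move=> mf f0 fb.
rewrite (ge0_leb2_reflect (f := fun u => (f u)%:E))//; exact/measurable_EFinP.
Qed.

Let msub (a : R * R) (f : R * R -> R) : measurable_fun [set: plane R] f ->
  measurable_fun [set: plane R] (fun u => f (u - a)).
Proof.
move=> mf; apply: (measurableT_comp mf).
by apply: (@measurable_plane_sub _ _ _ id (fun=> a)) => //; exact: measurable_cst.
Qed.

Let mrsub (a : R * R) (f : R * R -> R) : measurable_fun [set: plane R] f ->
  measurable_fun [set: plane R] (fun u => f (a - u)).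
Proof.
move=> mf; apply: (measurableT_comp mf).
by apply: (@measurable_plane_sub _ _ _ (fun=> a) id) => //; exact: measurable_cst.
Qed.

Let ge0_path_shift (f : R * R -> R) (b s : R) (a : R * R) : measurable_fun [set: plane R] f ->
  (forall u, 0 <= f u) -> (\int[leb2]_u (f u)%:E <= b%:E)%E -> 0 <= s <= 1 ->
  (\int[leb2]_u (f (deform_path tau s u - a))%:E <= ((1 - g) ^- 2 * b)%:E)%E.
Proof.
move=> mf f0 fb s01.
apply: (le_trans (deform_path_integral_le htau gE g5 (f := fun u => (f (u - a))%:E) s01 _ _)).
- by apply/measurable_EFinP; exact: msub.
- by move=> u; rewrite lee_fin.
rewrite EFinM; apply: lee_wpmul2l; last exact: ge0_shift.
by rewrite lee_fin invr_ge0 exprn_ge0// ltW.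
Qed.

Let ge0_path_reflect (f : R * R -> R) (b s : R) (a : R * R) : measurable_fun [set: plane R] f ->
  (forall u, 0 <= f u) -> (\int[leb2]_u (f u)%:E <= b%:E)%E -> 0 <= s <= 1 ->
  (\int[leb2]_u (f (a - deform_path tau s u))%:E <= ((1 - g) ^- 2 * b)%:E)%E.
Proof.
move=> mf f0 fb s01.
apply: (le_trans (deform_path_integral_le htau gE g5 (f := fun u => (f (a - u))%:E) s01 _ _)).
- by apply/measurable_EFinP; exact: mrsub.
- by move=> u; rewrite lee_fin.
rewrite EFinM; apply: lee_wpmul2l; last exact: ge0_reflect.
by rewrite lee_fin invr_ge0 exprn_ge0// ltW.
Qed.

Let mwn : measurable_fun [set: plane R] (fun u => `|w u|).
Proof. exact: measurableT_comp. Qed.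

Lemma translation_kernel_measurable :
  measurable_fun [set: plane R * plane R] (fun z => `|w ((z.2 : R * R) - z.1)|).
Proof.
apply: (measurableT_comp mwn).
by apply: measurable_plane_sub; [exact: measurable_snd|exact: measurable_fst].
Qed.

Lemma translation_kernel_snd (u : R * R) : (\int[leb2]_v `|w (v - u)|%:E <= A%:E)%E.
Proof. exact: (@ge0_shift (fun u => `|w u|) A u mwn _ (cf_L1 hw)). Qed.

Lemma translation_kernel_fst (v : R * R) : (\int[leb2]_u `|w (v - u)|%:E <= A%:E)%E.
Proof. exact: (@ge0_reflect (fun u => `|w u|) A v mwn _ (cf_L1 hw)). Qed.

Section displacement_kernel.
Variable T : R.
Hypothesis hT : forall u, enorm (tau u) <= T.

Let T0 : 0 <= T. Proof. by apply: le_trans (hT 0); exact: enorm_ge0. Qed.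

Lemma displacement_kernel_measurable : measurable_fun [set: plane R * plane R]
  (fun z => `|w ((z.2 : R * R) - z.1) - w ((z.2 : R * R) - ((z.1 : R * R) - tau z.1))|).
Proof.
apply: measurableT_comp => //; apply: measurable_funB.
  apply: (measurableT_comp mw).
  by apply: measurable_plane_sub; [exact: measurable_snd|exact: measurable_fst].
apply: (measurableT_comp mw); apply: measurable_plane_sub; first exact: measurable_snd.
exact: (measurableT_comp measurable_deformation measurable_fst).
Qed.

Let segment (u v : R * R) :
  (`|w (v - u) - w (v - (u - tau u))|%:E <= \int[lebesgue_measure]_(s in `[0%R, 1%R])
     (T * G (v - deform_path tau s u))%:E)%E.
Proof.
have := cf_segment hw (v - u) (tau u).
have -> : line (v - u) (tau u) 0 = v - u.
  by rewrite /line !mul0r !addr0 -surjective_pairing.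
have -> : line (v - u) (tau u) 1 = v - (u - tau u).
  by rewrite /line !mul1r opprB addrA addrAC; case: (tau u).
rewrite distrC => H; apply: (le_trans H).
have E s : line (v - u) (tau u) s = v - deform_path tau s u.
  by rewrite /line /deform_path; congr pair; rewrite /=; ring.
have mGp : measurable_fun [set: measurableTypeR R] (fun s => G (v - deform_path tau s u)).
  apply: (measurableT_comp mG); apply: (@measurable_plane_sub _ _ _ (fun=> v)).
    exact: measurable_cst.
  by apply: (@measurable_path _ _ id (fun=> u)) => //; exact: measurable_cst.
have mGl : measurable_fun [set: measurableTypeR R] (fun s => G (line (v - u) (tau u) s)).
  by rewrite (_ : (fun s => G (line (v - u) (tau u) s)) = fun s => G (v - deform_path tau s u));
    [|apply/funext => s; rewrite E].
apply: ge0_le_integral => //.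
- by move=> s _; rewrite lee_fin mulr_ge0 ?enorm_ge0// G0.
- by apply/measurable_EFinP; apply: measurable_funTS; apply: measurable_funM => //; exact: measurable_cst.
- by apply/measurable_EFinP; apply: measurable_funTS; apply: measurable_funM => //; exact: measurable_cst.
- by move=> s _; rewrite lee_fin E ler_wpM2r// G0.
Qed.

Let mTG : measurable_fun [set: plane R] (fun u => T * G u).
Proof. by apply: measurable_funM => //; exact: measurable_cst. Qed.

Let TG0 u : 0 <= T * G u. Proof. by rewrite mulr_ge0// G0. Qed.

Let TGb : (\int[leb2]_u (T * G u)%:E <= (T * grad_bound)%:E)%E.
Proof.
under eq_integral do rewrite EFinM.
rewrite ge0_integralZl_EFin//; last by move=> u _; rewrite lee_fin G0.
by rewrite EFinM; apply: lee_wpmul2l; [rewrite lee_fin|exact: (cf_grad_L1 hw)].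
Qed.

Lemma displacement_kernel_snd (u : R * R) :
  (\int[leb2]_v `|w (v - u) - w (v - (u - tau u))|%:E <= (T * Num.sqrt 2 / r * A)%:E)%E.
Proof.
have -> : T * Num.sqrt 2 / r * A = T * grad_bound by rewrite /grad_bound; ring.
apply: (segment_average_le (h := fun z => T * G (z.2 - deform_path tau z.1 u))) => //.
- apply: (measurableT_comp mTG); apply: measurable_plane_sub; first exact: measurable_snd.
  by apply: (@measurable_path _ _ _ (fun=> u)); [exact: measurable_fst|exact: measurable_cst].
- by apply: measurable_funB; exact: msub.
- by move=> s _; exact: (@ge0_shift (fun u => T * G u) _ (deform_path tau s u) mTG TG0 TGb).
Qed.

(** In [v] the interpolated kernel is only translated; in [u] it is composed with
    [deform_path tau s], whose Jacobian costs the additional factor (1 - g)^-2. *)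
Lemma displacement_kernel_fst (v : R * R) :
  (\int[leb2]_u `|w (v - u) - w (v - (u - tau u))|%:E <=
    ((1 - g) ^- 2 * (T * Num.sqrt 2 / r) * A)%:E)%E.
Proof.
have -> : (1 - g) ^- 2 * (T * Num.sqrt 2 / r) * A = (1 - g) ^- 2 * (T * grad_bound).
  by rewrite /grad_bound; ring.
apply: (segment_average_le (h := fun z => T * G (v - deform_path tau z.1 z.2))) => //.
- apply: (measurableT_comp mTG); apply: measurable_plane_sub; first exact: measurable_cst.
  by apply: measurable_path; [exact: measurable_fst|exact: measurable_snd].
- apply: measurable_funB; first exact: mrsub.
  exact: (measurableT_comp (mrsub v mw) measurable_deformation).
- by move=> s s01; exact: (@ge0_path_reflect (fun u => T * G u) _ s v mTG TG0 TGb s01).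
Qed.

End displacement_kernel.

Section commutator_kernel.
Variable J : R * R -> R.
Hypotheses (mJ : measurable_fun [set: plane R] J)
  (J1 : forall v, `|J v - 1| <= 2 * g + g ^+ 2).

Let kap := g * r / (1 - g).
Let kap0 : 0 <= kap. Proof. by rewrite divr_ge0 ?mulr_ge0// ltW. Qed.
Let dJ : 0 <= 2 * g + g ^+ 2. Proof. by rewrite addr_ge0 ?sqr_ge0// mulr_ge0. Qed.

(** The first term bounds the variation of the filter over the segment: displacement g r / (1 - g),
    gradient norm sqrt 2 A / r, Jacobian (1 - g)^-2. The second is the bound of |J - 1| times the
    mass of the filter composed with rho. *)
Definition commutator_constant : R :=
  Num.sqrt 2 * g / (1 - g) ^+ 3 + (2 * g + g ^+ 2) / (1 - g) ^+ 2.

Lemma commutator_kernel_measurable : measurable_fun [set: plane R * plane R]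
  (fun z => `|w (((z.2 : R * R) - tau z.2) - ((z.1 : R * R) - tau z.1)) * J z.2 -
    w ((z.2 : R * R) - z.1)|).
Proof.
apply: measurableT_comp => //; apply: measurable_funB; last first.
  apply: (measurableT_comp mw).
  by apply: measurable_plane_sub; [exact: measurable_snd|exact: measurable_fst].
apply: measurable_funM; last exact: (measurableT_comp mJ measurable_snd).
apply: (measurableT_comp mw); apply: measurable_plane_sub.
  exact: (measurableT_comp measurable_deformation measurable_snd).
exact: (measurableT_comp measurable_deformation measurable_fst).
Qed.

(* On the support of G the interpolated displacement has length at most r, and
   the deformation moves it by at most a factor g / (1 - g) of that length. *)
Let segment (u v : R * R) :
  (`|w (rho v - rho u) - w (v - u)|%:E <= \int[lebesgue_measure]_(s in `[0%R, 1%R])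
     (kap * G (deform_path tau s v - deform_path tau s u))%:E)%E.
Proof.
have := cf_segment hw (v - u) (- (tau v - tau u)).
have E s : line (v - u) (- (tau v - tau u)) s = deform_path tau s v - deform_path tau s u.
  by rewrite /line /deform_path; congr pair; rewrite /=; ring.
rewrite !E !deform_path1.
have -> : deform_path tau 0 v - deform_path tau 0 u = v - u.
  by rewrite /deform_path !mul0r !subr0 -!surjective_pairing.
move=> H; apply: (le_trans H).
have mGp : measurable_fun [set: measurableTypeR R]
    (fun s => G (deform_path tau s v - deform_path tau s u)).
  apply: (measurableT_comp mG); apply: measurable_plane_sub.
    by apply: (@measurable_path _ _ id (fun=> v)) => //; exact: measurable_cst.
  by apply: (@measurable_path _ _ id (fun=> u)) => //; exact: measurable_cst.
have mGl : measurable_fun [set: measurableTypeR R] (fun s => G (line (v - u) (- (tau v - tau u)) s)).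
  by rewrite (_ : (fun s => G (line (v - u) (- (tau v - tau u)) s)) = fun s => G (deform_path tau s v - deform_path tau s u));
    [|apply/funext => s; rewrite E].
apply: ge0_le_integral => //.
- by move=> s _; rewrite lee_fin mulr_ge0 ?enorm_ge0// G0.
- by apply/measurable_EFinP; apply: measurable_funTS; apply: measurable_funM => //; exact: measurable_cst.
- by apply/measurable_EFinP; apply: measurable_funTS; apply: measurable_funM => //; exact: measurable_cst.
move=> s /=; rewrite in_itv/= => /andP[s0 s1]; rewrite lee_fin E.
have [rz|zr] := ltP r (enorm (deform_path tau s v - deform_path tau s u)).
  by rewrite (cf_grad_support hw rz) !mulr0.
apply: ler_wpM2r; first exact: G0.
rewrite enormN; have L := deformation_lipschitz htau gE v u.
have : enorm (v - u) <= enorm (deform_path tau s v - deform_path tau s u) + s * enorm (tau v - tau u).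
  rewrite -[X in _ + X * _](ger0_norm s0) -enormZ.
  apply: le_trans (enormD _ _); rewrite le_eqVlt; apply/orP; left; apply/eqP; congr enorm.
  by rewrite /deform_path [LHS]surjective_pairing; congr pair; rewrite /=; ring.
move: L zr; rewrite /kap ler_pdivlMr//.
by move=> L zr H'; exact: (displacement_ratio g0 (enorm_ge0 _) s0 s1 L zr H').
Qed.

Let mkG : measurable_fun [set: plane R] (fun u => kap * G u).
Proof. by apply: measurable_funM => //; exact: measurable_cst. Qed.

Let kG0 u : 0 <= kap * G u. Proof. by rewrite mulr_ge0// G0. Qed.

Let kGb : (\int[leb2]_u (kap * G u)%:E <= (kap * grad_bound)%:E)%E.
Proof.
under eq_integral do rewrite EFinM.
rewrite ge0_integralZl_EFin//; last by move=> u _; rewrite lee_fin G0.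
by rewrite (EFinM kap grad_bound); apply: lee_wpmul2l; [rewrite lee_fin|exact: (cf_grad_L1 hw)].
Qed.

Let cE : commutator_constant * A =
  (1 - g) ^- 2 * (kap * grad_bound) + (2 * g + g ^+ 2) * ((1 - g) ^- 2 * A).
Proof.
by rewrite /commutator_constant /kap /grad_bound; field; rewrite !gt_eqF.
Qed.

Let split_le (k1 k2 k : R * R -> R) (a b : R) : measurable_fun [set: plane R] k ->
  measurable_fun [set: plane R] k1 -> measurable_fun [set: plane R] k2 ->
  (forall u, `|k u| <= `|k1 u| + (2 * g + g ^+ 2) * `|k2 u|) ->
  (\int[leb2]_u `|k1 u|%:E <= a%:E)%E -> (\int[leb2]_u `|k2 u|%:E <= b%:E)%E ->
  (\int[leb2]_u `|k u|%:E <= (a + (2 * g + g ^+ 2) * b)%:E)%E.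
Proof.
move=> mk mk1 mk2 H I1 I2.
have m1 : measurable_fun [set: plane R] (fun u => `|k1 u|%:E : \bar R).
  by apply/measurable_EFinP; exact: measurableT_comp.
have m2 : measurable_fun [set: plane R] (fun u => `|k2 u|%:E : \bar R).
  by apply/measurable_EFinP; exact: measurableT_comp.
have m3 : measurable_fun [set: plane R] (fun u => (2 * g + g ^+ 2)%:E * `|k2 u|%:E)%E.
  by apply: emeasurable_funM => //; exact: measurable_cst.
apply: (@le_trans _ _ (\int[leb2]_u (`|k1 u|%:E + (2 * g + g ^+ 2)%:E * `|k2 u|%:E))%E).
  apply: ge0_le_integral => //.
  - by apply/measurable_EFinP; exact: measurableT_comp.
  - exact: emeasurable_funD.
  - by move=> u _; rewrite -EFinM -EFinD lee_fin.
rewrite ge0_integralD//; last by move=> u _; rewrite -EFinM lee_fin mulr_ge0.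
rewrite (EFinD a); apply: leeD => //.
rewrite ge0_integralZl_EFin// (EFinM (2 * g + g ^+ 2)).
by apply: lee_wpmul2l.
Qed.

Let pointwise u v : `|w (rho v - rho u) * J v - w (v - u)| <=
  `|w (rho v - rho u) - w (v - u)| + (2 * g + g ^+ 2) * `|w (rho v - rho u)|.
Proof.
have -> : w (rho v - rho u) * J v - w (v - u) =
  (w (rho v - rho u) - w (v - u)) + (J v - 1) * w (rho v - rho u) by ring.
by apply: (le_trans (ler_normD _ _)); rewrite lerD2l normrM ler_wpM2r.
Qed.

Let mrs u : measurable_fun [set: plane R] (fun v => w (rho v - rho u)).
Proof. exact: (measurableT_comp (msub (rho u) mw) measurable_deformation). Qed.

Let mrr v : measurable_fun [set: plane R] (fun u => w (rho v - rho u)).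
Proof. exact: (measurableT_comp (mrsub (rho v) mw) measurable_deformation). Qed.

(** Either variable enters the interpolated kernel through [deform_path tau s], so both marginals
    have the same bound, and Schur's test returns it as the norm. *)
Lemma commutator_kernel_snd (u : R * R) :
  (\int[leb2]_v `|w ((v - tau v) - (u - tau u)) * J v - w (v - u)|%:E <=
    (commutator_constant * A)%:E)%E.
Proof.
rewrite cE; apply: (split_le _ _ _ (fun v => pointwise u v)).
- by apply: measurable_funB; [apply: measurable_funM|exact: msub].
- by apply: measurable_funB; [|exact: msub].
- exact: mrs.
- apply: (segment_average_le
    (h := fun z => kap * G (deform_path tau z.1 z.2 - deform_path tau z.1 u))) => //.
  + apply: (measurableT_comp mkG); apply: measurable_plane_sub.
      by apply: measurable_path; [exact: measurable_fst|exact: measurable_snd].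
    by apply: (@measurable_path _ _ _ (fun=> u)); [exact: measurable_fst|exact: measurable_cst].
  + by apply: measurable_funB; [|exact: msub].
  + by move=> s s01; exact: (@ge0_path_shift (fun u => kap * G u) _ s (deform_path tau s u) mkG kG0 kGb s01).
- have := @ge0_path_shift (fun u => `|w u|) A 1 (rho u) mwn _ (cf_L1 hw).
  by under eq_integral do rewrite deform_path1; apply; rewrite // lexx ler01.
Qed.

Lemma commutator_kernel_fst (v : R * R) :
  (\int[leb2]_u `|w ((v - tau v) - (u - tau u)) * J v - w (v - u)|%:E <=
    (commutator_constant * A)%:E)%E.
Proof.
rewrite cE; apply: (split_le _ _ _ (fun u => pointwise u v)).
- apply: measurable_funB; last exact: mrsub.
  by apply: measurable_funM; [|exact: measurable_cst].
- by apply: measurable_funB; [|exact: mrsub].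
- exact: mrr.
- apply: (segment_average_le
    (h := fun z => kap * G (deform_path tau z.1 v - deform_path tau z.1 z.2))) => //.
  + apply: (measurableT_comp mkG); apply: measurable_plane_sub.
      by apply: (@measurable_path _ _ _ (fun=> v)); [exact: measurable_fst|exact: measurable_cst].
    by apply: measurable_path; [exact: measurable_fst|exact: measurable_snd].
  + by apply: measurable_funB; [|exact: mrsub].
  + by move=> s s01; exact: (@ge0_path_reflect (fun u => kap * G u) _ s (deform_path tau s v) mkG kG0 kGb s01).
- have := @ge0_path_reflect (fun u => `|w u|) A 1 (rho v) mwn _ (cf_L1 hw).
  by under eq_integral do rewrite deform_path1; apply; rewrite // lexx ler01.
Qed.

End commutator_kernel.
End kernels.

(** * Layers and networks *)
(** The extra factor 1 / (1 - g) is the norm of D_tau on the signal to which the kernel is applied.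
    With sqrt 2 <= 3/2 and h = 1 - g >= 4/5 it remains to see 3/2 + (3 - h) h <= 8 h^4. *)
Lemma commutator_constant_le (R : realType) (g : R) : 0 <= g -> g < 5^-1 ->
  commutator_constant g * (1 - g)^-1 <= 8 * g.
Proof.
move=> g0 g5; have g1 : 0 < 1 - g by rewrite (lt_le_trans _ (half_sub g5)).
have s2 : Num.sqrt 2 <= 3 / 2 :> R.
  by rewrite -ler_sqr ?nnegrE ?sqrtr_ge0 ?divr_ge0// sqr_sqrtr//; lra.
have h4 : (4 / 5 : R) <= 1 - g.
  have -> : (4 / 5 : R) = 1 - 5^-1 by field.
  by rewrite lerD2l lerN2 ltW.
have -> : commutator_constant g * (1 - g)^-1 =
    g * (Num.sqrt 2 + (2 + g) * (1 - g)) / (1 - g) ^+ 4.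
  by rewrite /commutator_constant; field; rewrite gt_eqF.
rewrite ler_pdivrMr ?exprn_gt0// [8 * g]mulrC -mulrA ler_wpM2l//.
move: (Num.sqrt 2) s2 => s s2.
have -> : 2 + g = 3 - (1 - g) by ring.
move: (1 - g) h4 => h h4.
have h2 : (16 / 25 : R) <= h ^+ 2 by nra.
have h3 : (64 / 125 : R) <= h ^+ 2 * h by nra.
have -> : h ^+ 4 = h ^+ 2 * h * h by ring.
(* Replacing h^3 by its minimum 64/125 leaves a quadratic inequality in h, which at h = 4/5 reads
   3.26 <= 3.2768. *)
have : (64 / 125 : R) * h <= h ^+ 2 * h * h by apply: ler_wpM2r => //; lra.
move: (h ^+ 2 * h * h) => y yh; nra.
Qed.

Section layers.
Context (R : realType) (n m : nat) (sigma : R -> R).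
Variables (W : 'I_n -> 'I_m -> R * R -> R) (b : 'I_m -> R).

Definition filter_sum (x : R * R -> 'I_n -> R) (u : R * R) (l : 'I_m) : R :=
  \sum_(i < n) \int[leb2]_v (W i l v * x (u + v) i).

Definition layer (x : R * R -> 'I_n -> R) (u : R * R) (l : 'I_m) : R :=
  sigma (filter_sum x u l + b l).

Hypotheses (n0 : (0 < n)%N) (m0 : (0 < m)%N)
  (hsigma : forall s t, `|sigma s - sigma t| <= `|s - t|).
Variables (r : R) (wt : 'I_n -> 'I_m -> R) (G : 'I_n -> 'I_m -> R * R -> R).
Hypotheses (r0 : 0 < r) (wt0 : forall i l, 0 <= wt i l)
  (hW : forall i l, controlled_filter r (wt i l) (W i l) (G i l))
  (wt1 : forall l, \sum_(i < n) wt i l <= 1)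
  (wt2 : forall i, \sum_(l < m) wt i l <= m%:R / n%:R).

Let mW i l : measurable_fun [set: plane R] (W i l) := cf_measurable (hW i l).

Lemma nonexpansive_continuous : continuous sigma.
Proof.
move=> s; have /cvgrPdist_le ids : id @ s --> s by exact: cvg_id.
apply/cvgrPdist_le => e e0; apply: filterS (ids e e0) => t.
exact: le_trans (hsigma s t).
Qed.

(** The integrals of the positive and negative parts are measurable in [u] by Tonelli, whether
    finite or not; the real integral is [fine] of their difference. *)
Lemma measurable_layer (x : R * R -> 'I_n -> R) l :
  (forall i, measurable_fun [set: plane R] (x ^~ i)) ->
  measurable_fun [set: plane R] (layer x ^~ l).
Proof.
move=> mx; have ms : measurable_fun [set: R] sigma.
  by apply: continuous_measurable_fun; exact: nonexpansive_continuous.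
apply: (measurableT_comp ms); apply: measurable_funD; last exact: measurable_cst.
apply: measurable_sum => i.
pose f (z : plane R * plane R) := (W i l z.2 * x ((z.1 : R * R) + z.2) i)%:E.
have mf : measurable_fun [set: plane R * plane R] f.
  apply/measurable_EFinP; apply: measurable_funM.
    exact: (measurableT_comp (mW i l) measurable_snd).
  apply: (measurableT_comp (mx i)); apply: measurable_fun_pair; apply: measurable_funD.
  - exact: (measurableT_comp measurable_fst measurable_fst).
  - exact: (measurableT_comp measurable_fst measurable_snd).
  - exact: (measurableT_comp measurable_snd measurable_fst).
  - exact: (measurableT_comp measurable_snd measurable_snd).
have -> : (fun u => \int[leb2]_v (W i l v * x (u + v) i)) =
    fine \o (fun u => (\int[leb2]_v (f^\+ (u, v)) - \int[leb2]_v (f^\- (u, v))))%E.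
  apply/funext => u; rewrite /= /Rintegral integralE; congr (fine (_ - _)).
    by apply: eq_integral => v _; rewrite !funeposE.
  by apply: eq_integral => v _; rewrite !funenegE.
apply: measurableT_comp; first exact: fine_measurable.
apply: emeasurable_funB; apply: measurable_integral_leb2.
- exact: measurable_funepos.
- by move=> z; exact: funepos_ge0.
- exact: measurable_funeneg.
- by move=> z; exact: funeneg_ge0.
Qed.

Lemma energy_channel (x : R * R -> 'I_n -> R) (e : R) i : (energy x <= e%:E)%E ->
  (\int[leb2]_u (x u i ^+ 2)%:E < +oo)%E.
Proof.
move=> Ex; have I0 j : (0 <= \int[leb2]_u (x u j ^+ 2)%:E)%E.
  by apply: integral_ge0 => u _; rewrite lee_fin sqr_ge0.
rewrite ltey; apply/eqP => H; move: Ex.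
rewrite /energy (bigD1 i)//= H addye; last first.
  by rewrite -ltNye (lt_le_trans ltNy0)//; exact: sume_ge0.
by rewrite gt0_muley ?lte_fin ?invr_gt0 ?ltr0n// leye_eq.
Qed.

Section response.
Variables (c : 'I_n -> R) (x : R * R -> 'I_n -> R) (e : R).
Hypotheses (mx : forall i, measurable_fun [set: plane R] (x ^~ i))
  (Ex : (energy (fun u i => (x u i - c i)%R) <= e%:E)%E).

Let mxc i : measurable_fun [set: plane R] (fun u => x u i - c i).
Proof. by apply: measurable_funB => //; exact: measurable_cst. Qed.

Let xc i : (\int[leb2]_u ((x u i - c i) ^+ 2)%:E < +oo)%E.
Proof. exact: (energy_channel i Ex). Qed.

Lemma response_integrable u i l :
  leb2.-integrable [set: plane R] (fun v => (W i l (v - u) * (x v i - c i))%:E).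
Proof.
exact: (convolution_integrable (mW i l) (mxc i) (cf_bounded (hW i l)) (cf_L1 (hW i l)) (xc i)).
Qed.

(** The constant part gives a number depending neither on [u] nor on [x]; the rest is a translation
    kernel acting on an L^2 function. In this form responses at different points, or to different
    signals, can be subtracted. *)
Lemma filter_sumE u l : filter_sum x u l = \sum_(i < n)
  (\int[leb2]_v (W i l v * c i) + \int[leb2]_v (W i l (v - u) * (x v i - c i))).
Proof.
apply: eq_bigr => i _.
rewrite -(@convolution_shift _ (W i l) (fun v => x v i - c i) (mW i l) (mxc i)).
have iW : leb2.-integrable [set: plane R] (fun v => (W i l v)%:E).
  apply/integrableP; split; first exact/measurable_EFinP.
  by apply: le_lt_trans (cf_L1 (hW i l)) _; exact: ltry.
have iWc : leb2.-integrable [set: plane R] (fun v => (W i l v * c i)%:E).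
  by under eq_fun do rewrite mulrC EFinM; exact: integrableZl.
rewrite -RintegralD//.
  by apply: eq_Rintegral => v _; rewrite -mulrDr [c i + _]addrC subrK.
exact: (convolution_shift_integrable (mW i l) (mxc i) (cf_bounded (hW i l)) (cf_L1 (hW i l)) (xc i)).
Qed.

End response.

Let layer_dist (x y : R * R -> 'I_n -> R) u u' l :
  `|layer x u l - layer y u' l| <= `|filter_sum x u l - filter_sum y u' l|.
Proof. by apply: (le_trans (hsigma _ _)); rewrite opprD addrACA subrr addr0. Qed.

(** Common to the three estimates of a layer. The integrands stay abstract because the commutator
    uses one that has undergone a change of variables. *)
Let filter_sum_dist (c : 'I_n -> R) (x y : R * R -> 'I_n -> R) u u' l
    (f h : 'I_n -> R * R -> R) :
  filter_sum x u l = \sum_(i < n) (\int[leb2]_v (W i l v * c i) + \int[leb2]_v f i v) ->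
  filter_sum y u' l = \sum_(i < n) (\int[leb2]_v (W i l v * c i) + \int[leb2]_v h i v) ->
  (forall i, leb2.-integrable [set: plane R] (fun v => (f i v)%:E)) ->
  (forall i, leb2.-integrable [set: plane R] (fun v => (h i v)%:E)) ->
  (`|layer x u l - layer y u' l|%:E <= \sum_(i < n) \int[leb2]_v `|f i v - h i v|%:E)%E.
Proof.
move=> fE hE fi hi.
apply: (@le_trans _ _ (`|filter_sum x u l - filter_sum y u' l|%:E)%E).
  by rewrite lee_fin; exact: layer_dist.
rewrite fE hE -sumrB.
apply: (@le_trans _ _ (\sum_(i < n) `|\int[leb2]_v f i v - \int[leb2]_v h i v|%:E)%E).
  rewrite sumEFin lee_fin; apply: (le_trans (ler_norm_sum _ _ _)).
  by apply: ler_sum => i _; rewrite opprD addrACA subrr add0r.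
by apply: lee_sum => i _; exact: Rintegral_dist_le.
Qed.

Lemma layer_nonexpansive (c : 'I_n -> R) (x y : R * R -> 'I_n -> R) (e e' d : R) :
  (forall i, measurable_fun [set: plane R] (x ^~ i)) ->
  (forall i, measurable_fun [set: plane R] (y ^~ i)) ->
  (energy (fun u i => (x u i - c i)%R) <= e%:E)%E ->
  (energy (fun u i => (y u i - c i)%R) <= e'%:E)%E ->
  (energy (fun u i => (x u i - y u i)%R) <= (d ^+ 2)%:E)%E ->
  (energy (fun u l => (layer x u l - layer y u l)%R) <= (d ^+ 2)%:E)%E.
Proof.
move=> mx my Ex Ey Exy; rewrite -[d in leRHS]mul1r.
apply: (@schur_bound _ n m (fun i l u v => `|W i l (v - u)|) wt n0 m0 _ _ wt0 wt1 wt2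
  (fun u i => x u i - y u i) _ _ _ _ 1 1 1 d) => //.
- by move=> i l; exact: (translation_kernel_measurable (hW i l)).
- by move=> i; exact: measurable_funB.
- by move=> l; apply: measurable_funB; exact: measurable_layer.
- move=> u l; apply: (le_trans (filter_sum_dist (filter_sumE mx Ex u l) (filter_sumE my Ey u l) _ _)).
  + by move=> i; exact: (response_integrable mx Ex).
  + by move=> i; exact: (response_integrable my Ey).
  apply: lee_sum => i _; rewrite le_eqVlt; apply/orP; left; apply/eqP.
  by apply: eq_integral => v _; rewrite -mulrBr normrM opprB addrA subrK.
- by move=> i l u; rewrite mul1r; exact: (translation_kernel_snd (hW i l)).
- by move=> i l v; rewrite mul1r; exact: (translation_kernel_fst (hW i l)).
Qed.

Section deformed.
Variables (tau : R * R -> R * R) (g : R).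
Hypotheses (htau : is_Ck 1 tau) (gE : grad_sup tau = g%:E) (g5 : g < 5^-1).

Let g0 : 0 <= g. Proof. by rewrite -lee_fin -gE grad_sup_ge0. Qed.
Let g1 : 0 < 1 - g. Proof. by rewrite (lt_le_trans _ (half_sub g5)). Qed.

Let md : measurable_fun [set: plane R] ((fun u => u - tau u) : plane R -> plane R) :=
  measurable_deformation htau.

Lemma measurable_deform k (x : R * R -> 'I_k -> R) i : measurable_fun [set: plane R] (x ^~ i) ->
  measurable_fun [set: plane R] (deform tau x ^~ i).
Proof. by move=> mx; exact: (measurableT_comp mx md). Qed.

Lemma energy_deform k (x : R * R -> 'I_k -> R) (e : R) :
  (forall i, measurable_fun [set: plane R] (x ^~ i)) ->
  (energy x <= (e ^+ 2)%:E)%E -> (energy (deform tau x) <= (((1 - g)^-1 * e) ^+ 2)%:E)%E.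
Proof.
move=> mx Ex; rewrite exprMn exprVn.
apply: (@le_trans _ _ (((1 - g) ^- 2)%:E * energy x)%E); last first.
  by rewrite (EFinM ((1 - g) ^- 2)); apply: lee_wpmul2l => //; rewrite lee_fin invr_ge0 exprn_ge0// ltW.
rewrite /energy muleCA; apply: lee_wpmul2l; first by rewrite lee_fin invr_ge0.
rewrite ge0_sume_distrr; last first.
  by move=> i _; apply: integral_ge0 => u _; rewrite lee_fin sqr_ge0.
apply: lee_sum => i _.
have := deform_path_integral_le htau gE g5 (t := 1) (f := fun u => (x u i ^+ 2)%:E).
under eq_integral do rewrite deform_path1; apply.
- by rewrite lexx ler01.
- by apply/measurable_EFinP; exact: measurable_funX.
- by move=> u; rewrite lee_fin sqr_ge0.
Qed.

(** Substituting rho(v) for v in the deformed output makes it, like the response to the deformed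
    input, an integral against D_tau (x - c). The difference of the two kernels then acts on a
    signal of norm at most e / (1 - g). *)
Lemma layer_commutator (c : 'I_n -> R) (x : R * R -> 'I_n -> R) (e : R) : 0 <= e ->
  (forall i, measurable_fun [set: plane R] (x ^~ i)) ->
  (energy (fun u i => (x u i - c i)%R) <= (e ^+ 2)%:E)%E ->
  (energy (fun u l => (deform tau (layer x) u l - layer (deform tau x) u l)%R) <=
    ((8 * g * e) ^+ 2)%:E)%E.
Proof.
move=> e0 mx Ex.
have Exd := energy_deform (x := fun u i => x u i - c i) _ Ex.
have {}Exd : (energy (deform tau (fun u i => (x u i - c i)%R)) <= (((1 - g)^-1 * e) ^+ 2)%:E)%E.
  by apply: Exd => i; apply: measurable_funB => //; exact: measurable_cst.
have mxd i : measurable_fun [set: plane R] (deform tau x ^~ i) by exact: measurable_deform.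
have [|J [cJ J0 J1 HJ]] := @deformation_change_of_variables _ _ _ htau gE g5 1.
  by rewrite ler01 lexx.
have mJ : measurable_fun [set: plane R] J by exact: continuous_measurable_prod.
have {}J0 v : 0 <= J v by apply: le_trans (J0 v); rewrite sqr_ge0.
have {}J1 := J1 erefl.
have cc0 : 0 <= commutator_constant g.
  have h0 := ltW g1; apply: addr_ge0; apply: divr_ge0; rewrite ?exprn_ge0//.
    by rewrite mulr_ge0// sqrtr_ge0.
  by rewrite addr_ge0 ?sqr_ge0// mulr_ge0.
apply: (@le_trans _ _ ((commutator_constant g * ((1 - g)^-1 * e)) ^+ 2)%:E); last first.
  rewrite lee_fin ler_sqr ?nnegrE ?mulr_ge0 ?invr_ge0 ?(ltW g1)//.
  by rewrite mulrA ler_wpM2r// commutator_constant_le.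
apply: (@schur_bound _ n m (fun i l u v =>
  `|W i l ((v - tau v) - (u - tau u)) * J v - W i l (v - u)|) wt n0 m0 _ _ wt0 wt1 wt2
  (deform tau (fun u i => x u i - c i)) _ _ _ _ (commutator_constant g) (commutator_constant g)) => //.
- by move=> i l; exact: (commutator_kernel_measurable htau (hW i l)).
- by move=> i; apply: measurable_deform; apply: measurable_funB => //; exact: measurable_cst.
- move=> l; apply: measurable_funB; last exact: measurable_layer.
  by apply: measurable_deform; exact: measurable_layer.
- move=> u l.
  have HJ' (f : R * R -> \bar R) : measurable_fun [set: plane R] f ->
      (forall u, 0 <= f u)%E -> (\int[leb2]_u (f (u - tau u)%R * (J u)%:E) = \int[leb2]_u f u)%E.
    by move=> mf f0; rewrite -[RHS]HJ//; under [RHS]eq_integral do rewrite deform_path1.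
  have fi := response_integrable mx Ex (u - tau u).
  have mf i : measurable_fun [set: plane R] (fun v => W i l (v - (u - tau u)) * (x v i - c i)).
    by have /integrableP[/measurable_EFinP] := fi i l.
  have fE : filter_sum x (u - tau u) l = \sum_(i < n) (\int[leb2]_v (W i l v * c i) +
      \int[leb2]_v (W i l ((v - tau v) - (u - tau u)) * (x (v - tau v) i - c i) * J v)).
    rewrite (filter_sumE mx Ex); apply: eq_bigr => i _; congr (_ + _).
    by rewrite /Rintegral; congr fine; exact/esym/(change_of_variables_integral J0 HJ' (mf i)).
  apply: (le_trans (filter_sum_dist fE (filter_sumE mxd Exd u l) _ _)).
  + move=> i; exact: (change_of_variables_integrable md mJ J0 HJ' (fi i l)).
  + by move=> i; exact: (response_integrable mxd Exd).
  apply: lee_sum => i _; rewrite le_eqVlt; apply/orP; left; apply/eqP.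
  apply: eq_integral => v _; congr (_%:E).
  by rewrite -normrM /deform; congr (`|_|); ring.
- by move=> i l u; exact: (commutator_kernel_snd htau gE g5 r0 (hW i l)).
- by move=> i l v; exact: (commutator_kernel_fst htau gE g5 r0 (hW i l)).
Qed.

Lemma layer_displacement (T : R) (c : 'I_n -> R) (x : R * R -> 'I_n -> R) (e : R) :
  0 <= e -> (forall u, enorm (tau u) <= T) ->
  (forall i, measurable_fun [set: plane R] (x ^~ i)) ->
  (energy (fun u i => (x u i - c i)%R) <= (e ^+ 2)%:E)%E ->
  (energy (fun u l => (layer x u l - deform tau (layer x) u l)%R) <=
    ((2 * T / r * e) ^+ 2)%:E)%E.
Proof.
move=> e0 hT mx Ex.
have T0 : 0 <= T by apply: le_trans (hT 0); exact: enorm_ge0.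
pose p := T * Num.sqrt 2 / r.
have p0 : 0 <= p by rewrite divr_ge0 ?mulr_ge0 ?sqrtr_ge0// ltW.
apply: (@schur_bound _ n m (fun i l u v => `|W i l (v - u) - W i l (v - (u - tau u))|)
  wt n0 m0 _ _ wt0 wt1 wt2 (fun u i => x u i - c i) _ _ _ _ p ((1 - g) ^- 2 * p)) => //.
- by move=> i l; exact: (displacement_kernel_measurable htau (hW i l)).
- by move=> i; apply: measurable_funB => //; exact: measurable_cst.
- move=> l; apply: measurable_funB; first exact: measurable_layer.
  by apply: measurable_deform; exact: measurable_layer.
- move=> u l; apply: (le_trans (filter_sum_dist (filter_sumE mx Ex u l)
    (filter_sumE mx Ex (u - tau u) l) _ _)).
  + by move=> i; exact: (response_integrable mx Ex).
  + by move=> i; exact: (response_integrable mx Ex).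
  apply: lee_sum => i _; rewrite le_eqVlt; apply/orP; left; apply/eqP.
  by apply: eq_integral => v _; rewrite -mulrBl normrM.
- by rewrite mulr_ge0// invr_ge0 exprn_ge0// ltW.
(* The square of the constant 2: since 1 - g >= 4/5, 2 / (1 - g)^2 <= 25/8 <= 4. *)
- have -> : p * ((1 - g) ^- 2 * p) = (T / r) ^+ 2 * (2 / (1 - g) ^+ 2).
    transitivity ((T / r) ^+ 2 * (Num.sqrt 2 ^+ 2 / (1 - g) ^+ 2)); last by rewrite sqr_sqrtr.
    by rewrite /p; field; rewrite !gt_eqF.
  have -> : (2 * T / r) ^+ 2 = (T / r) ^+ 2 * 4 by ring.
  rewrite ler_wpM2l ?sqr_ge0// ler_pdivrMr ?exprn_gt0//.
  have h4 : (4 / 5 : R) <= 1 - g.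
    have -> : (4 / 5 : R) = 1 - 5^-1 by field.
    by rewrite lerD2l lerN2 ltW.
  move: (1 - g) h4 => h h4; nra.
- by move=> i l u; exact: (displacement_kernel_snd htau (hW i l) hT).
- by move=> i l v; exact: (displacement_kernel_fst htau gE g5 (hW i l) hT).
Qed.

End deformed.
End layers.

(** An infinite norm would make the first supremum infinite, so all norms are finite. In the second
    bound the ratio of channel numbers moves to the right-hand side, where Schur's test expects
    it. *)
Lemma FB_weights (R : realType) (B : FB_basis R) (M : nat -> nat)
    (a : forall l, 'I_(M l.-1) -> 'I_(M l) -> nat -> R) (l : nat) :
  (A_const B a l <= 1)%E ->
  [/\ forall i k, FB_norm B (a l i k) = (fine (FB_norm B (a l i k)))%:E,
      forall k, \sum_(i < M l.-1) pi * fine (FB_norm B (a l i k)) <= 1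
    & (0 < M l.-1)%N -> (0 < M l)%N ->
      forall i, \sum_(k < M l) pi * fine (FB_norm B (a l i k)) <= (M l)%:R / (M l.-1)%:R].
Proof.
rewrite /A_const; set S1 := ereal_sup _; set S2 := ereal_sup _ => hA.
have p0 : (0 < (pi : R)%:E)%E by rewrite lte_fin pi_gt0.
have h1 : (pi%:E * S1 <= 1)%E.
  by apply: le_trans hA; rewrite lee_pmul2l// le_max lexx.
have h2 : (pi%:E * S2 <= 1)%E.
  by apply: le_trans hA; rewrite lee_pmul2l// le_max lexx orbT.
have F0 i k : (0 <= FB_norm B (a l i k))%E by exact: poweR_ge0.
have H1 k : (pi%:E * \sum_(i < M l.-1) FB_norm B (a l i k) <= 1)%E.
  by apply: le_trans h1; rewrite lee_pmul2l//; apply: ereal_sup_ubound; exists k.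
have fin i k : FB_norm B (a l i k) = (fine (FB_norm B (a l i k)))%:E.
  rewrite fineK// ge0_fin_numE// ltey; apply/eqP => H; move: (H1 k).
  rewrite (bigD1 i)//= H addye ?gt0_muley//.
  by rewrite -ltNye (lt_le_trans ltNy0)//; exact: sume_ge0.
split => //.
- move=> k; have := H1 k; under eq_bigr do rewrite fin.
  by rewrite sumEFin -EFinM lee_fin mulr_sumr.
- move=> n0 m0 i.
  have : (pi%:E * (((M l.-1)%:R / (M l)%:R)%:E * \sum_(k < M l) FB_norm B (a l i k)) <= 1)%E.
    by apply: le_trans h2; rewrite lee_pmul2l//; apply: ereal_sup_ubound; exists i.
  under eq_bigr do rewrite fin.
  rewrite sumEFin -!EFinM lee_fin -mulr_sumr mulrCA mulrAC ler_pdivrMr ?ltr0n// mul1r.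
  by rewrite ler_pdivlMr ?ltr0n// mulrC.
Qed.

Lemma signal_normE (R : realType) (J : R) (m : nat) (x : R * R -> 'I_m -> R) :
  signal_norm J x = poweR (((Omega_area J)^-1)%:E * energy x)%E 2^-1.
Proof.
rewrite /signal_norm /energy [in RHS]muleCA; congr (poweR (_ * _)%E _).
rewrite ge0_sume_distrr; last first.
  by move=> l _; apply: integral_ge0 => u _; rewrite lee_fin sqr_ge0.
apply: eq_bigr => l _; congr (_ * _)%E; apply: eq_integral => u _.
by rewrite real_normK ?num_real.
Qed.

Section signal_norm.
Context (R : realType) (J : R) (m : nat) (x : R * R -> 'I_m -> R).

Let Ai0 : 0 <= (Omega_area J)^-1. Proof. by rewrite invr_ge0 sqr_ge0. Qed.

Lemma signal_norm_le (e : R) : 0 <= e -> (energy x <= (e ^+ 2)%:E)%E ->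
  (signal_norm J x <= (Num.sqrt (Omega_area J)^-1 * e)%:E)%E.
Proof.
move=> e0 Ex; rewrite signal_normE.
have -> : (Num.sqrt (Omega_area J)^-1 * e)%:E =
    poweR (((Omega_area J)^-1)%:E * (e ^+ 2)%:E)%E 2^-1.
  rewrite -EFinM poweR_EFin powR12_sqrt ?mulr_ge0 ?sqr_ge0//.
  by rewrite sqrtrM// sqrtr_sqr ger0_norm.
have I0 : (0 <= ((Omega_area J)^-1)%:E * energy x)%E.
  by rewrite mule_ge0 ?lee_fin ?energy_ge0.
apply: gt0_ler_poweR => //.
- by rewrite in_itv/= I0 leey.
- by rewrite in_itv/= leey andbT -EFinM lee_fin mulr_ge0// sqr_ge0.
- by apply: lee_wpmul2l.
Qed.

Lemma signal_norm_sqr (e : R) : 0 <= e -> energy x = (e ^+ 2)%:E ->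
  signal_norm J x = (Num.sqrt (Omega_area J)^-1 * e)%:E.
Proof.
move=> e0 Ex; rewrite signal_normE Ex -EFinM poweR_EFin powR12_sqrt ?mulr_ge0 ?sqr_ge0//.
by rewrite sqrtrM// sqrtr_sqr ger0_norm.
Qed.

End signal_norm.

Lemma is_Ck2_is_Ck1 (R : realType) (tau : R * R -> R * R) : is_Ck 2 tau -> is_Ck 1 tau.
Proof.
move=> [d c1 c2]; split; [exact: d|exact: (deformation_continuous c1)|exact: (deformation_continuous c2)].
Qed.

Lemma energy_cst0 (R : realType) (m : nat) : energy (fun (_ : R * R) (_ : 'I_m) => 0) = 0%E :> \bar R.
Proof.
rewrite /energy big1 ?mule0// => l _.
by under eq_integral do rewrite expr0n/=; rewrite integral0.
Qed.

Section network.
Context (R : realType) (B : FB_basis R) (L : nat) (J : R) (j : nat -> R) (M : nat -> nat)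
  (sigma : R -> R).
Variables (W : forall l, 'I_(M l.-1) -> 'I_(M l) -> R * R -> R)
  (a : forall l, 'I_(M l.-1) -> 'I_(M l) -> nat -> R) (b : forall l, 'I_(M l) -> R)
  (x0 : R * R -> 'I_(M 0%N) -> R) (tau : R * R -> R * R) (g e : R).
Hypotheses (hnet : is_DCFNet B L J j W a) (htau : is_Ck 1 tau)
  (gE : grad_sup tau = g%:E) (g5 : g < 5^-1)
  (hsigma : forall s t, `|sigma s - sigma t| <= `|s - t|)
  (hA : forall l, (1 <= l <= L)%N -> (A_const B a l <= 1)%E)
  (mx0 : forall i, measurable_fun [set: plane R] (x0 ^~ i))
  (e0 : 0 <= e) (Ex0 : energy x0 = (e ^+ 2)%:E).

Let g0 : 0 <= g. Proof. by rewrite -lee_fin -gE grad_sup_ge0. Qed.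
Let g1 : 0 < 1 - g. Proof. by rewrite (lt_le_trans _ (half_sub g5)). Qed.

Let Y := cnn sigma W b x0.
Let Z := cnn sigma W b (deform tau x0).
Arguments Y : clear implicits.
Arguments Z : clear implicits.

Let layer_control l : (l < L)%N -> exists (wt : 'I_(M l) -> 'I_(M l.+1) -> R) G,
  [/\ forall i k, controlled_filter (2 `^ j l.+1) (wt i k) (@W l.+1 i k) (G i k),
      forall i k, 0 <= wt i k, forall k, \sum_(i < M l) wt i k <= 1
    & forall i, \sum_(k < M l.+1) wt i k <= (M l.+1)%:R / (M l)%:R].
Proof.
move=> lL; have [hM _ _ hF] := hnet.
have [F1 F2 F3] := FB_weights (hA (l := l.+1) lL).
exists (fun i k => pi * fine (FB_norm B (@a l.+1 i k))).
pose G (i : 'I_(M l)) k := projT1 (cid (FB_filter_controlled (hF l.+1 lL i k) (F1 i k))).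
exists G; split => //.
- by move=> i k; exact: (projT2 (cid (FB_filter_controlled (hF l.+1 lL i k) (F1 i k)))).
- by move=> i k; rewrite mulr_ge0 ?pi_ge0//; have [] := FB_normE (F1 i k).
- by apply: F3; apply: hM => //; exact: ltnW.
Qed.

Let K := (1 - g)^-1 * e.

Let energy_cst k (c : 'I_k -> R) : energy (fun (_ : R * R) i => (c i - c i)%R) = 0%E :> \bar R.
Proof.
by rewrite -[RHS](energy_cst0 R k); congr energy; apply/funext => u; apply/funext => i; rewrite subrr.
Qed.

Let deformed_energy k (x : R * R -> 'I_k -> R) (c : 'I_k -> R) :
  (forall i, measurable_fun [set: plane R] (x ^~ i)) ->
  (energy (fun u i => (x u i - c i)%R) <= (e ^+ 2)%:E)%E ->
  (energy (fun u i => (deform tau x u i - c i)%R) <= (K ^+ 2)%:E)%E.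
Proof.
move=> mx Ex; apply: (energy_deform htau gE g5 (x := fun u i => x u i - c i) _ Ex).
by move=> i; apply: measurable_funB => //; exact: measurable_cst.
Qed.

(* The constant signals c are the outputs of the network for the zero input. *)
Lemma network_invariant l : (l <= L)%N ->
  [/\ forall i, measurable_fun [set: plane R] (fun u => Y l u i),
      forall i, measurable_fun [set: plane R] (fun u => Z l u i),
      exists2 c : 'I_(M l) -> R, (energy (fun u i => (Y l u i - c i)%R) <= (e ^+ 2)%:E)%E &
        (energy (fun u i => (Z l u i - c i)%R) <= (K ^+ 2)%:E)%E
    & (energy (fun u i => (deform tau (Y l) u i - Z l u i)%R) <=
        ((l%:R * (8 * g * e)) ^+ 2)%:E)%E].
Proof.
elim: l => [_|l IH lL].
  have E0 : (energy (fun u i => (x0 u i - 0)%R) <= (e ^+ 2)%:E)%E.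
    by rewrite -Ex0 le_eqVlt; apply/orP; left; apply/eqP; congr energy;
      apply/funext => u; apply/funext => i; rewrite subr0.
  split; [exact: mx0|by move=> i; exact: (measurable_deform htau)| |].
    by exists (fun=> 0) => //; exact: deformed_energy.
  rewrite mul0r expr0n/= (_ : (fun u i => _) = fun _ _ => 0) ?energy_cst0//.
  by apply/funext => u; apply/funext => i; rewrite subrr.
have [mY mZ [c Yc Zc] YZ] := IH (ltnW lL).
have [hM _ _ _] := hnet.
have n0 : (0 < M l)%N by apply: hM; exact: ltnW.
have m0 : (0 < M l.+1)%N by exact: hM.
have [wt [G [hW wt0 wt1 wt2]]] := layer_control lL.
have r0 : 0 < 2 `^ j l.+1 :> R by exact: powR_gt0.
have mc (i : 'I_(M l)) : measurable_fun [set: plane R] (fun _ : R * R => c i).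
  exact: measurable_cst.
have cc (d : R) : (energy (fun (_ : R * R) i => (c i - c i)%R) <= (d ^+ 2)%:E)%E.
  by rewrite energy_cst lee_fin sqr_ge0.
have mdY i : measurable_fun [set: plane R] (deform tau (Y l) ^~ i).
  exact: (measurable_deform htau).
pose lay := layer sigma (@W l.+1) (@b l.+1).
have mlay (x : R * R -> 'I_(M l) -> R) k : (forall i, measurable_fun [set: plane R] (x ^~ i)) ->
    measurable_fun [set: plane R] (lay x ^~ k).
  by move=> mx; exact: (measurable_layer (@b l.+1) hsigma hW).
split.
- by move=> k; exact: (mlay (Y l)).
- by move=> k; exact: (mlay (Z l)).
- exists (fun k => lay (fun _ i => c i) (0, 0) k).
    exact: (layer_nonexpansive (@b l.+1) n0 m0 hsigma wt0 hW wt1 wt2 mY mc Yc (cc 0) Yc).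
  exact: (layer_nonexpansive (@b l.+1) n0 m0 hsigma wt0 hW wt1 wt2 mZ mc Zc (cc 0) Zc).
- rewrite -natr1 mulrDl mul1r addrC.
  have e8 : 0 <= 8 * g * e by rewrite !mulr_ge0.
  (* Through the layer applied to the deformed signal: the first difference is the new commutator,
     the second is the previous error, which the layer does not increase. *)
  apply: (@energy_triangle _ _ (deform tau (lay (Y l))) (lay (deform tau (Y l))) (lay (Z l))) => //.
  + by move=> k; apply: (measurable_deform htau); exact: mlay.
  + by move=> k; exact: mlay.
  + by move=> k; exact: mlay.
  + by rewrite mulr_ge0.
  + exact: (layer_commutator (@b l.+1) n0 m0 hsigma r0 wt0 hW wt1 wt2 htau gE g5 e0 mY Yc).
  + exact: (layer_nonexpansive (@b l.+1) n0 m0 hsigma wt0 hW wt1 wt2 mdY mZ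
      (deformed_energy mY Yc) Zc YZ).
Qed.

Lemma network_stability (T : R) : (0 < L)%N -> (forall u, enorm (tau u) <= T) ->
  (energy (fun u i => (Y L u i - Z L u i)%R) <=
    ((2 * T / 2 `^ j L * e + L%:R * (8 * g * e)) ^+ 2)%:E)%E.
Proof.
move: hnet hA network_invariant layer_control.
case: L => // l hnet' _ inv ctrl _ hT.
have [mY mZ _ YZ] := inv l.+1 (leqnn _).
have [mY' _ [c Yc _] _] := inv l (leqnSn _).
have [hM _ _ _] := hnet'.
have n0 : (0 < M l)%N by exact: hM.
have m0 : (0 < M l.+1)%N by exact: hM.
have [wt [G [hW wt0 wt1 wt2]]] := ctrl l (ltnSn _).
have r0 : 0 < 2 `^ j l.+1 :> R by exact: powR_gt0.
have T0 : 0 <= T by apply: le_trans (hT (0, 0)); exact: enorm_ge0.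
apply: (@energy_triangle _ _ _ (deform tau (Y l.+1)) _) => //.
- by move=> k; exact: (measurable_deform htau).
- by rewrite mulr_ge0// divr_ge0 ?mulr_ge0// ltW.
- by rewrite !mulr_ge0.
- exact: (layer_displacement (@b l.+1) n0 m0 hsigma r0 wt0 hW wt1 wt2 htau gE g5 e0 hT mY' Yc).
Qed.

(** Isolated because it must not depend on a bound of tau: for an input of norm 0 both outputs are
    at distance 0 from the same constants. *)
Lemma network_zero : e = 0 -> energy (fun u i => (Y L u i - Z L u i)%R) = 0%E.
Proof.
move=> ee; have [mY mZ [c Yc Zc] _] := network_invariant (leqnn L).
apply/eqP; rewrite eq_le energy_ge0 andbT.
rewrite /K ee mulr0 in Zc; rewrite ee in Yc.
rewrite (_ : 0%E = ((0 + 0 : R) ^+ 2)%:E); last by rewrite addr0 expr0n.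
apply: (@energy_triangle _ _ _ (fun _ i => c i)) => //.
rewrite (_ : energy _ = energy (fun u i => (Z L u i - c i)%R))//.
congr (_ * _)%E; apply: eq_bigr => i _; apply: eq_integral => u _.
by rewrite -sqrrN opprB.
Qed.

End network.

Theorem theorem3p8 (R : realType) (B : FB_basis R)
    (L : nat) (J : R) (j : nat -> R) (M : nat -> nat)
    (sigma : R -> R)
    (W : forall l, 'I_(M l.-1) -> 'I_(M l) -> R * R -> R)
    (a : forall l, 'I_(M l.-1) -> 'I_(M l) -> nat -> R)
    (b : forall l, 'I_(M l) -> R)
    (x0 : R * R -> 'I_(M 0%N) -> R)
    (tau : R * R -> R * R)
    (hL : (0 < L)%N)
    (hnet : is_DCFNet B L J j W a)
    (hx0 : is_input J x0)
    (htau : is_Ck 2 tau)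
    (hgrad : (grad_sup tau < (5^-1 : R)%:E)%E)
    (hsigma : forall s t, `|sigma s - sigma t| <= `|s - t|)
    (hA : forall l, (1 <= l <= L)%N -> (A_const B a l <= 1)%E) :
  (signal_norm J (fun u lam => (cnn sigma W b x0 L u lam -
                               cnn sigma W b (deform tau x0) L u lam)%R)
   <= ((8 * L%:R)%:E * grad_sup tau + (2 * 2 `^ (- j L))%:E * sup_norm tau)
      * signal_norm J x0)%E.
Proof.
have htau1 := is_Ck2_is_Ck1 htau.
have gE : grad_sup tau = (fine (grad_sup tau))%:E.
  by rewrite fineK// ge0_fin_numE ?grad_sup_ge0// (lt_trans hgrad)// ltry.
move: (fine (grad_sup tau)) gE => g gE; rewrite gE lte_fin in hgrad *.
have g0 : 0 <= g by rewrite -lee_fin -gE grad_sup_ge0.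
have mx0 i : measurable_fun [set: plane R] (x0 ^~ i) by have [] := hx0 i.
have Efin : energy x0 \is a fin_num.
  rewrite fin_numM//; apply/sum_fin_numP => i _ _; apply: integrable_fin_num => //.
  by have [] := hx0 i.
pose e := Num.sqrt (fine (energy x0)).
have e0 : 0 <= e by exact: sqrtr_ge0.
have Ex0 : energy x0 = (e ^+ 2)%:E.
  by rewrite sqr_sqrtr ?fineK// fine_ge0// energy_ge0.
rewrite (signal_norm_sqr J e0 Ex0); set s := Num.sqrt _.
have S0 : (0 <= sup_norm tau)%E.
  apply: (@le_trans _ _ (enorm (tau 0))%:E); first by rewrite lee_fin enorm_ge0.
  by apply: ereal_sup_ubound; exists 0.
(* If the input norm is 0, the right-hand side is 0 even for unbounded tau, since +oo * 0 = 0, and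
   the left-hand side must vanish exactly. *)
have [ez|ez] := eqVneq e 0.
  have Z0 := network_zero b hnet htau1 gE hgrad hsigma hA mx0 e0 Ex0 ez.
  apply: (@le_trans _ _ 0%E).
    have := @signal_norm_le _ J _ _ 0 (lexx _) (_ : (energy (fun u lam => (cnn sigma W b x0 L u lam -
      cnn sigma W b (deform tau x0) L u lam)%R) <= (0 ^+ 2)%:E)%E).
    by rewrite mulr0; apply; rewrite Z0 expr0n.
  by rewrite ez mulr0 mule0.
have ep : 0 < e by rewrite lt_neqAle eq_sym ez.
have sp : 0 < s by rewrite sqrtr_gt0 invr_gt0 exprn_gt0// mulr_gt0// powR_gt0.
(* For unbounded tau and a nonzero input the right-hand side is +oo. *)
have [Soo|Soo] := eqVneq (sup_norm tau) +oo%E.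
  rewrite Soo gt0_muley ?lte_fin ?mulr_gt0// addey// gt0_mulye ?leey// lte_fin.
  exact: mulr_gt0.
have Sfin : sup_norm tau \is a fin_num by rewrite ge0_fin_numE// ltey.
pose T := fine (sup_norm tau).
have TE : sup_norm tau = T%:E by rewrite fineK.
have hT u : enorm (tau u) <= T.
  by rewrite -lee_fin -TE; apply: ereal_sup_ubound; exists u.
have T0 : 0 <= T by apply: le_trans (hT 0); exact: enorm_ge0.
have := network_stability b hnet htau1 gE hgrad hsigma hA mx0 e0 Ex0 hL hT.
move/(signal_norm_le J) => H; apply: (le_trans (H _)).
  by rewrite addr_ge0 ?mulr_ge0 ?invr_ge0 ?powR_ge0.
have -> : (((8 * L%:R)%:E * g%:E + (2 * 2 `^ (- j L))%:E * sup_norm tau) * (s * e)%:E =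
    ((8 * L%:R * g + 2 * 2 `^ (- j L) * T) * (s * e))%:E)%E by rewrite TE.
rewrite lee_fin -/s powRN le_eqVlt; apply/orP; left; apply/eqP.
by ring.
Qed.
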